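(* (a) Assume $A=A_{\alpha,\beta}=\alpha\mathbf 1_{s\times s}+(\beta-\alpha)I_s$ with $0<\alpha<\beta$, asymptotically equal block sizes $\gamma_k=1/s$ for all $k$, and $\lVert\sqrt\Gamma\mathcal A\sqrt\Gamma\rVert_2<\zeta_q$. Then, under $\mu_N$ and as $N\to\infty$, the rotated magnetization satisfies $$\hat m\Rightarrow\mathcal N\big(0,\,(qI_s-A/s)^{-1}\otimes I_{q-1}\big).$$ (b) More generally in the block sizes, assume $A$ is a symmetric positive definite $s\times s$ matrix with $A_{j,k}>0$ for all $j,k$, that $\gamma_k>0$ for all $k=1,\dots,s$, and that $\lVert\sqrt\Gamma\mathcal A\sqrt\Gamma\rVert_2<4\frac{q-1}{q}$. Then, under $\mu_N$ and as $N\to\infty$, $$\hat m\Rightarrow\mathcal N\Big(0,\,\big(qI_s-\operatorname{diag}(\gamma)^{1/2}A\operatorname{diag}(\gamma)^{1/2}\big)^{-1}\otimes I_{q-1}\Big).$$ In both cases the covariance matrix is non-singular and strictly positive definite.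
   Context: Block Potts model. Fix integers $s\ge1$ (number of blocks) and $q\ge2$ (number of colors). For each $N\in\mathbb N$ the set $\{1,\dots,N\}$ is partitioned into $s$ non-empty blocks $S_1,\dots,S_s$ (depending on $N$), and the limits $\gamma_k=\lim_{N\to\infty}|S_k|/N$ are assumed to exist. $\mathbf 1_{d\times e}$ is the $d\times e$ all-ones matrix, $\mathbf 1_d=\mathbf 1_{d\times1}$, $I_d$ is the identity matrix, $\otimes$ is the Kronecker product, $e_k\in\mathbb R^s$, $e_c\in\mathbb R^q$ are standard unit vectors, $\lVert\cdot\rVert_2$ is the spectral norm. Let $A$ be the $s\times s$ interaction matrix, $S=\operatorname{diag}(|S_1|,\dots,|S_s|)$, $\mathcal S=S\otimes I_q$, $\mathcal A=A\otimes I_q$, $\Gamma=\lim_{N\to\infty}\mathcal S/N=\operatorname{diag}(\gamma)\otimes I_q$. For $\omega\in\{1,\dots,q\}^N$ the magnetization is the vector $m=m(\omega)\in\mathbb R^{sq}$ with components $m_{k,c}=(e_k\otimes e_c)^Tm=\frac1{|S_k|}\sum_{i\in S_k}\mathbf 1_{\{\omega_i=c\}}$. The Hamiltonian is $H_N(\omega)=-\frac1{2N}m^T\mathcal S\mathcal A\mathcal S m$ and the Gibbs measure on $\{1,\dots,q\}^N$ is $\mu_N(\omega)=\exp(-H_N(\omega))/\sum_{\omega'}\exp(-H_N(\omega'))$. Critical value: $\zeta_q=2\,\frac{q-1}{q-2}\log(q-1)$ for $q\ge3$, and $\zeta_2=2$. Rotated magnetization: let $\tilde R\in SO(q)$ be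 a rotation with $\tilde R\,\frac1{\sqrt q}\mathbf 1_q=e_q$, let $\tilde P$ be the $(q-1)\times q$ matrix projecting onto the first $q-1$ coordinates, and put $\mathcal R=I_s\otimes\tilde P\tilde R$. Then $\hat m=\mathcal R\sqrt{\mathcal S}\,(m-\tfrac1q\mathbf 1_{sq})\in\mathbb R^{s(q-1)}$. The symbol $\Rightarrow$ denotes convergence in distribution (of the law under $\mu_N$) as $N\to\infty$. *)

(* Defs.v *)
From HB Require Import structures.
From mathcomp Require Import all_boot all_order all_algebra.
From mathcomp Require Import mxtens.
From mathcomp Require Import all_classical all_reals all_analysis.
From mathcomp Require Import measurable_realfun.

Set Implicit Arguments.
Unset Strict Implicit.
Unset Printing Implicit Defensive.

Import Order.TTheory GRing.Theory Num.Theory.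
Import numFieldNormedType.Exports.

Local Open Scope classical_set_scope.
Local Open Scope ring_scope.

(* R^d has two carriers below: 'cV[R]_d for linear algebra and topology, and
   d.-tuple R, whose library sigma-algebra is generated by the coordinates,
   i.e. is the Borel sigma-algebra.  col_of_tuple identifies the two. *)
Definition col_of_tuple (R : realType) (d : nat) (t : d.-tuple R) : 'cV[R]_d :=
  \col_i tnth t i.

Section LebesgueRd.
Context {R : realType}.

Local Notation T := (measurableTypeR R).

Definition tuple_cons_pair (d : nat) (p : (d.-tuple T * T)%type) : d.+1.-tuple T :=
  [tuple of p.2 :: p.1].

Lemma measurable_tuple_cons_pair d :
  measurable_fun [set: (d.-tuple T * T)%type] (@tuple_cons_pair d).
Proof. exact: measurable_cons. Qed.

Definition lebesgue_cons d (m : {measure set (d.-tuple T) -> \bar R})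
    : set (d.+1.-tuple T) -> \bar R :=
  pushforward (m \x @lebesgue_measure R)%E (@tuple_cons_pair d).

HB.instance Definition _ d (m : {measure set (d.-tuple T) -> \bar R}) :=
  Measure.copy (lebesgue_cons m)
    (measure_function_pushforward__canonical__measure_function_Measure
       (m \x @lebesgue_measure R)%E (@measurable_tuple_cons_pair d)).

(* Lebesgue measure on R^d, as the d-fold product of lebesgue_measure. *)
Fixpoint lebesgue_tuple (d : nat) : {measure set (d.-tuple T) -> \bar R} :=
  match d with
  | 0 => dirac ([tuple] : 0.-tuple T)
  | d'.+1 => lebesgue_cons (lebesgue_tuple d')
  end.

End LebesgueRd.

Section MultivariateNormal.
Context {R : realType} {d : nat}.
Implicit Types (mean : 'cV[R]_d) (Sigma : 'M[R]_d).

Definition quad_form (M : 'M[R]_d) (x : 'cV[R]_d) : R := (x^T *m M *m x) 0 0.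

Definition mvnormal_pdf mean Sigma (x : 'cV[R]_d) : R :=
  (Num.sqrt ((2 * pi) ^+ d * \det Sigma))^-1 *
  expR (- (quad_form (invmx Sigma) (x - mean) / 2)).

Lemma mvnormal_pdf_ge0 mean Sigma x : 0 <= mvnormal_pdf mean Sigma x.
Proof. by rewrite mulr_ge0 ?invr_ge0 ?sqrtr_ge0 ?expR_ge0. Qed.

Lemma measurable_mvnormal_pdf mean Sigma :
  measurable_fun [set: d.-tuple (measurableTypeR R)]
    (fun t => mvnormal_pdf mean Sigma (col_of_tuple t)).
Proof.
have mcoord i : measurable_fun [set: d.-tuple (measurableTypeR R)]
    (fun t => (col_of_tuple t - mean) i 0).
  rewrite (_ : (fun t => _) = (fun t => tnth t i - mean i 0)); last first.
    by apply/funext => t; rewrite !mxE.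
  by apply: measurable_funB => //; exact: measurable_tnth.
apply: measurable_funM => //.
apply: measurableT_comp => //; apply: measurableT_comp => //.
apply: measurable_funM => //.
rewrite (_ : (fun t => _) = (fun t => \sum_(j < d) (\sum_(i < d)
    (col_of_tuple t - mean) i 0 * invmx Sigma i j)
      * (col_of_tuple t - mean) j 0)); last first.
  apply/funext => t; rewrite /quad_form mxE; apply: eq_bigr => j _.
  by congr (_ * _); rewrite mxE; apply: eq_bigr => i _; rewrite mxE.
apply: measurable_sum => j; apply: measurable_funM => //.
by apply: measurable_sum => i; apply: measurable_funM.
Qed.

(* N(mean, Sigma), for a positive definite covariance matrix Sigma, through its
   density with respect to Lebesgue measure. *)
Definition mvnormal mean Sigma : set (d.-tuple (measurableTypeR R)) -> \bar R :=
  fun V => (\int[lebesgue_tuple d]_(t in V)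
              (mvnormal_pdf mean Sigma (col_of_tuple t))%:E)%E.

Section mvnormal_measure.
Variables (mean : 'cV[R]_d) (Sigma : 'M[R]_d).

Let mvnormal0 : mvnormal mean Sigma set0 = 0%E.
Proof. by rewrite /mvnormal integral_set0. Qed.

Let mvnormal_ge0 A : (0 <= mvnormal mean Sigma A)%E.
Proof. by apply: integral_ge0 => t _; rewrite lee_fin mvnormal_pdf_ge0. Qed.

Let mvnormal_sigma_additive : semi_sigma_additive (mvnormal mean Sigma).
Proof.
move=> A mA tA mUA; rewrite /mvnormal ge0_integral_bigcup//=; last 2 first.
- apply/measurable_EFinP; apply: measurable_funTS.
  exact: measurable_mvnormal_pdf.
- by move=> t _; rewrite lee_fin mvnormal_pdf_ge0.
apply: is_cvg_ereal_nneg_natsum_cond => n _ _.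
by apply: integral_ge0 => t _; rewrite lee_fin mvnormal_pdf_ge0.
Qed.

HB.instance Definition _ := isMeasure.Build _ _ _ (mvnormal mean Sigma)
  mvnormal0 mvnormal_ge0 mvnormal_sigma_additive.

End mvnormal_measure.

Definition posdefmx (M : 'M[R]_d) : Prop :=
  forall x : 'cV[R]_d, x != 0 -> 0 < quad_form M x.

Definition norm2 (x : 'cV[R]_d) : R := Num.sqrt (\sum_i x i 0 ^+ 2).

Definition spectral_norm (M : 'M[R]_d) : R :=
  sup [set norm2 (M *m x) | x in [set x : 'cV[R]_d | norm2 x <= 1]].

(* Convergence in distribution of random vectors X N, each on a finite
   probability space with mass function P N, to the law nu on R^d. *)
Definition cvg_in_distribution (Omega : nat -> finType)
    (P : forall N, Omega N -> R) (X : forall N, Omega N -> 'cV[R]_d)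
    (nu : {measure set (d.-tuple (measurableTypeR R)) -> \bar R}) : Prop :=
  forall f : 'cV[R]_d -> R, continuous f -> (exists C, forall x, `|f x| <= C) ->
    (fun N => \sum_(w : Omega N) P N w * f (X N w)) @ \oo -->
      (\int[nu]_t f (col_of_tuple t)).

End MultivariateNormal.

(* For a diagonal matrix with nonnegative entries the entrywise square root is
   its positive semidefinite square root; used only for such matrices. *)
Notation sqrt_diag_mx := (map_mx Num.sqrt).

Section BlockPotts.
Context {R : realType}.

Definition block_partition (s N : nat) (S : 'I_s -> {set 'I_N}) : Prop :=
  injective S /\ finset.partition (S @: 'I_s)%SET [set: 'I_N]%SET.

Section FixedN.
Variables (s q N : nat) (S : 'I_s -> {set 'I_N}).

Definition block_size_mx : 'M[R]_s := diag_mx (\row_k #|S k|%:R).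

Definition calS : 'M[R]_(s * q) := block_size_mx *t (1%:M : 'M[R]_q).

(* The coordinate i stands for e_k (x) e_c with (k, c) := mxtens_unindex i, as
   in the Kronecker product of the library. *)
Definition magnetization (w : {ffun 'I_N -> 'I_q}) : 'cV[R]_(s * q) :=
  \col_i let: (k, c) := mxtens_unindex i in
    #|S k|%:R^-1 * \sum_(j in S k) (w j == c)%:R.

Definition hamiltonian (A : 'M[R]_s) (w : {ffun 'I_N -> 'I_q}) : R :=
  let m := magnetization w in let calA := A *t (1%:M : 'M[R]_q) in
  - ((2 * N%:R)^-1 * (m^T *m calS *m calA *m calS *m m) 0 0).

Definition gibbs (A : 'M[R]_s) (w : {ffun 'I_N -> 'I_q}) : R :=
  expR (- hamiltonian A w) /
  \sum_(w' : {ffun 'I_N -> 'I_q}) expR (- hamiltonian A w').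

(* pid_mx q.-1 is the projection onto the first q - 1 coordinates. *)
Definition rotated_magnetization (Rot : 'M[R]_q) (w : {ffun 'I_N -> 'I_q}) :
    'cV[R]_(s * q.-1) :=
  ((1%:M : 'M[R]_s) *t ((pid_mx q.-1 : 'M[R]_(q.-1, q)) *m Rot)) *m
  sqrt_diag_mx calS *m (magnetization w - const_mx (q%:R^-1)).

End FixedN.

Definition zeta (q : nat) : R :=
  if q == 2 then 2
  else 2 * ((q%:R - 1) / (q%:R - 2)) * ln (q%:R - 1).

Definition rotation_to_last (q : nat) (Rot : 'M[R]_q) : Prop :=
  [/\ Rot *m Rot^T = 1%:M, \det Rot = 1 &
      Rot *m const_mx ((Num.sqrt q%:R)^-1) = \col_(i < q) (i.+1 == q)%:R].

Definition block_interaction (s : nat) (alpha beta : R) : 'M[R]_s :=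
  alpha *: const_mx 1 + (beta - alpha)%:M.

(* sqrt(Gamma) (A (x) I_q) sqrt(Gamma), Gamma = diag(gamma) (x) I_q *)
Definition limit_interaction (s q : nat) (gamma : 'I_s -> R) (A : 'M[R]_s) :
    'M[R]_(s * q) :=
  let Gamma := diag_mx (\row_k gamma k) *t (1%:M : 'M[R]_q) in
  sqrt_diag_mx Gamma *m (A *t (1%:M : 'M[R]_q)) *m sqrt_diag_mx Gamma.

End BlockPotts.

(* Main.v *)
(* Under the uniform measure on configurations the rotated magnetization X is a
   sum of independent centered vectors, and the Gibbs measure is the tilt of this
   measure by exp (X^T (B_N (x) I) X / 2), where B_N tends to
   B = diag(gamma)^(1/2) A diag(gamma)^(1/2).  By the central limit theorem X is
   asymptotically N(0, q^-1 I), and tilting this Gaussian by the limiting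
   quadratic form gives N(0, (q I - B)^-1 (x) I).

   The tilt is unbounded, so weak convergence has to be complemented by uniform
   integrability: E exp (lam |X|^2 / 2) is bounded for every lam < zeta q.  By
   Hubbard-Stratonovich this reduces to E exp <t, X> <= exp (|t|^2 / (2 zeta q)),
   hence, by independence, to the same bound for a single uniform spin, which is
   dual (Gibbs variational principle) to the relative entropy inequality
   zeta q / 2 * |p - u|^2 <= KL(p | u) for the uniform law u on q colors.

   Since 4 (q - 1) / q <= zeta q <= q, the condition on the spectral norm in
   either part gives B < zeta q <= q, and both parts are the same statement. *)

Require Import Defs.
From HB Require Import structures.
From mathcomp Require Import all_boot all_order all_algebra.
From mathcomp Require Import mxtens.
From mathcomp Require Import all_classical all_reals all_analysis.
From mathcomp Require Import measurable_realfun.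
From mathcomp Require Import ring lra.
From mathcomp Require complex.

Set Implicit Arguments.
Unset Strict Implicit.
Unset Printing Implicit Defensive.

Import Order.TTheory GRing.Theory Num.Theory.
Import numFieldNormedType.Exports.

Local Open Scope classical_set_scope.
Local Open Scope ring_scope.

(** * The moment generating function of one spin *)

(** The constant in the entropy inequality is sharp: equality holds at the uniform law and, for q >=
    3, also at the law giving mass 1 - 1/q to one color and sharing the rest equally. The second
    point of contact excludes a local expansion around the uniform law. The induction on the number
    of colors closes because the removed largest atom is at least 1/q and because zeta q / q is
    nonincreasing.

    Weak convergence is tested on cos (<t, x> + c): the phase c carries the real and imaginary parts
    of the characteristic function at once, and a Gaussian bump is an average of such cosines, so
    mollified test functions are within reach.

    No partition function is computed: the Gibbs mean and the Gaussian mean of f are both written as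
    quotients of unnormalized means of f and of 1. Blocks are known to be non-empty only for N >= s,
    so the probabilistic bounds are required for large N only. *)

Lemma ge0_derive_le (R : realType) (f df : R -> R) (a b : R) : a <= b ->
  (forall x, a <= x <= b -> is_derive x 1 f (df x)) ->
  (forall x, a <= x <= b -> 0 <= df x) -> f a <= f b.
Proof.
move=> ab dfE df0.
have [||c cab fE] := @MVT_segment R f df a b ab.
- by move=> x /[!in_itv]/= /andP[ax xb]; apply: dfE; rewrite !ltW.
- apply: continuous_in_subspaceT => x /[!inE]/= /[!in_itv]/= xab.
  apply: differentiable_continuous; apply/derivable1_diffP.
  by have [] := dfE _ xab.
- rewrite -subr_ge0 fE mulr_ge0 ?subr_ge0//.
  by apply: df0; move: cab; rewrite in_itv.
Qed.

(** The difference of the two sides has derivative [(y - 1)^2 / (y (y + 1)^2)]. At [x = (1 - u) / u]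
    the left side becomes [2 (1 - 2 u)], which settles the case of two colors. *)
Lemma ln_ge_frac (R : realType) (x : R) : 1 <= x -> 2 * (x - 1) / (x + 1) <= ln x.
Proof.
move=> x1.
pose f : R -> R := (@ln R + 4 \*o (fun z => ((id + cst 1) z)^-1))%R.
pose df (y : R) := y^-1 - 4 / (y + 1) ^+ 2.
have : f 1 <= f x.
  apply: (@ge0_derive_le _ f df _ _ x1) => y /andP[y1 yx].
    have y0 : 0 < y by lra.
    have y10 : y + 1 != 0 by rewrite gt_eqF//; lra.
    have dln := is_derive1_ln y0.
    have dV := @is_deriveV _ (id + cst 1) y _ _ y10.
    apply: is_derive_eq.
    rewrite /df /= !fctE /GRing.scale /=; field.
    by rewrite y10 gt_eqF.
  rewrite /df.
  have y0 : 0 < y by lra.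
  suff -> : y^-1 - 4 / (y + 1) ^+ 2 = (y - 1) ^+ 2 / (y * (y + 1) ^+ 2).
    by rewrite divr_ge0 ?sqr_ge0// mulr_ge0 ?sqr_ge0// ltW.
  by field; rewrite !gt_eqF//; lra.
rewrite /f /= !fctE /= ln1 add0r (_ : 1 + 1 = 2 :> R)// => h.
have -> : 2 * (x - 1) / (x + 1) = 2 - 4 / (x + 1) by field; rewrite gt_eqF//; lra.
lra.
Qed.

(** At [x = (1 - w) / w] this is the sign of the derivative in [logit_div_nincr]; at [x = 2] it
    gives [ln 2 <= 3/4], used for [zeta 3]. *)
Lemma ln_le_half_diff (R : realType) (x : R) : 1 <= x -> ln x <= (x - x^-1) / 2.
Proof.
move=> x1.
pose f : R -> R := (2^-1 \*o (id - (fun z => (id z)^-1)) - @ln R)%R.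
pose df (y : R) := (1 + y ^- 2) / 2 - y^-1.
have : f 1 <= f x.
  apply: (@ge0_derive_le _ f df _ _ x1) => y /andP[y1 yx].
    have y0 : 0 < y by lra.
    have y10 : y != 0 by rewrite gt_eqF.
    have dln := is_derive1_ln y0.
    have dV := @is_deriveV _ id y _ _ y10.
    apply: is_derive_eq.
    by rewrite /df /= /GRing.scale /=; field.
  rewrite /df.
  have y0 : y != 0 by rewrite gt_eqF//; lra.
  suff -> : (1 + y ^- 2) / 2 - y^-1 = (1 - y^-1) ^+ 2 / 2.
    by rewrite divr_ge0 ?sqr_ge0.
  by field.
rewrite /f /= !fctE /= ln1 invr1 => h.
lra.
Qed.

(** Because this quotient is monotone, [k (1 - 2 u) - ln ((1 - u) / u)] changes sign at most once on
    (0, 1/2), from negative to positive. A critical point there is therefore a minimum of the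
    function in [kl_bernoulli_min]. *)
Lemma logit_div_nincr (R : realType) (u v : R) : 0 < u -> u <= v -> v < 2^-1 ->
  ln ((1 - v) / v) / (1 - 2 * v) <= ln ((1 - u) / u) / (1 - 2 * u).
Proof.
move=> u0 uv v1.
have lnE w : u <= w <= v -> ln ((1 - w) / w) = ln (1 - w) - ln w.
  move=> /andP[uw wv]; rewrite ln_div// posrE; lra.
pose f : R -> R :=
  ((@ln R - (@ln R \o (cst 1 - id))) * (fun z => ((cst 1 - 2 \*o id) z)^-1))%R.
pose df (w : R) := ((1 - 2 * w) / (w * (1 - w)) - 2 * ln ((1 - w) / w))
                     / (1 - 2 * w) ^+ 2.
have : f u <= f v.
  apply: (@ge0_derive_le _ f df _ _ uv) => w /andP[uw wv].
    have w0 : 0 < w by lra.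
    have w1 : 0 < 1 - w by lra.
    have w2 : 1 - 2 * w != 0 by rewrite gt_eqF//; lra.
    have dln := is_derive1_ln w0.
    have dln1 := is_derive1_ln w1.
    have dlnc : is_derive w 1 (@ln R \o (cst 1 - id)) ((1 - w)^-1 * (0 - 1)).
      exact: is_derive1_comp.
    have dV := @is_deriveV _ (cst 1 - 2 \*o id) w _ _ w2.
    apply: is_derive_eq.
    rewrite /df lnE ?uw// /= !fctE /GRing.scale /=; field.
    by rewrite w2 !gt_eqF.
  have w0 : 0 < w by lra.
  have w1 : 0 < 1 - w by lra.
  rewrite /df divr_ge0 ?sqr_ge0// subr_ge0.
  have /ln_le_half_diff : 1 <= (1 - w) / w by rewrite ler_pdivlMr//; lra.
  suff -> : (1 - w) / w - ((1 - w) / w)^-1 = (1 - 2 * w) / (w * (1 - w)) by lra.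
  by field; rewrite !gt_eqF.
rewrite /f /= !fctE /= => fuv.
rewrite !lnE ?lexx ?uv//; move: fuv.
by rewrite -(opprB (ln v)) -(opprB (ln u)) !mulNr lerN2.
Qed.

(** Both sides are values of one function, invariant under [t -> 1 - t], so [t <= 1/2] may be
    assumed. There the derivative is [k (1 - 2 u) - ln ((1 - u) / u)], and the two conditions on [k]
    make it nonpositive before [p] and nonnegative after. *)
Lemma kl_bernoulli_min (R : realType) (p t k : R) : 0 < p -> p <= 2^-1 ->
  (forall u : R, 0 < u -> u <= p -> k * (1 - 2 * u) <= ln ((1 - u) / u)) ->
  (forall u : R, p <= u -> u <= 2^-1 -> ln ((1 - u) / u) <= k * (1 - 2 * u)) ->
  0 < t < 1 ->
  p * ln p + (1 - p) * ln (1 - p) + k * (p * (1 - p)) <=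
  t * ln t + (1 - t) * ln (1 - t) + k * (t * (1 - t)).
Proof.
move=> p0 p12 kle kge.
wlog t12 : t / t <= 2^-1.
  move=> wlg /andP[t0 t1]; have [t12|t12] := leP t 2^-1; first by rewrite wlg// t0.
  have := wlg (1 - t); rewrite (_ : 1 - (1 - t) = t); last by ring.
  have -> : (1 - t) * ln (1 - t) + t * ln t + k * ((1 - t) * t) =
    t * ln t + (1 - t) * ln (1 - t) + k * (t * (1 - t)) by ring.
  by apply; lra.
move=> /andP[t0 t1].
have [D DE dDE] : exists2 D : R -> R,
    forall u : R, D u = u * ln u + (1 - u) * ln (1 - u) + k * (u * (1 - u)) &
    forall u : R, 0 < u -> u <= 2^-1 ->
      is_derive u 1 D (k * (1 - 2 * u) - ln ((1 - u) / u)).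
  exists (id * @ln R + (cst 1 - id) * (@ln R \o (cst 1 - id))
    + k \*o (id * (cst 1 - id)))%R => [//|u u0 u12].
  have u1 : 0 < 1 - u by lra.
  have dln := is_derive1_ln u0.
  have dln1 := is_derive1_ln u1.
  have dlnc : is_derive u 1 (@ln R \o (cst 1 - id)) ((1 - u)^-1 * (0 - 1)).
    exact: is_derive1_comp.
  apply: is_derive_eq.
  rewrite ln_div ?posrE// /= !fctE /GRing.scale /=; field.
  by rewrite !gt_eqF.
rewrite -!DE; have [pt|/ltW tp] := leP p t.
  apply: (ge0_derive_le pt) => [u /andP[pu ut]|u /andP[pu ut]].
    by apply: dDE; lra.
  by rewrite subr_ge0 kge//; lra.
rewrite -lerN2.
apply: (@ge0_derive_le _ (- D) (fun u => - (k * (1 - 2 * u) - ln ((1 - u) / u))) _ _ tp) => [u /andP[tu up]|u /andP[tu up]].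
  by apply: is_deriveN; apply: dDE; lra.
by rewrite opprB subr_ge0 kle//; lra.
Qed.

(** The right side is the relative entropy, with respect to the uniform law on [n + 2] colors, of
    the law with mass [t] on one color and the rest shared equally; the left side is [zeta / 2]
    times its squared distance to the uniform law. Their difference is the increment from [p] to [t]
    of the function in [kl_bernoulli_min]. *)
Lemma kl_bernoulli (R : realType) (n : nat) (t : R) : 0 < t < 1 ->
  zeta n.+2 / 2 * (n.+2%:R / n.+1%:R) * (t - n.+2%:R^-1) ^+ 2 <=
  t * ln (n.+2%:R * t) + (1 - t) * ln (n.+2%:R * (1 - t) / n.+1%:R) :> R.
Proof.
move=> t01; have /andP[t0 t1] := t01.
pose p : R := n.+2%:R^-1.
have n0 : 0 <= n%:R :> R by rewrite ler0n.
have n1E : n.+1%:R = n%:R + 1 :> R by rewrite -natr1.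
have n2E : n.+2%:R = n%:R + 2 :> R by rewrite -natr1 n1E; ring.
have p0 : 0 < p by rewrite invr_gt0 ltr0n.
have n2p : n.+2%:R * p = 1 by rewrite divff// pnatr_eq0.
have p12 : p <= 2^-1 by rewrite lef_pV2 ?posrE ?ltr0n// ler_nat.
(* [k] makes [p] a critical point. For two colors [p = 1/2] and the quotient is 0/0; its limit at
   1/2 is 2. *)
pose k : R := if n is 0 then 2 else ln ((1 - p) / p) / (1 - 2 * p).
have oddsE : (1 - p) / p = n.+1%:R :> R.
  rewrite /p n1E n2E; field; rewrite gt_eqF//; lra.
have p2 : (0 < n)%N -> p < 2^-1.
  by move=> n_gt0; rewrite ltf_pV2 ?posrE ?ltr0n// ltr_nat.
have kp : k * (1 - 2 * p) = ln ((1 - p) / p).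
  rewrite /k; case: n @p {n0 n1E n2E p0 n2p k} oddsE p12 p2 => [|n] p oddsE p12 p2.
    by rewrite oddsE ln1 /p; lra.
  by rewrite divfK// gt_eqF// subr_gt0; have := p2 isT; lra.
have kE : k = zeta n.+2 / 2 * (n.+2%:R / n.+1%:R).
  rewrite /k /zeta; case: n @p {n0 p0 n2p k kp} n1E n2E oddsE p12 p2 => [|n] p n1E n2E oddsE p12 p2.
    by rewrite /=; field.
  rewrite oddsE /p (_ : n.+3 == 2 = false)// n2E n1E.
  have n0 : 1 <= n.+1%:R :> R by rewrite ler1n.
  rewrite (_ : n.+1%:R + 2 - 1 = n.+1%:R + 1 :> R); last by ring.
  by field; rewrite !gt_eqF//; lra.
have kge u : p <= u -> u <= 2^-1 -> ln ((1 - u) / u) <= k * (1 - 2 * u).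
  move=> pu; rewrite le_eqVlt => /predU1P[->|u12].
    rewrite (_ : (1 - 2^-1) / 2^-1 = 1 :> R); last by field.
    by rewrite ln1 (_ : 1 - 2 * 2^-1 = 0 :> R) ?mulr0//; field.
  have pl : 0 < 1 - 2 * p by lra.
  rewrite -ler_pdivrMr; last by lra.
  rewrite (le_trans (logit_div_nincr p0 pu u12))//.
  by rewrite -kp mulfK// gt_eqF.
have kle u : 0 < u -> u <= p -> k * (1 - 2 * u) <= ln ((1 - u) / u).
  move=> u0 up; have [n_gt0|n_le0] := ltnP 0 n.
    have pl := p2 n_gt0.
    rewrite -ler_pdivlMr; last by lra.
    by rewrite (le_trans _ (logit_div_nincr u0 up pl))// -kp mulfK// gt_eqF//; lra.
  rewrite /k; case: n n_le0 @p {n0 n1E n2E p0 n2p k kp kE oddsE p2 kge} p12 up => // _ p p12 up.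
  have /ln_ge_frac : 1 <= (1 - u) / u by rewrite ler_pdivlMr//; lra.
  suff -> : 2 * ((1 - u) / u - 1) / ((1 - u) / u + 1) = 2 * (1 - 2 * u) by [].
  by field; rewrite gt_eqF//= (_ : 1 - u + u = 1)//; ring.
have := kl_bernoulli_min p0 p12 kle kge t01.
rewrite -kE -/p.
have -> : n.+2%:R * (1 - t) / n.+1%:R = (1 - t) / (1 - p).
  rewrite -oddsE (_ : n.+2%:R = p^-1) ?invrK//.
  by field; rewrite !gt_eqF//; lra.
rewrite lnM ?posrE ?ltr0n// ln_div ?posrE; [|lra|lra].
have -> : ln n.+2%:R = - ln p by rewrite /p lnV ?opprK// posrE ltr0n.
move: kp; rewrite ln_div ?posrE; [|lra|lra] => kp.
have -> : ln (1 - p) = ln p + k * (1 - 2 * p) by lra.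
lra.
Qed.

(** With [x = q - 1] this compares [zeta (q + 1) / (q + 1)] with [zeta q / q]. The bound
    [ln (x + 1) <= ln x + 1 / x] leaves only a lower bound on [ln x], supplied by [ln_ge_frac]; what
    remains is [x^3 - x^2 - x - 1 >= 0], true from [x = 2] on. *)
Lemma zeta_succ_aux (R : realType) (x : R) : 2 <= x ->
  (x + 1) / x * ln (x + 1) * (x + 1) <= (x + 2) * (x / (x - 1) * ln x).
Proof.
move=> x2.
have /ln_ge_frac lnx : 1 <= x by lra.
have lnx1 : ln (x + 1) <= ln x + x^-1.
  rewrite (_ : x + 1 = x * (1 + x^-1)); last by field; rewrite gt_eqF//; lra.
  have xV0 : 0 < x^-1 by rewrite invr_gt0; lra.
  rewrite lnM ?posrE; [|lra|lra].
  by rewrite lerD2l (le_trans (le_ln1Dx _))//; lra.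
rewrite (@le_trans _ _ ((x + 1) / x * (ln x + x^-1) * (x + 1)))//.
  have x10 : 0 <= x + 1 by lra.
  by rewrite ler_wpM2r// ler_wpM2l// divr_ge0//; lra.
rewrite -subr_ge0.
have -> : (x + 2) * (x / (x - 1) * ln x) - (x + 1) / x * (ln x + x^-1) * (x + 1) =
  ((x ^+ 2 + x + 1) * ln x - (x + 1) ^+ 2 * (x - 1) / x) / (x * (x - 1)).
  by field; rewrite !gt_eqF//; lra.
rewrite divr_ge0//; last by rewrite mulr_ge0//; lra.
rewrite subr_ge0 (@le_trans _ _ ((x ^+ 2 + x + 1) * (2 * (x - 1) / (x + 1))))//.
  rewrite -subr_ge0.
  have -> : (x ^+ 2 + x + 1) * (2 * (x - 1) / (x + 1)) - (x + 1) ^+ 2 * (x - 1) / x =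
    (x - 1) * (x ^+ 3 - x ^+ 2 - x - 1) / (x * (x + 1)).
    by field; rewrite !gt_eqF//; lra.
  rewrite divr_ge0//; first by rewrite mulr_ge0//; nra.
  by rewrite mulr_ge0//; lra.
by rewrite ler_wpM2l//; nra.
Qed.

(** This monotonicity of [zeta n / n] is what the entropy induction consumes. The first case is
    separate because [zeta 2] is not an instance of the general formula; it amounts to
    [ln 2 <= 3/4]. *)
Lemma zeta_succ (R : realType) (n : nat) : (2 <= n)%N ->
  n%:R * zeta n.+1 <= n.+1%:R * zeta n :> R.
Proof.
case: n => [//|[//|[_|n _]]].
  rewrite /zeta /= (_ : 3 - 1 = 2 :> R); last by ring.
  have /ln_le_half_diff : 1 <= 2 :> R by lra.
  rewrite (_ : 3 - 2 = 1 :> R); last by ring.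
  rewrite divr1; lra.
rewrite /zeta !eqE /=.
have n0 : 0 <= n%:R :> R by rewrite ler0n.
pose x : R := n%:R + 2.
have -> : n.+3%:R = x + 1 :> R by rewrite -!natr1 /x; ring.
have -> : n.+4%:R = x + 2 :> R by rewrite -!natr1 /x; ring.
have /zeta_succ_aux : 2 <= x by rewrite /x; lra.
rewrite (_ : x + 2 - 1 = x + 1); last by ring.
rewrite (_ : x + 2 - 2 = x); last by ring.
rewrite (_ : x + 1 - 1 = x); last by ring.
rewrite (_ : x + 1 - 2 = x - 1); last by ring.
lra.
Qed.

Lemma zeta_le (R : realType) (n : nat) : (2 <= n)%N -> zeta n <= n%:R :> R.
Proof.
elim: n => [//|[//|[_ _|n IH _]]]; first by rewrite /zeta.
have /zeta_succ nS : (2 <= n.+2)%N by [].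
have n0 : 0 < n.+2%:R :> R by rewrite ltr0n.
rewrite -(ler_pM2l n0) (le_trans (nS _))// mulrC ler_pM2r ?ltr0n//.
exact: IH.
Qed.

Lemma zeta_ge (R : realType) (n : nat) : (2 <= n)%N ->
  4 * (n%:R - 1) / n%:R <= zeta n :> R.
Proof.
case: n => [//|[//|[_|n _]]]; first by rewrite /zeta /=; lra.
rewrite /zeta eqE /=.
have n0 : 0 <= n%:R :> R by rewrite ler0n.
pose x : R := n%:R + 2.
have -> : n.+3%:R = x + 1 :> R by rewrite -!natr1 /x; ring.
have x2 : 2 <= x by rewrite /x; lra.
have /ln_ge_frac lnx : 1 <= x by lra.
rewrite (_ : x + 1 - 1 = x); last by ring.
rewrite (_ : x + 1 - 2 = x - 1); last by ring.
rewrite (@le_trans _ _ (2 * (x / (x - 1)) * (2 * (x - 1) / (x + 1))))//.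
  by rewrite le_eqVlt; apply/orP; left; apply/eqP; field; rewrite !gt_eqF//; lra.
by rewrite ler_wpM2l// mulr_ge0// divr_ge0//; lra.
Qed.

Lemma zeta_gt0 (R : realType) (n : nat) : (2 <= n)%N -> 0 < zeta n :> R.
Proof.
move=> n2; rewrite (lt_le_trans _ (zeta_ge R n2))// divr_gt0// ?ltr0n ?(ltnW n2)//.
by rewrite mulr_gt0// subr_gt0 ltr1n.
Qed.

(* Chain rule for the relative entropy: splitting off the largest atom reduces
   to the two-point inequality and to a distribution on one point less. *)
Lemma kl_uniform (R : realType) (n : nat) (p : 'I_n.+1 -> R) :
  (forall i, 0 < p i) -> \sum_i p i = 1 ->
  zeta n.+1 / 2 * (\sum_i (p i - n.+1%:R^-1) ^+ 2) <=
  \sum_i p i * ln (n.+1%:R * p i).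
Proof.
elim: n p => [|n IH] p p0 p1.
  move: p1; rewrite !big_ord1 => ->.
  by rewrite invr1 subrr expr0n/= mulr0 !mul1r ln1.
(* The largest atom has [t >= 1 / (n + 2)], whence [(1 - t) * zeta (n + 2) <= (n + 1) / (n + 2) *
   zeta (n + 2) <= zeta (n + 1)]. This lets the induction hypothesis absorb the variance [V] of the
   rest. *)
pose i := [arg max_(i > ord0) p i]%O.
have pi j : p j <= p i by rewrite /i; case: arg_maxP => // k _; exact.
pose t := p i.
have sumE (F : 'I_n.+2 -> R) : \sum_j F j = F i + \sum_j F (lift i j).
  by rewrite (bigD1_ord i).
have restE : \sum_j p (lift i j) = 1 - t.
  by move: p1; rewrite sumE -/t => <-; ring.
have t1 : 0 < 1 - t.
  by rewrite -restE big_ord_recl ltr_pwDl// sumr_ge0// => j _; exact: ltW.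
have t01 : 0 < t < 1 by rewrite p0/= -subr_gt0.
have n1 : 0 < n.+1%:R :> R by rewrite ltr0n.
have n2E : n.+2%:R = n.+1%:R + 1 :> R by rewrite natr1.
have n2t : 1 <= n.+2%:R * t.
  rewrite mulr_natl -[n.+2 in leRHS]card_ord -sumr_const -[leLHS]p1.
  exact: ler_sum.
pose p' j := p (lift i j) / (1 - t).
have p'0 j : 0 < p' j by rewrite divr_gt0.
have p'1 : \sum_j p' j = 1 by rewrite -mulr_suml restE divff// gt_eqF.
have p'E j : p (lift i j) = (1 - t) * p' j by rewrite mulrC divfK// gt_eqF.
have := IH p' p'0 p'1.
set K := \sum_j p' j * _; set V := \sum_j (p' j - _) ^+ 2 => KV.
have V0 : 0 <= V by rewrite sumr_ge0// => j _; rewrite sqr_ge0.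
have -> : \sum_j p j * ln (n.+2%:R * p j) =
   t * ln (n.+2%:R * t) + (1 - t) * ln (n.+2%:R * (1 - t) / n.+1%:R) + (1 - t) * K.
  rewrite sumE -/t -addrA; congr (_ + _).
  transitivity (\sum_j ((1 - t) * ln (n.+2%:R * (1 - t) / n.+1%:R) * p' j +
                        (1 - t) * (p' j * ln (n.+1%:R * p' j)))).
    apply: eq_bigr => j _; rewrite p'E.
    have -> : n.+2%:R * ((1 - t) * p' j) =
      (n.+2%:R * (1 - t) / n.+1%:R) * (n.+1%:R * p' j).
      by field; rewrite gt_eqF.
    rewrite [X in _ * X]lnM ?posrE; [ring| |by rewrite mulr_gt0].
    by rewrite divr_gt0// mulr_gt0// ltr0n.
  by rewrite big_split/= -!mulr_sumr p'1 mulr1.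
have -> : \sum_j (p j - n.+2%:R^-1) ^+ 2 =
   n.+2%:R / n.+1%:R * (t - n.+2%:R^-1) ^+ 2 + (1 - t) ^+ 2 * V.
  rewrite sumE -/t.
  have -> : \sum_j (p (lift i j) - n.+2%:R^-1) ^+ 2 =
     \sum_j ((1 - t) ^+ 2 * (p' j - n.+1%:R^-1) ^+ 2 +
       (2 * (1 - t) * ((1 - t) / n.+1%:R - n.+2%:R^-1) * (p' j - n.+1%:R^-1) +
        ((1 - t) / n.+1%:R - n.+2%:R^-1) ^+ 2)).
    by apply: eq_bigr => j _; rewrite p'E; ring.
  have sumc (c : R) : \sum_(j < n.+1) c = n.+1%:R * c.
    by rewrite sumr_const card_ord mulr_natl.
  rewrite !big_split/= -!mulr_sumr -/V sumrB p'1 !sumc n2E; field.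
  by rewrite !gt_eqF//; lra.
rewrite mulrDr mulrA lerD// ?kl_bernoulli//.
rewrite (_ : _ * (_ * V) = (1 - t) * ((1 - t) * (zeta n.+2 / 2) * V)); last by ring.
rewrite ler_pM2l//.
(* With two colors the rest is a point mass and [V = 0]. The comparison of zetas would fail here,
   since the formula gives [zeta 1 = 0]. *)
have [n0|n0] := posnP n.
  suff V_eq0 : V = 0 by move: KV; rewrite V_eq0 !mulr0.
  have V1 m (f : 'I_m.+1 -> R) : m = 0%N -> \sum_j f j = 1 ->
      \sum_j (f j - m.+1%:R^-1) ^+ 2 = 0.
    move=> m0; move: f; rewrite m0 => f; rewrite !big_ord1 => ->.
    by rewrite invr1 subrr expr0n.
  exact: V1.
rewrite (le_trans _ KV)// ler_wpM2r//.
have n3 : (2 <= n.+1)%N by rewrite ltnS.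
have := zeta_succ R n3.
have z1 := zeta_gt0 R n3.
have z2 := zeta_gt0 R (leqW n3).
rewrite n2E in n2t * => zS.
rewrite mulrA ler_pM2r//.
have np : 0 < n.+1%:R + 1 :> R by rewrite -n2E.
have : (1 - t) * (n.+1%:R + 1) * zeta n.+2 <= n.+1%:R * zeta n.+2.
  by rewrite ler_pM2r//; lra.
by rewrite -(ler_pM2r np); lra.
Qed.

(** For weights [p] proportional to [expR (eta i)], the logarithm of the mean is the [p]-average of
    [eta] minus the relative entropy of [p]. As [eta] sums to 0, that average only sees the
    deviation of [p] from uniform, and the entropy inequality subtracts a multiple of the squared
    deviation. *)
Lemma mean_expR_le (R : realType) (n : nat) (eta : 'I_n.+2 -> R) :
  \sum_i eta i = 0 ->
  n.+2%:R^-1 * (\sum_i expR (eta i)) <= expR ((\sum_i eta i ^+ 2) / (2 * zeta n.+2)).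
Proof.
move=> eta0.
pose Z := \sum_i expR (eta i).
have Z0 : 0 < Z.
  by rewrite /Z big_ord_recl ltr_pwDl ?expR_gt0// sumr_ge0// => j _; exact: expR_ge0.
pose p i := expR (eta i) / Z.
have p0 i : 0 < p i by rewrite divr_gt0// expR_gt0.
have p1 : \sum_i p i = 1 by rewrite -mulr_suml divff// gt_eqF.
have n0 : 0 < n.+2%:R :> R by rewrite ltr0n.
have z0 : 0 < zeta n.+2 :> R by rewrite zeta_gt0.
have := kl_uniform p0 p1.
pose L := ln (n.+2%:R^-1 * Z).
have -> : \sum_i p i * ln (n.+2%:R * p i) = \sum_i p i * eta i - L.
  have -> : L = \sum_i p i * L by rewrite -mulr_suml p1 mul1r.
  rewrite -sumrB; apply: eq_bigr => i _.
  rewrite -mulrBr; congr (_ * _).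
  have -> : n.+2%:R * p i = expR (eta i) / (n.+2%:R^-1 * Z).
    by rewrite /p; field; rewrite !gt_eqF.
  by rewrite ln_div ?posrE ?expR_gt0 ?mulr_gt0 ?invr_gt0// expRK.
move=> KL.
rewrite -[leLHS]lnK ?posrE ?mulr_gt0 ?invr_gt0// ler_expR -/L.
have pE : \sum_i (p i - n.+2%:R^-1) * eta i = \sum_i p i * eta i.
  by under eq_bigr do rewrite mulrBl; rewrite sumrB -mulr_sumr eta0 mulr0 subr0.
rewrite -pE in KL.
(* Coordinatewise Legendre transform of a square: [a e - zeta / 2 * a^2 <= e^2 / (2 zeta)]. *)
rewrite (@le_trans _ _ (\sum_i ((p i - n.+2%:R^-1) * eta i - zeta n.+2 / 2 * (p i - n.+2%:R^-1) ^+ 2)))//.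
  by rewrite sumrB -mulr_sumr; lra.
rewrite mulr_suml ler_sum// => i _.
set a := p i - _; set e := eta i; rewrite -subr_ge0.
have -> : e ^+ 2 / (2 * zeta n.+2) - (a * e - zeta n.+2 / 2 * a ^+ 2) =
  (e - zeta n.+2 * a) ^+ 2 / (2 * zeta n.+2) by field; rewrite gt_eqF.
by rewrite divr_ge0 ?sqr_ge0// mulr_ge0 ?ltW.
Qed.

(** * Lebesgue measure and Gaussian integrals on R^d *)

Lemma floor_div_near (R : realType) (n : nat) (x e : R) : n.+1%:R^-1 < e ->
  `|x - (Num.floor (n.+1%:R * x))%:~R / n.+1%:R| < e.
Proof.
move=> ne.
have n0 : 0 < n.+1%:R :> R by rewrite ltr0n.
have /andP[fx1 fx2] := floor_itv (n.+1%:R * x).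
set k := (Num.floor _)%:~R in fx1 *.
have -> : x - k / n.+1%:R = (n.+1%:R * x - k) / n.+1%:R.
  by field; rewrite gt_eqF.
rewrite ger0_norm ?divr_ge0 ?subr_ge0// (le_lt_trans _ ne)//.
rewrite ler_pdivrMr// mulVf ?gt_eqF// lerBlDl addrC.
by move: fx2; rewrite intrD -/k addrC => /ltW.
Qed.

Section LebesgueTuple.
Context {R : realType}.
Local Open Scope ereal_scope.
Local Notation T := (measurableTypeR R).
Local Notation mu := (@lebesgue_measure R).

Definition tuple_uncons d (t : d.+1.-tuple T) : (d.-tuple T * T)%type :=
  ([tuple of behead t], thead t).

Lemma tuple_uncons_cons d (p : (d.-tuple T * T)%type) :
  tuple_uncons (tuple_cons_pair p) = p.
Proof. by case: p => t x; congr pair; apply/val_inj. Qed.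

Lemma measurable_tuple_uncons d :
  measurable_fun [set: d.+1.-tuple T] (@tuple_uncons d).
Proof.
apply: measurable_fun_pair; last exact: measurable_tnth.
apply/measurable_fun_tnthP => i /=.
rewrite (_ : _ \o _ = (@tnth _ T)^~ (lift ord0 i)).
  exact: measurable_tnth.
by apply/funext => t /=; rewrite [in RHS](tuple_eta t) tnthS.
Qed.

Lemma sigma_finite_lebesgue_tuple d : sigma_finite setT (@lebesgue_tuple R d).
Proof.
elim: d => [|d [F FT Foo]].
  exists (fun=> setT) => [|_]; first by rewrite bigcup_const.
  by split => //; rewrite /= diracT ltry.
(* Increasing exhaustions of both factors are taken so that rectangles with one common index cover
   the product. *)
have /sigma_finiteP [G [GT ndG Goo]] := sigma_finiteT mu.
have /sigma_finiteP [H [HT ndH Hoo]] : sigma_finite setT (@lebesgue_tuple R d).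
  by exists F.
exists (fun n => @tuple_uncons d @^-1` (H n `*` G n)).
  apply/seteqP; split => // t _.
  have : [set: d.-tuple T] (tuple_uncons t).1 by [].
  have : [set: T] (tuple_uncons t).2 by [].
  rewrite HT {1}GT => -[k _ Gk] [n _ Hn]; exists (maxn n k) => //; split.
  - by move: Hn; exact/subsetPset/ndH/leq_maxl.
  - by move: Gk; exact/subsetPset/ndG/leq_maxr.
move=> n; have [mH Hlt] := Hoo n; have [mG Glt] := Goo n.
split.
  rewrite -[X in measurable X]setTI.
  by apply: measurable_tuple_uncons => //; exact: measurableX.
rewrite /= /lebesgue_cons /pushforward -comp_preimage.
rewrite (_ : _ \o _ = id); last by apply/funext => p; exact: tuple_uncons_cons.
by rewrite preimage_id product_measure1E// lte_mul_pinfty// ge0_fin_numE.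
Qed.

(* lebesgue_tuple is a Measure structure, not a function carrying one, so its
   sigma-finiteness instance has to be attached to a function alias. *)
Definition lebesgue_tuple_fun d : set (d.-tuple T) -> \bar R :=
  @lebesgue_tuple R d.

HB.instance Definition _ d :=
  Measure.copy (@lebesgue_tuple_fun d) (@lebesgue_tuple R d).

HB.instance Definition _ d :=
  Measure_isSigmaFinite.Build _ _ _ (@lebesgue_tuple_fun d)
    (@sigma_finite_lebesgue_tuple d).

Lemma integral_lebesgue_tupleS d (F : d.+1.-tuple T -> \bar R) :
  measurable_fun setT F -> (forall t, 0 <= F t) ->
  \int[lebesgue_tuple d.+1]_t F t =
  \int[lebesgue_tuple d]_t \int[mu]_x F (tuple_cons_pair (t, x)).
Proof.
move=> mF F0.
have mc := @measurable_tuple_cons_pair R d.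
rewrite -[LHS]/(\int[pushforward (lebesgue_tuple d \x mu) (@tuple_cons_pair R d)]_t F t).
rewrite ge0_integral_pushforward//.
have := @fubini_tonelli1 _ _ _ _ R (@lebesgue_tuple_fun d) mu
  (F \o @tuple_cons_pair R d).
apply.
- exact: measurableT_comp.
- by move=> x; exact: F0.
Qed.
(* f is the pointwise limit of its values at the points with coordinates
   floor(n t_i) / n, which range over a countable set. *)
Lemma measurable_continuous_col d (f : 'cV[R]_d -> R) : continuous f ->
  measurable_fun [set: d.-tuple T] (fun t => f (col_of_tuple t)).
Proof.
move=> cf.
pose fl n (t : d.-tuple T) : {ffun 'I_d -> int} :=
  [ffun i => Num.floor (n.+1%:R * tnth t i)].
pose pt n (k : {ffun 'I_d -> int}) : 'cV[R]_d := \col_i ((k i)%:~R / n.+1%:R)%R.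
apply: (@measurable_fun_cvg _ _ R setT (fun n (t : d.-tuple T) => f (pt n (fl n t)))).
- move=> n _ Y mY; rewrite setTI.
  have -> : (fun t : d.-tuple T => f (pt n (fl n t))) @^-1` Y =
      \bigcup_k [set t | Y (f (pt n k)) /\ forall i, fl n t i = k i].
    apply/seteqP; split => [t /= Yt|t [k _ /= [Yk tk]]] /=.
      by exists (fl n t).
    by have -> : fl n t = k by apply/ffunP.
  apply: countable_bigcupT_measurable => [|k]; first exact: countableP.
  have [Yk|Yk] := pselect (Y (f (pt n k))); last first.
    by rewrite (_ : mkset _ = set0)//; apply/seteqP; split => // t [].
  rewrite (_ : mkset _ = \bigcap_(i in [set: 'I_d]) [set t | fl n t i = k i]).
    apply: fin_bigcap_measurable => // i _.
    rewrite (_ : mkset _ = setT `&` (fun t => n.+1%:R * tnth t i)%R @^-1`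
      `[(k i)%:~R, (k i + 1)%:~R[%classic).
      apply: measurable_funM => //; exact: measurable_tnth.
    apply/seteqP; split => t /=; rewrite in_itv /= /fl ffunE.
      by move=> <-; split=> //; exact: floor_itv.
    by move=> [_ ?]; exact: floor_def.
  apply/seteqP; split => [t [_ h] i _ //=|t h]; split => // i; exact: h.
- move=> t _.
  apply: (cvg_comp (fun n => pt n (fl n t)) f); last exact: cf.
  apply/cvg_ballP => e e0; near=> n; split=> // i j.
  rewrite /ball /= !mxE ffunE floor_div_near//.
  by near: n; exact: (near_infty_natSinv_lt (PosNum e0)).
Unshelve. all: by end_near.
Qed.
End LebesgueTuple.

(** * The Fourier transform of the one-dimensional Gaussian *)

Section Gauss1D.
Context {R : realType}.
Local Notation mu := (@lebesgue_measure R).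
Implicit Types a c m x z : R.

Lemma integral_expR_sqr a m : 0 < a ->
  (\int[mu]_x (expR (- (a / 2 * (x - m) ^+ 2)))%:E = (Num.sqrt (2 * pi / a))%:E)%E.
Proof.
move=> a0; pose s := Num.sqrt a^-1.
have sE : s ^+ 2 = a^-1 by rewrite sqr_sqrtr// invr_ge0 ltW.
have s0 : s != 0 by rewrite gt_eqF// sqrtr_gt0 invr_gt0.
have peakE : normal_peak s = (Num.sqrt (2 * pi / a))^-1.
  by rewrite /normal_peak sE -mulr_natl mulrA mulrAC -mulrA.
have p0 : 0 < Num.sqrt (2 * pi / a).
  by rewrite sqrtr_gt0 divr_gt0// mulr_gt0// pi_gt0.
have := @integral_normal_pdf R m s.
rewrite normal_pdfE//=.
under eq_integral.
  move=> x _; rewrite peakE EFinM /normal_fun sE.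
  rewrite (_ : - (x - m) ^+ 2 / (a^-1 *+ 2) = - (a / 2 * (x - m) ^+ 2)); last first.
    by rewrite -mulr_natl; field; rewrite gt_eqF.
  over.
rewrite ge0_integralZl//=.
- have vV : ((Num.sqrt (2 * pi / a))%:E * ((Num.sqrt (2 * pi / a))^-1)%:E = 1 :> \bar R)%E.
    by rewrite -EFinM divff// gt_eqF.
  by move=> h; rewrite -[LHS]mul1e -[X in (X * _)%E]vV -muleA h mule1.
- apply/measurable_EFinP; apply: measurableT_comp => //.
  apply: measurableT_comp => //; apply: measurable_funM => //.
  by apply: measurable_funX; exact: measurable_funB.
Qed.

Lemma continuous_expR_sqr a : continuous (fun x => expR (- (a / 2 * x ^+ 2))).
Proof.
move=> x; apply: (@continuous_comp _ _ _ (fun x => - (a / 2 * x ^+ 2)) expR).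
  apply: continuousN; apply: continuousM; first exact: cst_continuous.
  exact: exprn_continuous.
exact: continuous_expR.
Qed.

Lemma integrable_gauss_dom a C (h : R -> R) : 0 < a -> continuous h ->
  (forall x, `|h x| <= C * (1 + `|x|)) ->
  mu.-integrable setT (EFin \o (fun x => h x * expR (- (a / 2 * x ^+ 2)))).
Proof.
move=> a0 ch hC.
have a20 : 0 < a / 2 by rewrite divr_gt0.
(* Half of the Gaussian exponent is kept and the other half pays for the linear growth:
   [expR (a x^2 / 4) >= 1 + a x^2 / 4], and [2 + 4 / a] times the latter dominates [1 + |x|]. *)
pose K := `|C| * (2 + 4 / a).
have K0 : 0 <= K by rewrite mulr_ge0// addr_ge0// divr_ge0// ltW.
have mg b : measurable_fun setT (fun x => expR (- (b / 2 * x ^+ 2)) : R).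
  by apply: continuous_measurable_fun; exact: continuous_expR_sqr.
have dom (x : R) : `|h x * expR (- (a / 2 * x ^+ 2))| <=
    `|K * expR (- (a / 2 / 2 * x ^+ 2))|.
  rewrite normrM (ger0_norm (expR_ge0 _)).
  rewrite [leRHS]ger0_norm; last exact: mulr_ge0 K0 (expR_ge0 _).
  have -> : - (a / 2 * x ^+ 2) = - (a / 2 / 2 * x ^+ 2) - (a / 4 * x ^+ 2) by field.
  rewrite expRD mulrCA [leRHS]mulrC ler_wpM2l ?expR_ge0//.
  rewrite expRN ler_pdivrMr ?expR_gt0//.
  rewrite (le_trans (hC x))// (@le_trans _ _ (`|C| * (1 + `|x|)))//.
    by rewrite ler_wpM2r ?addr_ge0// ler_norm.
  rewrite /K -[leRHS]mulrA ler_wpM2l//.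
  have a4 : 0 <= 4 / a by rewrite divr_ge0// ltW.
  have a24 : 0 <= 2 + 4 / a by rewrite addr_ge0.
  rewrite (@le_trans _ _ ((2 + 4 / a) * (1 + a / 4 * x ^+ 2)))//; last first.
    by rewrite ler_wpM2l// expR_ge1Dx.
  have -> : (2 + 4 / a) * (1 + a / 4 * x ^+ 2) =
    2 + 4 / a + a / 2 * x ^+ 2 + `|x| ^+ 2.
    by rewrite real_normK ?num_real//; field; rewrite gt_eqF.
  have ax : 0 <= a / 2 * x ^+ 2 by rewrite mulr_ge0 ?sqr_ge0// ltW.
  have : 0 <= (`|x| - 1) ^+ 2 by rewrite sqr_ge0.
  by nra.
apply: (@le_integrable _ _ _ mu _ measurableT _
  (EFin \o (fun x : R => K * expR (- (a / 2 / 2 * x ^+ 2))))).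
- apply/measurable_EFinP; apply: measurable_funM; last exact: mg.
  exact: continuous_measurable_fun.
- by move=> x _; rewrite /= lee_fin dom.
- apply/integrableP; split.
    by apply/measurable_EFinP; apply: measurable_funM; [exact: measurable_cst|exact: mg].
  under eq_integral.
    move=> x _ /=.
    rewrite ger0_norm; last exact: mulr_ge0 K0 (expR_ge0 _).
    rewrite EFinM -[X in X ^+ 2]subr0; over.
  rewrite ge0_integralZl//=; last first.
    by apply/measurable_EFinP; under eq_fun do rewrite subr0; exact: mg.
  by rewrite integral_expR_sqr// -EFinM ltry.
Qed.

Lemma is_derive_sin_gauss a z c x :
  is_derive x 1 (fun x => sin (z * x + c) * expR (- (a / 2 * x ^+ 2)))
    ((z * cos (z * x + c) - a * x * sin (z * x + c)) * expR (- (a / 2 * x ^+ 2))).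
Proof.
have d1 : is_derive x 1 (z \*o id + cst c) z.
  by apply: is_derive_eq; rewrite addr0 /GRing.scale /= mulr1.
have d2 := @is_derive1_comp _ sin _ _ _ _ (is_derive_sin _) d1.
have d3 : is_derive x 1 (- (a / 2) \*o (id ^+ 2)) (- (a * x)).
  by apply: is_derive_eq; rewrite /GRing.scale /=; field.
have d4 := @is_derive1_comp _ expR _ _ _ _ (is_derive_expR _) d3.
have := @is_deriveM _ _ _ _ _ _ _ _ d2 d4.
rewrite (_ : _ * _ = fun x => sin (z * x + c) * expR (- (a / 2 * x ^+ 2))); last first.
  by apply/funext => y; rewrite /= !fctE /= mulNr.
by move=> d5; apply: is_derive_eq; rewrite /GRing.scale /= !fctE /= !mulNr; ring.
Qed.

Lemma continuous_trig_affine (trig : R -> R) z c : continuous trig ->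
  continuous (fun x => trig (z * x + c)).
Proof.
move=> ct x; apply: (@continuous_comp _ _ _ (fun x => z * x + c) trig); last exact: ct.
apply: continuousD; last exact: cst_continuous.
by apply: continuousM => //; exact: cst_continuous.
Qed.

Lemma integrable_cos_gauss a z c : 0 < a ->
  mu.-integrable setT (EFin \o (fun x => cos (z * x + c) * expR (- (a / 2 * x ^+ 2)))).
Proof.
move=> a0; apply: (@integrable_gauss_dom _ 1) => //.
  exact/continuous_trig_affine/continuous_cos.
by move=> x; rewrite mul1r (le_trans (cos_max _))// lerDl.
Qed.

Lemma integrable_xsin_gauss a z c : 0 < a ->
  mu.-integrable setT (EFin \o (fun x => x * sin (z * x + c) * expR (- (a / 2 * x ^+ 2)))).
Proof.
move=> a0; apply: (@integrable_gauss_dom _ 1 (fun x => x * sin (z * x + c))) => //.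
  by move=> x; apply: continuousM => //; exact/continuous_trig_affine/continuous_sin.
move=> x; rewrite mul1r normrM.
rewrite (@le_trans _ _ `|x|)//; last by rewrite lerDr.
by rewrite ler_piMr// sin_max.
Qed.

(** The two sides differ by the integral of the derivative of [sin (z x + c) expR (- a x^2 / 2)].
    Over a symmetric interval this is a boundary term, which tends to 0 as the interval grows, and
    dominated convergence passes to the whole line. *)
Lemma Rintegral_gauss_by_parts a z c : 0 < a ->
  a * \int[mu]_x (x * sin (z * x + c) * expR (- (a / 2 * x ^+ 2))) =
  z * \int[mu]_x (cos (z * x + c) * expR (- (a / 2 * x ^+ 2))).
Proof.
move=> a0.
pose g x := expR (- (a / 2 * x ^+ 2)).
pose F x := sin (z * x + c) * g x.
pose f x := (z * cos (z * x + c) - a * x * sin (z * x + c)) * g x.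
have dF x : is_derive x 1 F (f x) by exact: is_derive_sin_gauss.
have fE x : f x = z * (cos (z * x + c) * g x) - a * (x * sin (z * x + c) * g x).
  by rewrite /f; ring.
have Ic := integrable_cos_gauss z c a0; have Is := integrable_xsin_gauss z c a0.
have If : mu.-integrable setT (EFin \o f).
  rewrite (_ : EFin \o f = (fun x => z%:E * (cos (z * x + c) * g x)%:E -
      a%:E * (x * sin (z * x + c) * g x)%:E)%E).
    by apply: integrableB => //; exact: integrableZl.
  by apply/funext => x; rewrite /= fE EFinB !EFinM.
have cf : continuous f.
  move=> x; apply: (@continuousM _ _ (fun x => z * cos (z * x + c) - a * x * sin (z * x + c)) g); last exact: continuous_expR_sqr.
  apply: continuousB; apply: continuousM.
  - exact: cst_continuous.
  - exact/continuous_trig_affine/continuous_cos.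
  - by apply: continuousM => //; exact: cst_continuous.
  - exact/continuous_trig_affine/continuous_sin.
have cF x : {for x, continuous F}.
  by apply: differentiable_continuous; apply/derivable1_diffP; have [] := dF x.
suff f0 : \int[mu]_x f x = 0.
  apply/eqP; rewrite eq_sym -subr_eq0 -!RintegralZl// -RintegralB//.
  - by rewrite -[X in _ == X]f0; apply/eqP/eq_Rintegral => x _; rewrite fE.
  - by apply: eq_integrable (integrableZl measurableT z Ic) => // x _; rewrite /= EFinM.
  - by apply: eq_integrable (integrableZl measurableT a Is) => // x _; rewrite /= EFinM.
pose D n : set R := `[- n.+1%:R, n.+1%:R]%classic.
have FTC n : (\int[mu]_(x in D n) (f x)%:E)%E = (F n.+1%:R - F (- n.+1%:R))%:E.
  rewrite EFinB; apply: continuous_FTC2.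
  - by rewrite (@lt_trans _ _ 0)// ?oppr_lt0 ltr0n.
  - exact: continuous_subspaceT.
  - split => [x _||]; first by have [] := dF x.
      exact/cvg_at_right_filter/cF.
    exact/cvg_at_left_filter/cF.
  - by move=> x _; rewrite derive1E; have [] := dF x.
(* Any rate tending to 0 is enough; [expR y >= 1 + y] gives the square of the harmonic rate, and one
   factor is dropped. *)
have g_le n : g n.+1%:R <= 2 / a * harmonic n.
  have n1 : 1 <= n.+1%:R :> R by rewrite ler1n.
  rewrite /g expRN /harmonic.
  rewrite -[leRHS]invrK lef_pV2 ?posrE ?expR_gt0 ?invr_gt0 ?mulr_gt0 ?invr_gt0 ?ltr0n//.
  rewrite (le_trans _ (expR_ge1Dx _))// invfM invf_div invrK.
  have a20 : 0 <= a / 2 by rewrite divr_ge0// ltW.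
  rewrite -[leLHS]add0r lerD// ler_wpM2l//.
  by rewrite expr2 ler_peMl// (le_trans _ n1).
have lim0 : (fun n => F n.+1%:R - F (- n.+1%:R)) @ \oo --> (0 : R).
  apply: (@squeeze_cvgr _ _ _ _ (fun n => - (4 / a * harmonic n)) (fun n => 4 / a * harmonic n)).
  - near=> n; rewrite -ler_norml.
    rewrite (le_trans (ler_normB _ _))//.
    have Fg x : `|F x| <= g x.
      by rewrite normrM (ger0_norm (expR_ge0 _)) ler_piMl ?expR_ge0// sin_max.
    have -> : 4 / a * harmonic n = 2 / a * harmonic n + 2 / a * harmonic n.
      by rewrite -mulrDl -mulrDl; congr (_ / _ * _); ring.
    rewrite lerD// (le_trans (Fg _))//.
    by rewrite /g sqrrN; exact: g_le.
  - rewrite -[X in _ --> X]oppr0 -(mulr0 (4 / a)); apply: cvgN; apply: cvgMr.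
    exact: cvg_harmonic.
  - by rewrite -(mulr0 (4 / a)); apply: cvgMr; exact: cvg_harmonic.
have limf : (fun n => (\int[mu]_(x in D n) (f x)%:E)%E) @ \oo --> (\int[mu]_x (f x)%:E)%E.
  rewrite (_ : (fun n => _) = fun n => (\int[mu]_x ((EFin \o f) \_ (D n)) x)%E); last first.
    by apply/funext => n; rewrite integral_mkcond.
  have /integrableP[mf _] := If.
  apply: (@dominated_cvg _ _ _ mu _ measurableT
    (fun n => (EFin \o f) \_ (D n)) (EFin \o f) (fun x : R => (`|f x|)%:E)) => //.
  - move=> n; apply/(measurable_restrictT _ _).1.
      by rewrite /D; exact: measurable_itv.
    exact: measurable_funTS.
  - move=> x _; apply: cvg_near_cst; near=> n.
    rewrite patchE ifT// inE /D /= in_itv /= -ler_norml.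
    rewrite (@le_trans _ _ n%:R) ?ler_nat//.
    by near: n; exact: nbhs_infty_ger.
  - by rewrite (_ : (fun x => _) = abse \o (EFin \o f))//; exact: integrable_abse.
  - move=> n x _; rewrite patchE; case: ifP => _ //=.
    by rewrite normr0 lee_fin.
have limE : (\int[mu]_x (f x)%:E)%E = 0%:E.
  apply: (cvg_unique _ limf).
    exact: ereal_hausdorff.
  rewrite (_ : (fun n => _) = EFin \o (fun n => F n.+1%:R - F (- n.+1%:R))).
    by apply: cvg_EFin; [exact: nearW|exact: lim0].
  by apply/funext => n; exact: FTC.
by rewrite /Rintegral limE.
Unshelve. all: by end_near.
Qed.

(** Differentiating under the integral brings down [- x sin], and the integration by parts turns
    this into the linear equation [F' = - (z / a) F]. *)
Lemma is_derive_gauss_cos a c z : 0 < a ->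
  is_derive z 1
    (fun z => \int[mu]_x (cos (z * x + c) * expR (- (a / 2 * x ^+ 2))))
    (- (z / a) * \int[mu]_x (cos (z * x + c) * expR (- (a / 2 * x ^+ 2)))).
Proof.
move=> a0.
pose f z x := cos (z * x + c) * expR (- (a / 2 * x ^+ 2)).
pose G x := `|x| * expR (- (a / 2 * x ^+ 2)).
have df x y : is_derive x 1 (f^~ y) (- (y * sin (x * y + c) * expR (- (a / 2 * y ^+ 2)))).
  have d1 : is_derive x 1 (y \*o id + cst c) y.
    by apply: is_derive_eq; rewrite addr0 /GRing.scale /= mulr1.
  have d2 := @is_derive1_comp _ cos _ _ _ _ (is_derive_cos _) d1.
  have d3 := @is_deriveZ _ _ _ _ (expR (- (a / 2 * y ^+ 2))) _ _ _ d2.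
  rewrite (_ : f^~ y = expR (- (a / 2 * y ^+ 2)) \*: (cos \o (y \*o id + cst c))); last first.
    by apply/funext => w; rewrite /f /= !fctE /= mulrC [w * y]mulrC.
  apply: is_derive_eq.
  by rewrite /GRing.scale /= !fctE /= [x * y]mulrC; ring.
have IG : mu.-integrable setT (EFin \o G).
  apply: (@integrable_gauss_dom a 1 (fun x => `|x|) a0).
    by move=> x; exact: norm_continuous.
  by move=> x; rewrite mul1r normr_id lerDr.
have G0 y : 0 <= G y by rewrite mulr_ge0// expR_ge0.
have dG x y : `|partial1of2 f x y| <= G y.
  rewrite partial1of2E; have [_ ->] := df x y.
  rewrite normrN normrM (ger0_norm (expR_ge0 _)) ler_wpM2r ?expR_ge0//.
  by rewrite normrM ler_piMr// sin_max.
have zI : `]z - 1, z + 1[%classic z by rewrite /= in_itv/= ltrBlDr ltrDl ltr01.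
have If x : `]z - 1, z + 1[%classic x -> mu.-integrable setT (EFin \o f x).
  by move=> _; exact: integrable_cos_gauss.
have Df x y : `]z - 1, z + 1[%classic x -> setT y -> derivable (f^~ y) x 1.
  by move=> _ _; have [] := df x y.
have := @derivable_under_integral R _ _ mu f setT measurableT z _ _ zI If Df G G0 IG (fun x y _ _ => dG x y).
have := @differentiation_under_integral R _ _ mu f setT measurableT z _ _ zI If Df G G0 IG (fun x y _ _ => dG x y).
rewrite derive1E => d1 d2; apply: DeriveDef; first exact: d2.
rewrite d1.
have -> : \int[mu]_y partial1of2 f z y =
    \int[mu]_y (-1 * (y * sin (z * y + c) * expR (- (a / 2 * y ^+ 2)))).
  by apply: eq_Rintegral => y _; rewrite partial1of2E; have [_ ->] := df z y; rewrite mulN1r.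
rewrite RintegralZl//; last exact: integrable_xsin_gauss.
apply: (@mulfI _ a); first by rewrite gt_eqF.
rewrite mulrCA Rintegral_gauss_by_parts//.
by field; rewrite gt_eqF.
Qed.

(** The equation [F' = - (z / a) F] makes [F z * expR (z^2 / (2 a))] constant, and [z = 0] evaluates
    it. *)
Lemma Rintegral_gauss_cos a c z : 0 < a ->
  \int[mu]_x (cos (z * x + c) * expR (- (a / 2 * x ^+ 2))) =
  Num.sqrt (2 * pi / a) * expR (- (z ^+ 2 / (2 * a))) * cos c.
Proof.
move=> a0.
pose F z := \int[mu]_x (cos (z * x + c) * expR (- (a / 2 * x ^+ 2))).
pose K := F * (expR \o ((2 * a)^-1 \*o (id ^+ 2))).
have dK x : is_derive x 1 K 0.
  have dF := is_derive_gauss_cos c x a0.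
  have d3 : is_derive x 1 ((2 * a)^-1 \*o (id ^+ 2)) (x / a).
    by apply: is_derive_eq; rewrite /GRing.scale /=; field; rewrite gt_eqF.
  have d4 := @is_derive1_comp _ expR _ _ _ _ (is_derive_expR _) d3.
  have := @is_deriveM _ _ _ _ _ _ _ _ dF d4.
  by move=> d5; apply: is_derive_eq; rewrite /GRing.scale /= -/(F x); ring.
have := @is_derive_0_is_cst _ K z 0 dK.
rewrite /K !fctE /= expr0n /= mulr0 expR0 mulr1.
have -> : F 0 = Num.sqrt (2 * pi / a) * cos c.
  rewrite /F /Rintegral.
  have -> : (\int[mu]_x (cos (0 * x + c) * expR (- (a / 2 * x ^+ 2)))%:E)%E =
            (\int[mu]_x ((cos c)%:E * (expR (- (a / 2 * (x - 0) ^+ 2)))%:E))%E.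
    by apply: eq_integral => x _; rewrite mul0r add0r subr0 EFinM.
  rewrite integralZl//; last first.
    have := integrable_cos_gauss 0 0 a0; apply: eq_integrable => // x _ /=.
    by rewrite mul0r add0r cos0 mul1r subr0.
  by rewrite integral_expR_sqr// -EFinM /= mulrC.
move=> KE; rewrite -/(F z) expRN.
rewrite mulrAC -KE [z ^+ 2 / _]mulrC mulfK//.
by rewrite gt_eqF// expR_gt0.
Qed.

(** Adding 1 to a cosine with coefficient [|r| <= 1] keeps the integrand nonnegative, the form in
    which Tonelli integrates out coordinates in [integral_gauss_cos]. *)
Lemma integral_gauss_1Dcos a c z r : 0 < a -> `|r| <= 1 ->
  (\int[mu]_x ((1 + r * cos (z * x + c)) * expR (- (a / 2 * x ^+ 2)))%:E =
  (Num.sqrt (2 * pi / a) * (1 + r * (expR (- (z ^+ 2 / (2 * a))) * cos c)))%:E)%E.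
Proof.
move=> a0 r1.
have I1 : mu.-integrable setT (EFin \o (fun x => expR (- (a / 2 * x ^+ 2)))).
  have := integrable_cos_gauss 0 0 a0; apply: eq_integrable => // x _ /=.
  by rewrite mul0r add0r cos0 mul1r.
have I2 := integrable_cos_gauss z c a0.
rewrite (_ : (fun x : R => _) = (fun x => (expR (- (a / 2 * x ^+ 2)))%:E +
   r%:E * (cos (z * x + c) * expR (- (a / 2 * x ^+ 2)))%:E)%E); last first.
  by apply/funext => x; rewrite -EFinM -EFinD; congr EFin; ring.
rewrite integralD//=; last exact: integrableZl.
rewrite integralZl//.
rewrite -[X in (_ + _ * X)%E]fineK; last exact: integrable_fin_num I2.
rewrite -/(Rintegral mu setT _) Rintegral_gauss_cos//.
have := integral_expR_sqr 0 a0; under eq_integral do rewrite subr0.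
by move=> ->; rewrite -EFinM -EFinD; congr EFin; ring.
Qed.

End Gauss1D.

(** * Continuous functions and quadratic forms on R^d *)

Section ContinuousReal.
Context {R : realType} {T : topologicalType}.
Implicit Types f g : T -> R.

Lemma continuous_cstR (c : R) : continuous (fun _ : T => c).
Proof. exact: cst_continuous. Qed.

Lemma continuous_addR f g :
  continuous f -> continuous g -> continuous (fun t => f t + g t).
Proof. by move=> cf cg t; apply: continuousD; [exact: cf|exact: cg]. Qed.

Lemma continuous_oppR f : continuous f -> continuous (fun t => - f t).
Proof. by move=> cf t; apply: continuousN; exact: cf. Qed.

Lemma continuous_mulR f g :
  continuous f -> continuous g -> continuous (fun t => f t * g t).
Proof. by move=> cf cg t; apply: continuousM; [exact: cf|exact: cg]. Qed.

Lemma continuous_compR (h : R -> R) f :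
  continuous h -> continuous f -> continuous (fun t => h (f t)).
Proof. by move=> ch cf t; apply: (@continuous_comp _ _ _ f h); [exact: cf|exact: ch]. Qed.

Lemma continuous_sum (I : Type) (r : seq I) (F : I -> T -> R) :
  (forall i, continuous (F i)) -> continuous (fun t => \sum_(i <- r) F i t).
Proof.
move=> cF; apply: continuous_big => //.
by move=> x; exact: add_continuous.
Qed.

End ContinuousReal.

Section QuadForm.
Context {R : realType} {d : nat}.
Implicit Types (M : 'M[R]_d) (x y : 'cV[R]_d).

Definition nsq x : R := \sum_i x i 0 ^+ 2.

Definition dotp x y : R := \sum_i x i 0 * y i 0.

Lemma quad_formE M x : quad_form M x = \sum_i \sum_j x i 0 * M i j * x j 0.
Proof.
rewrite /quad_form mxE exchange_big /=; apply: eq_bigr => j _.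
by rewrite mxE mulr_suml; apply: eq_bigr => i _; rewrite mxE.
Qed.

Lemma quad_form_scalar (a : R) x : quad_form a%:M x = a * nsq x.
Proof.
rewrite quad_formE mulr_sumr; apply: eq_bigr => i _.
rewrite (bigD1 i)//= big1 ?addr0 => [|j ji]; rewrite !mxE ?eqxx ?mulr1n; first by ring.
by rewrite eq_sym (negbTE ji) mulr0n mulr0 mul0r.
Qed.

Lemma nsq_ge0 x : 0 <= nsq x.
Proof. by apply: sumr_ge0 => i _; rewrite sqr_ge0. Qed.

Lemma nsq_gt0 x : x != 0 -> 0 < nsq x.
Proof.
move=> x0; rewrite lt_neqAle nsq_ge0 andbT eq_sym; apply: contraNneq x0.
move=> /psumr_eq0P x0; apply/eqP/colP => i; rewrite mxE.
by apply/eqP; rewrite -sqrf_eq0 x0// => j _; exact: sqr_ge0.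
Qed.

Lemma continuous_quad_form M : continuous (quad_form M).
Proof.
rewrite (_ : quad_form M = fun x => \sum_i \sum_j x i 0 * M i j * x j 0); last first.
  by apply/funext => x; rewrite quad_formE.
apply: continuous_sum => i; apply: continuous_sum => j.
apply: continuous_mulR; last exact: coord_continuous.
by apply: continuous_mulR; [exact: coord_continuous|exact: continuous_cstR].
Qed.

Lemma continuous_gauss_quad M y :
  continuous (fun x => expR (- (quad_form M (x - y) / 2))).
Proof.
apply: continuous_compR; first exact: continuous_expR.
apply: continuous_oppR; apply: continuous_mulR; last exact: continuous_cstR.
move=> x; apply: (@continuous_comp _ _ _ (fun x => x - y) (quad_form M)).
  by apply: continuousB => //; exact: cst_continuous.
exact: continuous_quad_form.
Qed.

Lemma nsqE : nsq = quad_form 1%:M.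
Proof. by apply/funext => x; rewrite quad_form_scalar mul1r. Qed.

Lemma continuous_nsq : continuous nsq.
Proof. by rewrite nsqE; exact: continuous_quad_form. Qed.

Lemma continuous_expR_nsq (a : R) :
  continuous (fun x => expR (- (a / 2 * nsq x))).
Proof.
apply: continuous_compR; first exact: continuous_expR.
apply: continuous_oppR; apply: continuous_mulR; first exact: continuous_cstR.
exact: continuous_nsq.
Qed.

Lemma continuous_dotp x : continuous (dotp x).
Proof.
apply: continuous_sum => i.
by apply: continuous_mulR; [exact: continuous_cstR|exact: coord_continuous].
Qed.

End QuadForm.

(** * The Schur complement of the first diagonal entry *)

Section SchurStep.
Context {R : realType} {d : nat}.
Variable Q : 'M[R]_d.+1.
Hypotheses (Qsym : Q^T = Q) (Qpos : posdefmx Q).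

Let b (i : 'I_d) := Q (lift 0 i) 0.

Definition schur : 'M[R]_d :=
  \matrix_(i, j) (Q (lift 0 i) (lift 0 j) - Q (lift 0 i) 0 * Q (lift 0 j) 0 / Q 0 0).

Lemma posdef_entry00_gt0 : 0 < Q 0 0.
Proof.
pose e : 'cV[R]_d.+1 := delta_mx 0 0.
have e0 : e != 0.
  by apply/eqP => /matrixP /(_ 0 0) /eqP; rewrite !mxE !eqxx oner_eq0.
have := Qpos e0; rewrite quad_formE (bigD1 0)//= [X in _ + X]big1 ?addr0 => [|i i0].
  rewrite (bigD1 0)//= big1 ?addr0 => [|i i0]; rewrite !mxE ?eqxx ?mul1r ?mulr1//.
  by rewrite (negbTE i0) mulr0.
by rewrite big1 // => j _; rewrite !mxE (negbTE i0) !mul0r.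
Qed.

(** This completes the square in the first coordinate. [y] is tied to [x] only through its entries,
    so the identity serves both a translated tuple and a vector built from [y]. *)
Lemma quad_form_schur (x : 'cV[R]_d.+1) (y : 'cV[R]_d) :
  (forall i, y i 0 = x (lift 0 i) 0) ->
  quad_form Q x =
  Q 0 0 * (x 0 0 + (\sum_i Q (lift 0 i) 0 * y i 0) / Q 0 0) ^+ 2 + quad_form schur y.
Proof.
move=> yE; have q0 := posdef_entry00_gt0.
have QE i : Q 0 (lift 0 i) = Q (lift 0 i) 0 by rewrite -[in LHS]Qsym mxE.
set B := \sum_i _.
rewrite !quad_formE big_ord_recl big_ord_recl.
under [X in _ + _ + X]eq_bigr do rewrite big_ord_recl.
rewrite big_split /=.
have -> : \sum_i x 0 0 * Q 0 (lift 0 i) * x (lift 0 i) 0 = x 0 0 * B.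
  by rewrite mulr_sumr; apply: eq_bigr => i _; rewrite QE yE; ring.
have -> : \sum_i x (lift 0 i) 0 * Q (lift 0 i) 0 * x 0 0 = x 0 0 * B.
  by rewrite mulr_sumr; apply: eq_bigr => i _; rewrite yE; ring.
have -> : \sum_i \sum_j y i 0 * schur i j * y j 0 =
    \sum_i \sum_j x (lift 0 i) 0 * Q (lift 0 i) (lift 0 j) * x (lift 0 j) 0 - B ^+ 2 / Q 0 0.
  rewrite expr2 /B mulr_suml mulr_suml -sumrB; apply: eq_bigr => i _.
  rewrite mulr_sumr mulr_suml -sumrB; apply: eq_bigr => j _.
  by rewrite !mxE -!yE; ring.
by field; rewrite gt_eqF.
Qed.

Lemma trmx_schur : schur^T = schur.
Proof.
apply/matrixP => i j; rewrite !mxE; congr (_ - _); last by ring.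
by rewrite -[in LHS]Qsym mxE.
Qed.

Lemma posdef_schur : posdefmx schur.
Proof.
move=> y y0.
(* The first coordinate is chosen to annihilate the square, so that [Q] at [x] equals its complement
   at [y]. *)
pose x : 'cV[R]_d.+1 := \col_i if unlift 0 i is Some j then y j 0
  else - ((\sum_i Q (lift 0 i) 0 * y i 0) / Q 0 0).
have yE i : y i 0 = x (lift 0 i) 0 by rewrite mxE liftK.
have x0 : x != 0.
  apply: contraNneq y0 => x0; apply/eqP/colP => i.
  by rewrite yE x0 !mxE.
have := Qpos x0; rewrite (quad_form_schur yE).
by rewrite [x 0 0]mxE unlift_none addNr expr0n mulr0 add0r.
Qed.

Lemma det_schur : \det Q = Q 0 0 * \det schur.
Proof.
have q0 := posdef_entry00_gt0.
pose Q' : 'M[R]_(1 + d) := Q.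
(* One step of Gaussian elimination: [L] clears the first column of [Q] below the pivot. *)
pose L : 'M[R]_(1 + d) := block_mx 1%:M 0 (- (Q 0 0)^-1 *: dlsubmx Q') 1%:M.
have detL : \det L = 1 by rewrite det_lblock !det1 mulr1.
have LQ : L *m Q' = block_mx (Q 0 0)%:M (ursubmx Q') 0 schur.
  rewrite -{1}(submxK Q') mulmx_block !mul1mx !mul0mx !addr0.
  have ulE : ulsubmx Q' = (Q 0 0)%:M.
    apply/matrixP => i j; rewrite !ord1 !mxE eqxx mulr1n.
    by congr (Q _ _); apply/val_inj.
  congr block_mx => //.
    rewrite ulE -scalemxAl mul_mx_scalar scalerA mulNr mulVf ?gt_eqF//.
    by rewrite scaleN1r addNr.
  apply/matrixP => i j; rewrite !mxE big_ord1 !mxE.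
  have lE k : rshift 1 k = lift 0 k :> 'I_(1 + d) by apply/val_inj.
  have -> : lshift d 0 = 0 :> 'I_(1 + d) by apply/val_inj.
  rewrite !lE /Q' -[Q 0 (lift 0 j)]/(Q 0 (lift 0 j)).
  have -> : Q 0 (lift 0 j) = Q (lift 0 j) 0 by rewrite -[in LHS]Qsym mxE.
  by field; rewrite gt_eqF.
have := det_mulmx L Q'; rewrite LQ detL mul1r => <-.
by rewrite det_ublock det_scalar1.
Qed.

End SchurStep.

(** * Gaussian integrals in d dimensions, by induction on d *)

Section GaussDD.
Context {R : realType}.
Local Notation T := (measurableTypeR R).
Local Notation mu := (@lebesgue_measure R).

Lemma col_of_tuple_cons0 d (t : d.-tuple T) (x : T) j :
  col_of_tuple (tuple_cons_pair (t, x)) 0 j = x.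
Proof. by rewrite mxE. Qed.

Lemma col_of_tuple_consS d (t : d.-tuple T) (x : T) i j :
  col_of_tuple (tuple_cons_pair (t, x)) (lift 0 i) j = col_of_tuple t i j.
Proof. by rewrite !mxE tnthS. Qed.

Lemma measurable_EFin_col d (f : 'cV[R]_d -> R) : continuous f ->
  measurable_fun [set: d.-tuple T] (fun t => (f (col_of_tuple t))%:E).
Proof.
by move=> cf; apply/measurable_EFinP; exact: measurable_continuous_col.
Qed.

(** The inner integral over the first coordinate is a one-dimensional Gaussian with shifted center,
    leaving the Schur complement. The sign of the determinant comes out of the same induction and
    later yields invertibility of positive definite matrices. *)
Lemma integral_gauss_quad d (Q : 'M[R]_d) (m : 'cV[R]_d) :
  Q^T = Q -> posdefmx Q ->
  0 < \det Q /\
  (\int[lebesgue_tuple d]_t (expR (- (quad_form Q (col_of_tuple t - m) / 2)))%:E =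
   (Num.sqrt ((2 * pi) ^+ d / \det Q))%:E)%E.
Proof.
elim: d Q m => [|d IH] Q m Qsym Qpos.
  rewrite det_mx00; split=> //.
  have := @integral_dirac _ (0.-tuple T) [tuple] R setT measurableT
    (fun t => (expR (- (quad_form Q (col_of_tuple t - m) / 2)))%:E).
  rewrite diracT mul1e quad_formE big_ord0 mul0r oppr0 expR0 => intE.
  rewrite expr0 divr1 sqrtr1 -intE//.
  apply: (@measurable_EFin_col 0 (fun x => expR (- (quad_form Q (x - m) / 2)))).
  exact: continuous_gauss_quad.
have q0 := posdef_entry00_gt0 Qpos.
pose m' : 'cV[R]_d := \col_i m (lift 0 i) 0.
have [D0 IHS] := IH (schur Q) m' (trmx_schur Qsym) (posdef_schur Qsym Qpos).
have detE := det_schur Qsym Qpos.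
split; first by rewrite detE mulr_gt0.
rewrite integral_lebesgue_tupleS; last 2 first.
- apply: (@measurable_EFin_col _ (fun x => expR (- (quad_form Q (x - m) / 2)))).
  exact: continuous_gauss_quad.
- by move=> t; rewrite lee_fin expR_ge0.
pose B (t : d.-tuple T) := (\sum_i Q (lift 0 i) 0 * (col_of_tuple t - m') i 0) / Q 0 0.
transitivity (\int[lebesgue_tuple d]_t
  ((Num.sqrt (2 * pi / Q 0 0))%:E *
   (expR (- (quad_form (schur Q) (col_of_tuple t - m') / 2)))%:E))%E.
  apply: eq_integral => t _.
  rewrite -(integral_expR_sqr (m 0 0 - B t) q0).
  rewrite -ge0_integralZr//=; last first.
    apply/measurable_EFinP; apply: continuous_measurable_fun.
    apply: (@continuous_compR _ _ (fun x => expR (- (Q 0 0 / 2 * x ^+ 2))) (fun x => x - (m 0 0 - B t))).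
      exact: continuous_expR_sqr.
    apply: (@continuous_addR _ _ id (fun=> - (m 0 0 - B t))).
      by move=> x; exact: cvg_id.
    exact: continuous_cstR.
  apply: eq_integral => x _; rewrite -EFinM -expRD; congr (expR _)%:E.
  rewrite (@quad_form_schur _ _ Q Qsym Qpos _ (col_of_tuple t - m')); last first.
    by move=> i; rewrite !mxE tnthS.
  have arith (p u v b s : R) : - ((p * (u - v + b) ^+ 2 + s) / 2) =
    - (p / 2 * (u - (v - b)) ^+ 2) - s / 2 by field.
  have -> : (col_of_tuple (tuple_cons_pair (t, x)) - m) 0 0 = x - m 0 0 by rewrite !mxE.
  exact: arith.
rewrite ge0_integralZl//=; last first.
  apply: (@measurable_EFin_col _ (fun x => expR (- (quad_form (schur Q) (x - m') / 2)))).
  exact: continuous_gauss_quad.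
rewrite IHS -EFinM -sqrtrM; last by rewrite divr_ge0 ?mulr_ge0 ?pi_ge0// ltW.
by congr (Num.sqrt _)%:E; rewrite detE exprS; field; rewrite !gt_eqF.
Qed.

(** Integrating out one coordinate turns the others into part of the phase [c] and multiplies [r] by
    a factor at most 1, so the integrand keeps its shape; hence the general [r] and [c]. *)
Lemma integral_gauss_cos d (a : R) (z : 'cV[R]_d) (c r : R) : 0 < a -> `|r| <= 1 ->
  (\int[lebesgue_tuple d]_t ((1 + r * cos (dotp z (col_of_tuple t) + c)) *
      expR (- (a / 2 * nsq (col_of_tuple t))))%:E =
   (Num.sqrt (2 * pi / a) ^+ d * (1 + r * (expR (- (nsq z / (2 * a))) * cos c)))%:E)%E.
Proof.
move=> a0.
have cont e (w : 'cV[R]_e) (b p : R) : continuous (fun x =>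
    (1 + p * cos (dotp w x + b)) * expR (- (a / 2 * nsq x))).
  apply: continuous_mulR.
    apply: continuous_addR; first exact: continuous_cstR.
    apply: continuous_mulR; first exact: continuous_cstR.
    apply: continuous_compR; first exact: continuous_cos.
    by apply: continuous_addR; [exact: continuous_dotp|exact: continuous_cstR].
  exact: continuous_expR_nsq.
have ge0 e (w : 'cV[R]_e) (b p : R) x : `|p| <= 1 ->
    0 <= (1 + p * cos (dotp w x + b)) * expR (- (a / 2 * nsq x)).
  move=> p1; rewrite mulr_ge0 ?expR_ge0// -lerBlDl sub0r.
  suff : `|p * cos (dotp w x + b)| <= 1 by rewrite ler_norml => /andP[].
  by rewrite normrM mulr_ile1// cos_max.
elim: d z c r => [|d IH] z c r r1.
  have := @integral_dirac _ (0.-tuple T) [tuple] R setT measurableT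
    (fun t => ((1 + r * cos (dotp z (col_of_tuple t) + c)) *
      expR (- (a / 2 * nsq (col_of_tuple t))))%:E).
  rewrite diracT mul1e /nsq /dotp !big_ord0 mulr0 oppr0 expR0 => intE.
  rewrite expr0 !mul0r oppr0 expR0 !mul1r add0r in intE *.
  rewrite mulr1 in intE; rewrite -intE//.
  have := measurable_EFin_col (cont 0 z c r).
  by rewrite /nsq /dotp.
rewrite integral_lebesgue_tupleS; last 2 first.
- exact: (measurable_EFin_col (cont _ z c r)).
- by move=> t; rewrite lee_fin ge0.
pose z' : 'cV[R]_d := \col_i z (lift 0 i) 0.
pose r' := r * expR (- (z 0 0 ^+ 2 / (2 * a))).
have r'1 : `|r'| <= 1.
  rewrite /r' normrM mulr_ile1// ger0_norm ?expR_ge0//.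
  by rewrite -expR0 ler_expR oppr_le0 divr_ge0 ?sqr_ge0// mulr_ge0// ltW.
transitivity (\int[lebesgue_tuple d]_t
  ((Num.sqrt (2 * pi / a))%:E *
   ((1 + r' * cos (dotp z' (col_of_tuple t) + c)) *
      expR (- (a / 2 * nsq (col_of_tuple t))))%:E))%E.
  apply: eq_integral => t _.
  have := integral_gauss_1Dcos (dotp z' (col_of_tuple t) + c) (z 0 0) a0 r1.
  set I := (Num.sqrt _ * _)%:E => intE.
  have -> : ((Num.sqrt (2 * pi / a))%:E * ((1 + r' * cos (dotp z' (col_of_tuple t) + c)) *
      expR (- (a / 2 * nsq (col_of_tuple t))))%:E = I * (expR (- (a / 2 * nsq (col_of_tuple t))))%:E)%E.
    by rewrite /I -!EFinM; congr EFin; rewrite /r'; ring.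
  rewrite -intE -ge0_integralZr//=; last 2 first.
    apply/measurable_EFinP; apply: continuous_measurable_fun.
    apply: continuous_mulR; last exact: continuous_expR_sqr.
    apply: continuous_addR; first exact: continuous_cstR.
    apply: continuous_mulR; first exact: continuous_cstR.
    exact/continuous_trig_affine/continuous_cos.
    move=> x _; rewrite lee_fin mulr_ge0 ?expR_ge0// -lerBlDl sub0r.
    suff : `|r * cos (z 0 0 * x + (dotp z' (col_of_tuple t) + c))| <= 1 by rewrite ler_norml => /andP[].
    by rewrite normrM mulr_ile1// cos_max.
  apply: eq_integral => x _; rewrite -EFinM; congr EFin.
  rewrite -[RHS]mulrA -expRD; congr (_ * expR _).
    congr (1 + r * cos _); rewrite /dotp big_ord_recl col_of_tuple_cons0 -addrA.
    congr (_ + (_ + _)); apply: eq_bigr => i _.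
    by rewrite col_of_tuple_consS [z' _ _]mxE.
  rewrite /nsq big_ord_recl col_of_tuple_cons0 mulrDr opprD; congr (_ - _ * _).
  by apply: eq_bigr => i _; rewrite col_of_tuple_consS.
rewrite ge0_integralZl//=; last 2 first.
- exact: (measurable_EFin_col (cont _ z' c r')).
- by move=> t _; rewrite lee_fin ge0.
rewrite IH// -EFinM; congr EFin; rewrite exprS -[RHS]mulrA; congr (_ * (_ * (1 + _))).
rewrite /r' -!mulrA; congr (_ * _); rewrite mulrA -expRD; congr (expR _ * _).
have -> : nsq z = z 0 0 ^+ 2 + nsq z'.
  by rewrite /nsq big_ord_recl; congr (_ + _); apply: eq_bigr => i _; rewrite mxE.
by field; rewrite gt_eqF.
Qed.
End GaussDD.

(** * Integrals of functions of a column vector *)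

Section GaussIntegrals.
Context {R : realType} {d : nat}.
Local Notation T := (measurableTypeR R).
Local Notation mu := (@lebesgue_tuple R d).
Implicit Types (F G : 'cV[R]_d -> R) (x y z : 'cV[R]_d) (a c C : R).

Definition Int F : R := \int[mu]_t F (col_of_tuple t).

Definition integrableC F := mu.-integrable setT (fun t => (F (col_of_tuple t))%:E).

Definition gauss a x := expR (- (a / 2 * nsq x)).

Definition gauss_mass a := Num.sqrt (2 * pi / a) ^+ d.

Lemma gauss_gt0 a x : 0 < gauss a x. Proof. exact: expR_gt0. Qed.

Lemma gauss_mass_gt0 a : 0 < a -> 0 < gauss_mass a.
Proof. by move=> a0; rewrite exprn_gt0// sqrtr_gt0 divr_gt0// mulr_gt0// pi_gt0. Qed.

Lemma integral_gauss a m : 0 < a ->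
  (\int[mu]_t (gauss a (col_of_tuple t - m))%:E = (gauss_mass a)%:E)%E.
Proof.
move=> a0.
have Qsym : (a%:M : 'M[R]_d)^T = a%:M by rewrite tr_scalar_mx.
have Qpos : posdefmx (a%:M : 'M[R]_d).
  by move=> x x0; rewrite quad_form_scalar mulr_gt0// nsq_gt0.
have [_] := integral_gauss_quad m Qsym Qpos.
rewrite det_scalar -expr_div_n.
rewrite -[X in Num.sqrt (X ^+ d)]sqr_sqrtr; last first.
  by rewrite divr_ge0 ?mulr_ge0 ?pi_ge0// ltW.
rewrite -exprM mulnC exprM sqrtr_sqr ger0_norm ?exprn_ge0 ?sqrtr_ge0// => <-.
apply: eq_integral => t _; rewrite quad_form_scalar /gauss; congr (expR (- _))%:E.
by ring.
Qed.

Lemma integrableC_dom F C a m : 0 < a -> continuous F ->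
  (forall x, `|F x| <= C * gauss a (x - m)) -> integrableC F.
Proof.
move=> a0 cF FC.
have cg : continuous (fun x => gauss a (x - m)).
  rewrite (_ : (fun x => _) = fun x => expR (- (quad_form a%:M (x - m) / 2))).
    exact: continuous_gauss_quad.
  by apply/funext => x; rewrite quad_form_scalar /gauss mulrAC.
apply: (@le_integrable _ _ _ mu _ measurableT _
  (fun t => (C * gauss a (col_of_tuple t - m))%:E)).
- exact: measurable_EFin_col.
- move=> t _; rewrite /= lee_fin (le_trans (FC _))//.
  exact: ler_norm.
- have ig : mu.-integrable setT (fun t => (gauss a (col_of_tuple t - m))%:E).
    apply/integrableP; split; first exact: (measurable_EFin_col cg).
    under eq_integral do rewrite /= ger0_norm ?(ltW (gauss_gt0 _ _))//.
    by rewrite integral_gauss// ltry.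
  have := integrableZl measurableT C ig.
  by apply: eq_integrable => // t _; rewrite EFinM.
Qed.

Lemma Int_gauss a m : 0 < a -> Int (fun x => gauss a (x - m)) = gauss_mass a.
Proof. by move=> a0; rewrite /Int /Rintegral integral_gauss. Qed.

Lemma IntD F G : integrableC F -> integrableC G ->
  Int (fun x => F x + G x) = Int F + Int G.
Proof. by move=> iF iG; rewrite /Int RintegralD. Qed.

Lemma IntB F G : integrableC F -> integrableC G ->
  Int (fun x => F x - G x) = Int F - Int G.
Proof. by move=> iF iG; rewrite /Int RintegralB. Qed.

Lemma IntZ c F : integrableC F -> Int (fun x => c * F x) = c * Int F.
Proof. by move=> iF; rewrite /Int RintegralZl. Qed.

Lemma integrableCZ c F : integrableC F -> integrableC (fun x => c * F x).
Proof.
move=> iF; have := integrableZl measurableT c iF.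
by apply: eq_integrable => // t _; rewrite EFinM.
Qed.

Lemma integrableC_sum (I : Type) (r : seq I) (F_ : I -> 'cV[R]_d -> R) :
  (forall i, integrableC (F_ i)) -> integrableC (fun x => \sum_(i <- r) F_ i x).
Proof.
move=> iF; elim: r => [|i r IH].
  by have := @integrable0 _ _ _ mu setT; apply: eq_integrable => // t _; rewrite big_nil.
have := integrableD measurableT (iF i) IH.
by apply: eq_integrable => // t _; rewrite big_cons.
Qed.

Lemma Int_sum (I : Type) (r : seq I) (F_ : I -> 'cV[R]_d -> R) :
  (forall i, integrableC (F_ i)) ->
  Int (fun x => \sum_(i <- r) F_ i x) = \sum_(i <- r) Int (F_ i).
Proof.
move=> iF; elim: r => [|i r IH].
  rewrite big_nil /Int; under eq_Rintegral do rewrite big_nil.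
  by rewrite /Rintegral integral0.
rewrite big_cons -IH -IntD//; last exact: integrableC_sum.
by apply: eq_Rintegral => t _; rewrite big_cons.
Qed.

Lemma Int_le F G : integrableC F -> integrableC G -> (forall x, F x <= G x) ->
  Int F <= Int G.
Proof. by move=> iF iG FG; apply: le_Rintegral. Qed.

Lemma Int_norm_le F G : integrableC F -> integrableC G -> (forall x, `|F x| <= G x) ->
  `|Int F| <= Int G.
Proof.
move=> iF iG FG; rewrite (le_trans (le_normr_Rintegral _ _))//.
apply: le_Rintegral; [by []| |exact: iG|by move=> t _; exact: FG].
exact: integrable_abse iF.
Qed.

Lemma Int_dominated_cvg (F_ : nat -> 'cV[R]_d -> R) F G :
  (forall n, continuous (F_ n)) -> integrableC F -> integrableC G ->
  (forall n x, `|F_ n x| <= G x) ->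
  (forall x, (fun n => F_ n x) @ \oo --> F x) ->
  (fun n => Int (F_ n)) @ \oo --> Int F.
Proof.
move=> cF_ iF iG FG FF.
apply: fine_cvg; rewrite fineK.
  apply: (@dominated_cvg _ _ _ mu _ measurableT
    (fun n t => (F_ n (col_of_tuple t))%:E) (fun t => (F (col_of_tuple t))%:E)
    (fun t => (G (col_of_tuple t))%:E)) => //.
  - by move=> n; exact: measurable_EFin_col.
  - by move=> t _; apply: cvg_EFin; [exact: nearW|exact: FF].
  - by move=> n t _; rewrite /= lee_fin.
exact: integrable_fin_num.
Qed.

(** Subtracting the Gaussian mass from the case [r = 1] of [integral_gauss_cos] isolates the
    cosine. *)
Lemma Int_cos_gauss a c z : 0 < a ->
  Int (fun x => cos (dotp z x + c) * gauss a x) =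
  gauss_mass a * (expR (- (nsq z / (2 * a))) * cos c).
Proof.
move=> a0.
have ccos : continuous (fun x => cos (dotp z x + c)).
  apply: continuous_compR; first exact: continuous_cos.
  by apply: continuous_addR; [exact: continuous_dotp|exact: continuous_cstR].
have ig : integrableC (gauss a).
  apply: (@integrableC_dom _ 1 a 0 a0); first exact: continuous_expR_nsq.
  by move=> x; rewrite subr0 mul1r ger0_norm// ltW// gauss_gt0.
have ic : integrableC (fun x => cos (dotp z x + c) * gauss a x).
  apply: (@integrableC_dom _ 1 a 0 a0).
    by apply: continuous_mulR => //; exact: continuous_expR_nsq.
  move=> x; rewrite subr0 mul1r normrM (ger0_norm (ltW (gauss_gt0 _ _))).
  by rewrite ler_piMl// ?cos_max// ltW// gauss_gt0.
have := @integral_gauss_cos _ d a z c 1 a0; rewrite normr1 => /(_ (lexx _)).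
move=> /(congr1 fine); rewrite /= -/(Rintegral mu setT _).
have -> : \int[mu]_t ((1 + 1 * cos (dotp z (col_of_tuple t) + c)) *
    expR (- (a / 2 * nsq (col_of_tuple t)))) = gauss_mass a +
    Int (fun x => cos (dotp z x + c) * gauss a x).
  have <- : Int (fun x => gauss a (x - 0)) = gauss_mass a by exact: Int_gauss.
  rewrite -IntD//; last first.
    by rewrite (_ : (fun x => _) = gauss a)//; apply/funext => x; rewrite subr0.
  by apply: eq_Rintegral => t _; rewrite subr0 mul1r mulrDl mul1r.
by move=> h; apply: (@addrI _ (gauss_mass a)); rewrite h /gauss_mass; ring.
Qed.

End GaussIntegrals.

Arguments gauss_mass {R} d a.

(** * Tilted central limit theorem *)

(** An epsilon / 3 argument for exchanging two limits. It serves twice, with [k] the inverse width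
    of a mollifier and with [k] the size of a cutoff. *)
Lemma cvg_exchange {R : realType} (u : nat -> R) (w : nat -> nat -> R)
    (L_ : nat -> R) (L : R) :
  (forall e, 0 < e -> \forall k \near \oo, \forall N \near \oo, `|u N - w k N| <= e) ->
  (forall k, w k @ \oo --> L_ k) -> L_ @ \oo --> L -> u @ \oo --> L.
Proof.
move=> uw wL LL; apply/cvgrPdist_le => e e0.
have e30 : 0 < e / 3 by rewrite divr_gt0.
have /cvgrPdist_le /(_ _ e30) LLe := LL.
near \oo => k.
have uwk : \forall N \near \oo, `|u N - w k N| <= e / 3.
  by near: k; exact: uw.
have Lk : `|L - L_ k| <= e / 3 by near: k; exact: LLe.
have /cvgrPdist_le /(_ _ e30) wLk := wL k.
near=> N.
have h1 : `|u N - w k N| <= e / 3 by near: N; exact: uwk.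
have h2 : `|L_ k - w k N| <= e / 3 by near: N; exact: wLk.
have -> : L - u N = (L - L_ k) + (L_ k - w k N) - (u N - w k N) by ring.
rewrite (le_trans (ler_normB _ _))//.
have -> : e = e / 3 + e / 3 + e / 3 by field.
by rewrite lerD// (le_trans (ler_normD _ _))// lerD.
Unshelve. all: by end_near.
Qed.

(** * Compactly supported test functions and their mollification *)

Section Modulus.
Context {R : realType} {d : nat}.
Implicit Types (x y : 'cV[R]_d) (g : 'cV[R]_d -> R).

Lemma nsq_entry_le x i : x i 0 ^+ 2 <= nsq x.
Proof. by rewrite /nsq (bigD1 i)//= lerDl sumr_ge0// => j _; exact: sqr_ge0. Qed.

Lemma nsqN x : nsq (- x) = nsq x.
Proof. by apply: eq_bigr => i _; rewrite mxE sqrrN. Qed.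

(* Away from the diagonal the quadratic term absorbs the oscillation of g; near
   it, a Lebesgue number of the support does. *)
Lemma compact_support_modulus g (K B : R) : continuous g ->
  (forall x, K < nsq x -> g x = 0) -> (forall x, `|g x| <= B) ->
  forall e, 0 < e ->
  exists2 C, 0 <= C & forall x y, `|g y - g x| <= e + C * nsq (y - x).
Proof.
move=> cg g0 gB e e0.
have B0 : 0 <= B by rewrite (le_trans _ (gB 0)).
(* The compactness theorem for boxes speaks of row vectors, hence the transposes below. The box
   contains every [x] with [nsq x <= K], because [t^2 <= K] implies [t <= K + 1]. *)
pose Box := [set v : 'rV[R]_d | forall i, `[- (K + 1), K + 1]%classic (v ord0 i)].
have cBox : compact Box.
  apply: (@rV_compact R d (fun=> `[- (K + 1), K + 1]%classic)) => i.
  exact: segment_compact.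
pose Pr (C : R) (v : 'rV[R]_d) :=
  forall y, `|g y - g v^T| <= e + C * nsq (y - v^T).
have PB : \forall C \near +oo, Box `<=` Pr C.
  apply: (compact_near_coveringP Box).1 => // v0 _.
  have e20 : 0 < e / 2 by rewrite divr_gt0.
  have /cvgrPdist_lt /(_ _ e20) /nbhs_ballP [r r0 rP] := cg v0^T.
  have r20 : 0 < r / 2 by rewrite divr_gt0.
  (* Either all coordinates of [y - v] are below [r / 2] and both points lie in the ball where [g]
     varies little, or one coordinate is not, and then [C (r / 2)^2 >= 2 B] covers the whole
     oscillation of [g]. *)
  exists (ball v0 (r / 2), [set C | 2 * B / (r / 2) ^+ 2 <= C]) => /=.
    split; first exact: nbhsx_ballx.
    by apply: nbhs_pinfty_ge; rewrite num_real.
  move=> [v C] /= [v0v CB] y.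
  have r2 : 0 < (r / 2) ^+ 2 by rewrite exprn_gt0.
  have C0 : 0 <= C by rewrite (le_trans _ CB)// divr_ge0 ?mulr_ge0// ltW.
  have [vy|/existsNP [i vy]] := pselect (forall i, `|y i 0 - v^T i 0| < r / 2).
    have bv : ball v0^T r v^T.
      case: v0v => _ v0v; split => // i j; rewrite !mxE.
      by apply: le_ball (v0v _ _); move: (r0 : 0 < r); lra.
    have by_ : ball v0^T r y.
      case: v0v => _ v0v; split=> // i j; rewrite ord1.
      rewrite /ball /= (_ : v0^T i 0 - y i 0 = (v0^T i 0 - v^T i 0) - (y i 0 - v^T i 0)); last by ring.
      rewrite (le_lt_trans (ler_normB _ _))// (splitr r) ltrD//.
      by have := v0v 0 i; rewrite /ball /= !mxE.
    have h1 := rP _ bv; have h2 := rP _ by_.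
    rewrite (@le_trans _ _ e)//; last by rewrite lerDl mulr_ge0// nsq_ge0.
    have -> : g y - g v^T = (g v0^T - g v^T) - (g v0^T - g y) by ring.
    rewrite (le_trans (ler_normB _ _))// (splitr e) lerD// ltW//.
  rewrite (@le_trans _ _ (2 * B))//.
    by rewrite (le_trans (ler_normB _ _))// mulr_natl mulr2n lerD.
  rewrite -[leLHS]add0r lerD ?(ltW e0)//.
  rewrite (@le_trans _ _ (C * (r / 2) ^+ 2))//; first by rewrite -ler_pdivrMr.
  rewrite ler_wpM2l// (le_trans _ (nsq_entry_le _ i))//.
  move/negP: vy; rewrite -leNgt => vy.
  rewrite [(y - v^T) i 0]mxE [(- v^T) i 0]mxE -[leRHS]real_normK ?num_real//.
  by rewrite lerXn2r ?nnegrE// ltW.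
near (pinfty_nbhs R) => C.
have C0 : 0 <= C by near: C; apply: (@nbhs_pinfty_ge R); rewrite num_real.
have BoxC : Box `<=` Pr C by near: C.
have inBox x : nsq x <= K -> Pr C x^T.
  move=> xK; apply: BoxC => i /=; rewrite mxE in_itv /= -ler_norml.
  have := le_trans (nsq_entry_le x i) xK; rewrite -real_normK ?num_real//.
  have := normr_ge0 (x i 0); set t := `|_|.
  by nra.
exists C => // x y; have [xK|xK] := leP (nsq x) K.
  by have := inBox _ xK y; rewrite trmxK.
have [yK|yK] := leP (nsq y) K.
  by have := inBox _ yK x; rewrite trmxK distrC -(opprB y x) nsqN.
by rewrite (g0 _ xK) (g0 _ yK) subr0 normr0 addr_ge0 ?(ltW e0)// mulr_ge0// nsq_ge0.
Unshelve. all: by end_near.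
Qed.

End Modulus.

Section GaussBump.
Context {R : realType} {d : nat}.
Implicit Types (x y : 'cV[R]_d) (a : R).

Lemma expR_dist_le (u v m : R) : u <= m -> v <= m ->
  `|expR u - expR v| <= `|u - v| * expR m.
Proof.
wlog vu : u v / v <= u.
  move=> wlg um vm; have [vu|/ltW uv] := leP v u; first exact: wlg.
  by rewrite distrC [X in X * _]distrC; exact: wlg.
move=> um _; rewrite !ger0_norm ?subr_ge0 ?ler_expR//.
rewrite (@le_trans _ _ ((u - v) * expR u))//; last first.
  by rewrite ler_wpM2l ?subr_ge0// ler_expR.
have -> : v = u + (v - u) by ring.
rewrite expRD -{1}[expR u]mulr1 -mulrBr mulrC ler_wpM2r ?expR_ge0//.
have := expR_ge1Dx (v - u); set e := expR _; lra.
Qed.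

Lemma gaussNx a x : gauss a (- x) = gauss a x.
Proof. by rewrite /gauss nsqN. Qed.

Lemma gauss_le1 a x : 0 <= a -> gauss a x <= 1.
Proof.
move=> a0; rewrite /gauss -expR0 ler_expR oppr_le0 mulr_ge0 ?nsq_ge0//.
by rewrite divr_ge0.
Qed.

Lemma continuous_gauss a y : continuous (fun x => gauss a (x - y)).
Proof.
rewrite (_ : (fun x => _) = fun x => expR (- (quad_form a%:M (x - y) / 2))).
  exact: continuous_gauss_quad.
by apply/funext => x; rewrite quad_form_scalar /gauss mulrAC.
Qed.

Lemma gauss_mass_half a : 0 < a ->
  gauss_mass d (a / 2) = Num.sqrt 2 ^+ d * gauss_mass d a.
Proof.
move=> a0; rewrite /gauss_mass -exprMn -sqrtrM//; congr (Num.sqrt _ ^+ _).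
by field; rewrite gt_eqF.
Qed.

Lemma gauss_massV a : 0 < a -> gauss_mass d a * gauss_mass d a^-1 = (2 * pi) ^+ d.
Proof.
move=> a0; rewrite /gauss_mass -exprMn -sqrtrM; last first.
  by rewrite divr_ge0 ?mulr_ge0 ?pi_ge0// ltW.
rewrite (_ : _ * (_ / _) = (2 * pi) ^+ 2); last by field; rewrite gt_eqF.
by rewrite sqrtr_sqr ger0_norm// mulr_ge0// pi_ge0.
Qed.

(** Half of the exponent pays for the quadratic factor, which replaces a computation of second
    moments. *)
Lemma nsq_gauss_le a x : 0 < a -> nsq x * gauss a x <= 4 / a * gauss (a / 2) x.
Proof.
move=> a0; rewrite /gauss.
have -> : - (a / 2 * nsq x) = - (a / 2 / 2 * nsq x) - (a / 4 * nsq x) by field.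
rewrite expRD mulrCA mulrC ler_wpM2r ?expR_ge0//.
rewrite expRN ler_pdivrMr ?expR_gt0// mulrC -ler_pdivrMr ?divr_gt0//.
rewrite (le_trans _ (expR_ge1Dx _))// invf_div mulrC.
by rewrite lerDr.
Qed.

(* Average of g against the Gaussian density of variance 1/a centered at x. *)
Definition mollify (g : 'cV[R]_d -> R) a x : R :=
  (gauss_mass d a)^-1 * Int (fun y => g y * gauss a (x - y)).

Lemma integrableC_mul_gauss (g : 'cV[R]_d -> R) B a x : 0 < a -> continuous g ->
  (forall y, `|g y| <= B) -> integrableC (fun y => g y * gauss a (x - y)).
Proof.
move=> a0 cg gB.
have gE y : gauss a (x - y) = gauss a (y - x) by rewrite -(opprB x) gaussNx.
apply: (@integrableC_dom _ _ _ B a x a0).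
  apply: continuous_mulR => //.
  by rewrite (_ : (fun y => _) = (fun y => gauss a (y - x))); [exact: continuous_gauss|exact/funext].
move=> y; rewrite normrM (ger0_norm (ltW (gauss_gt0 _ _))) gE.
by rewrite ler_wpM2r// ltW// gauss_gt0.
Qed.

(** Integrating the modulus against the bump leaves [e] plus a term of order [1 / a]. The bound is
    uniform in [x], so it survives any expectation, whatever the law of the argument. *)
Lemma mollify_near (g : 'cV[R]_d -> R) B e C a : 0 < a -> continuous g ->
  (forall x, `|g x| <= B) -> 0 <= C ->
  (forall x y, `|g y - g x| <= e + C * nsq (y - x)) ->
  forall x, `|mollify g a x - g x| <= e + C * (4 / a * Num.sqrt 2 ^+ d).
Proof.
move=> a0 cg gB C0 gC x.
have m0 := @gauss_mass_gt0 R d a a0.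
have gE y : gauss a (x - y) = gauss a (y - x) by rewrite -(opprB x) gaussNx.
have ig : integrableC (fun y => gauss a (y - x)).
  apply: (@integrableC_dom _ _ _ 1 a x a0); first exact: continuous_gauss.
  by move=> y; rewrite mul1r ger0_norm// ltW// gauss_gt0.
have a20 : 0 < a / 2 by rewrite divr_gt0.
have ig2 : integrableC (fun y => gauss (a / 2) (y - x)).
  apply: (@integrableC_dom _ _ _ 1 (a / 2) x a20); first exact: continuous_gauss.
  by move=> y; rewrite mul1r ger0_norm// ltW// gauss_gt0.
have igg := integrableC_mul_gauss x a0 cg gB.
have igc : integrableC (fun y => g x * gauss a (y - x)) by exact: integrableCZ.
have -> : mollify g a x - g x = (gauss_mass d a)^-1 *
    Int (fun y => g y * gauss a (x - y) - g x * gauss a (y - x)).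
  by rewrite IntB// IntZ// Int_gauss// mulrBr -/(mollify g a x) mulrCA mulVf ?mulr1// gt_eqF.
rewrite normrM ger0_norm ?invr_ge0 ?(ltW m0)// mulrC ler_pdivrMr//.
have -> : (e + C * (4 / a * Num.sqrt 2 ^+ d)) * gauss_mass d a =
    Int (fun y => e * gauss a (y - x) + C * (4 / a) * gauss (a / 2) (y - x)).
  rewrite IntD; [|exact: integrableCZ|exact: integrableCZ].
  by rewrite !IntZ// !Int_gauss// gauss_mass_half//; ring.
apply: Int_norm_le.
- by have := integrableB measurableT igg igc; apply: eq_integrable.
- have := integrableD measurableT (integrableCZ e ig) (integrableCZ (C * (4 / a)) ig2).
  by apply: eq_integrable.
- move=> y; rewrite gE -mulrBl normrM (ger0_norm (ltW (gauss_gt0 _ _))).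
  rewrite (@le_trans _ _ ((e + C * nsq (y - x)) * gauss a (y - x)))//.
    by rewrite ler_wpM2r// ltW// gauss_gt0.
  rewrite mulrDl lerD// -!mulrA ler_wpM2l//.
  by rewrite mulrA nsq_gauss_le.
Qed.

End GaussBump.

(** * Limits of expectations under quadratic tilts *)

Section TiltedCLT.
Context {R : realType} {d : nat}.
Variables (Omega : nat -> finType) (P : forall N, Omega N -> R)
  (X : forall N, Omega N -> 'cV[R]_d) (q z : R).
Hypotheses (P_ge0 : forall N (w : Omega N), 0 <= P w)
  (P_sum : forall N, \sum_(w : Omega N) P w = 1)
  (q_gt0 : 0 < q) (z_gt0 : 0 < z).
Implicit Types (f g h : 'cV[R]_d -> R) (x y t : 'cV[R]_d) (a c lam : R).

Let E N h : R := \sum_(w : Omega N) P w * h (X w).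

Hypothesis cos_cvg : forall t c,
  (fun N => E N (fun x => cos (dotp t x + c))) @ \oo -->
  expR (- (nsq t / (2 * q))) * cos c.
Hypothesis mgf_le : \forall N \near \oo, forall t,
  E N (fun x => expR (dotp t x)) <= expR (nsq t / (2 * z)).

Lemma expectZ N c h : E N (fun x => c * h x) = c * E N h.
Proof. by rewrite /E mulr_sumr; apply: eq_bigr => w _; rewrite mulrCA. Qed.

Lemma expectB N h1 h2 : E N (fun x => h1 x - h2 x) = E N h1 - E N h2.
Proof. by rewrite /E -sumrB; apply: eq_bigr => w _; rewrite mulrBr. Qed.

Lemma expect_norm N h1 h2 : (forall x, `|h1 x| <= h2 x) -> `|E N h1| <= E N h2.
Proof.
move=> h12; rewrite (le_trans (ler_norm_sum _ _ _))//.
by apply: ler_sum => w _; rewrite normrM ger0_norm// ler_wpM2l.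
Qed.

Lemma expect_cst N c : E N (fun=> c) = c.
Proof. by rewrite /E -mulr_suml P_sum mul1r. Qed.

(* A Gaussian bump is a superposition of cosines, whose expectations converge. *)
Lemma expect_gauss_cvg a t : 0 < a ->
  (fun N => E N (fun x => gauss a (x - t))) @ \oo -->
  (gauss_mass d a^-1)^-1 *
  (gauss_mass d (a^-1 + q^-1) * gauss (a^-1 + q^-1)^-1 t).
Proof.
move=> a0; have aV0 : 0 < a^-1 by rewrite invr_gt0.
have qV0 : 0 < q^-1 by rewrite invr_gt0.
(* A Gaussian of precision [a] is, up to its mass, the Fourier transform of one of precision
   [a^-1]. *)
have bumpE y : gauss a y = (gauss_mass d a^-1)^-1 *
    Int (fun u => cos (dotp y u + 0) * gauss a^-1 u).
  rewrite Int_cos_gauss// cos0 mulr1 mulrA mulVf ?gt_eqF ?gauss_mass_gt0// mul1r.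
  by rewrite /gauss; congr (expR (- _)); field; rewrite gt_eqF.
pose F N u := E N (fun x => cos (dotp u x - dotp t u)) * gauss a^-1 u.
have cF N : continuous (F N).
  apply: continuous_mulR; last exact: continuous_expR_nsq.
  apply: continuous_sum => w; apply: continuous_mulR; first exact: continuous_cstR.
  apply: continuous_compR; first exact: continuous_cos.
  apply: continuous_addR; last by apply: continuous_oppR; exact: continuous_dotp.
  rewrite (_ : (fun u => _) = dotp (X w)); first exact: continuous_dotp.
  by apply/funext => u; apply: eq_bigr => i _; rewrite mulrC.
have ig : integrableC (@gauss R d a^-1).
  apply: (@integrableC_dom _ _ _ 1 a^-1 0 aV0); first exact: continuous_expR_nsq.
  by move=> x; rewrite subr0 mul1r ger0_norm// ltW// gauss_gt0.
have P_le1 N : \sum_(w : Omega N) `|P w| = 1.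
  by rewrite -(P_sum N); apply: eq_bigr => w _; rewrite ger0_norm.
have F_le N u : `|F N u| <= gauss a^-1 u.
  rewrite normrM (ger0_norm (ltW (gauss_gt0 _ _))) ler_piMl ?(ltW (gauss_gt0 _ _))//.
  rewrite -(expect_cst N 1); apply: expect_norm => x; exact: cos_max.
have FE N : E N (fun x => gauss a (x - t)) = (gauss_mass d a^-1)^-1 * Int (F N).
  have FsumE u : F N u = \sum_(w : Omega N) P w * (cos (dotp (X w - t) u + 0) * gauss a^-1 u).
    rewrite /F mulr_suml; apply: eq_bigr => w _; rewrite -mulrA; congr (_ * (cos _ * _)).
    rewrite addr0 /dotp -sumrB; apply: eq_bigr => i _; rewrite !mxE; ring.
  have icos y : integrableC (fun u => cos (dotp y u + 0) * gauss a^-1 u).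
    apply: (@integrableC_dom _ _ _ 1 a^-1 0 aV0).
      apply: continuous_mulR; last exact: continuous_expR_nsq.
      apply: continuous_compR; first exact: continuous_cos.
      by apply: continuous_addR; [exact: continuous_dotp|exact: continuous_cstR].
    move=> x; rewrite subr0 mul1r normrM (ger0_norm (ltW (gauss_gt0 _ _))).
    by rewrite ler_piMl// ?cos_max// ltW// gauss_gt0.
  have -> : Int (F N) = \sum_(w : Omega N) P w * Int (fun u => cos (dotp (X w - t) u + 0) * gauss a^-1 u).
    rewrite (_ : F N = fun u => \sum_(w : Omega N) P w * (cos (dotp (X w - t) u + 0) * gauss a^-1 u)); last exact/funext.
    rewrite Int_sum => [|w]; last exact: integrableCZ.
    by apply: eq_bigr => w _; rewrite IntZ.
  by rewrite mulr_sumr; apply: eq_bigr => w _; rewrite bumpE mulrCA.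
rewrite (_ : (fun N => _) = fun N => (gauss_mass d a^-1)^-1 * Int (F N)); last first.
  exact/funext.
apply: cvgMr.
pose Finf u := expR (- (nsq u / (2 * q))) * cos (- dotp t u) * gauss a^-1 u.
have FinfE u : Finf u = cos (dotp t u + 0) * gauss (a^-1 + q^-1) u.
  rewrite /Finf cosN addr0 mulrAC -expRD mulrC; congr (_ * expR _).
  by field; rewrite !gt_eqF.
have aq0 : 0 < a^-1 + q^-1 by rewrite addr_gt0.
have -> : gauss_mass d (a^-1 + q^-1) * gauss (a^-1 + q^-1)^-1 t = Int Finf.
  rewrite (_ : Finf = fun u => cos (dotp t u + 0) * gauss (a^-1 + q^-1) u); last exact/funext.
  rewrite Int_cos_gauss// cos0 mulr1; congr (_ * expR (- _)).
  by field; rewrite !gt_eqF// addr_gt0.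
apply: (@Int_dominated_cvg _ _ _ _ (gauss a^-1)) => //.
  apply: (@integrableC_dom _ _ _ 1 a^-1 0 aV0).
    apply: continuous_mulR; last exact: continuous_expR_nsq.
    apply: continuous_mulR.
      apply: continuous_compR; first exact: continuous_expR.
      apply: continuous_oppR; apply: continuous_mulR; last exact: continuous_cstR.
      exact: continuous_nsq.
    apply: continuous_compR; first exact: continuous_cos.
    by apply: continuous_oppR; exact: continuous_dotp.
  move=> x; rewrite subr0 mul1r normrM (ger0_norm (ltW (gauss_gt0 _ _))).
  rewrite ler_piMl ?(ltW (gauss_gt0 _ _))// normrM mulr_ile1// ?cos_max//.
  rewrite ger0_norm ?expR_ge0// -expR0 ler_expR oppr_le0 divr_ge0 ?nsq_ge0//.
  by rewrite mulr_ge0// ltW.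
move=> u; apply: cvgMl; exact: cos_cvg.
Qed.

(* Weak convergence to N(0, q^-1 I): mollify g, let N tend to infinity for a
   fixed width, then let the width tend to 0. *)
Lemma expect_cvg g (B K : R) : continuous g -> (forall x, `|g x| <= B) ->
  (forall x, K < nsq x -> g x = 0) ->
  (fun N => E N g) @ \oo --> (gauss_mass d q)^-1 * Int (fun x => g x * gauss q x).
Proof.
move=> cg gB gK.
have B0 : 0 <= B by rewrite (le_trans _ (gB 0)).
(* On [nsq x <= K] the factor [expR (K / 2)] compensates [gauss 1 x], so one Gaussian dominates [g]
   in all the limits below. *)
pose C0 := B * expR (K / 2).
have gdom x : `|g x| <= C0 * gauss 1 (x - 0).
  rewrite subr0 /C0 -mulrA -expRD; have [xK|xK] := leP (nsq x) K.
    rewrite (le_trans (gB x))// ler_peMr// -[leLHS]expR0 ler_expR; lra.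
  by rewrite gK// normr0 mulr_ge0// expR_ge0.
have C00 : 0 <= C0 by rewrite mulr_ge0// expR_ge0.
have igC : integrableC (fun x => C0 * gauss 1 (x - 0)).
  apply: integrableCZ; apply: (@integrableC_dom _ _ _ 1 1 0 ltr01).
    exact: continuous_gauss.
  by move=> x; rewrite mul1r ger0_norm// ltW// gauss_gt0.
(* Variance of the limit law convolved with the mollifier: the two variances add. *)
pose v (k : nat) := (k.+1%:R^-1 + q^-1 : R).
have qV0 : 0 < q^-1 by rewrite invr_gt0.
have v0 k : 0 < v k by rewrite addr_gt0// invr_gt0 ltr0n.
pose w k N := E N (mollify g k.+1%:R).
pose lim_bump k x := (gauss_mass d k.+1%:R^-1)^-1 * (gauss_mass d (v k) * gauss (v k)^-1 x).
pose L_ k := (gauss_mass d k.+1%:R)^-1 * Int (fun y => g y * lim_bump k y).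
apply: (@cvg_exchange _ _ w L_).
- move=> e e0.
  have e20 : 0 < e / 2 by rewrite divr_gt0.
  have [C C_ge0 gC] := compact_support_modulus cg gK gB e20.
  pose D := C * (4 * Num.sqrt 2 ^+ d) / (e / 2).
  have D0 : 0 <= D.
    by rewrite divr_ge0 ?(ltW e20)// !mulr_ge0// exprn_ge0// sqrtr_ge0.
  near=> k; apply: nearW => N; rewrite /w -expectB -(expect_cst N e).
  apply: expect_norm => x; rewrite distrC.
  have k0 : 0 < k.+1%:R :> R by rewrite ltr0n.
  rewrite (le_trans (mollify_near k0 cg gB C_ge0 gC x))// [leRHS]splitr lerD2l.
  have Dk : D <= k.+1%:R.
    rewrite (@le_trans _ _ k%:R) ?ler_nat//.
    by near: k; exact: nbhs_infty_ger.
  move: Dk; rewrite /D ler_pdivrMr// => Dk.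
  rewrite (_ : C * _ = C * (4 * Num.sqrt 2 ^+ d) / k.+1%:R); last by ring.
  by rewrite ler_pdivrMr// [e / 2 * _]mulrC.
- move=> k; have k0 : 0 < k.+1%:R :> R by rewrite ltr0n.
  have kV0 : 0 < k.+1%:R^-1 :> R by rewrite invr_gt0.
  (* Exchanging the finite expectation with the integral over the centers [y] reduces the limit in
     [N] to that of single bumps. *)
  pose F N y := g y * E N (fun x => gauss k.+1%:R (x - y)).
  have wE N : w k N = (gauss_mass d k.+1%:R)^-1 * Int (F N).
    rewrite /w /mollify expectZ; congr (_ * _).
    have -> : F N = fun y => \sum_(u : Omega N) P u * (g y * gauss k.+1%:R (X u - y)).
      by apply/funext => y; rewrite /F /E mulr_sumr; apply: eq_bigr => u _; rewrite mulrCA.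
    rewrite Int_sum => [|u]; last by apply: integrableCZ; exact: (integrableC_mul_gauss _ k0 cg gB).
    by apply: eq_bigr => u _; rewrite IntZ//; exact: (integrableC_mul_gauss _ k0 cg gB).
  rewrite (_ : w k = fun N => (gauss_mass d k.+1%:R)^-1 * Int (F N)); last exact/funext.
  apply: cvgMr; apply: (@Int_dominated_cvg _ _ _ _ (fun x => C0 * gauss 1 (x - 0))) => //.
  + move=> N; apply: continuous_mulR => //; apply: continuous_sum => u.
    apply: continuous_mulR; first exact: continuous_cstR.
    rewrite (_ : (fun y => _) = (fun y => gauss k.+1%:R (y - X u))); first exact: continuous_gauss.
    by apply/funext => y; rewrite -(opprB y) gaussNx.
  + have vV0 : 0 < (v k)^-1 by rewrite invr_gt0.
    apply: (@integrableC_dom _ _ _ (B * (gauss_mass d k.+1%:R^-1)^-1 * gauss_mass d (v k)) _ 0 vV0).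
      apply: continuous_mulR => //; apply: continuous_mulR; first exact: continuous_cstR.
      by apply: continuous_mulR; [exact: continuous_cstR|exact: continuous_expR_nsq].
    move=> x; rewrite subr0 normrM -!mulrA ler_pM//.
    by rewrite ger0_norm// !mulr_ge0// ?invr_ge0 ltW// ?gauss_mass_gt0// gauss_gt0.
  + move=> N x; rewrite normrM (le_trans _ (gdom x))// ler_piMr//.
    suff : `|E N (fun y => gauss k.+1%:R (y - x))| <= E N (fun=> 1) by rewrite expect_cst.
    apply: expect_norm => y.
    by rewrite ger0_norm ?(ltW (gauss_gt0 _ _))// gauss_le1// ltW.
  + by move=> x; apply: cvgMr; exact: expect_gauss_cvg.
- have vcvg : v @ \oo --> q^-1.
    rewrite -[X in _ --> X]add0r; apply: cvgD; last exact: cvg_cst.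
    exact: cvg_harmonic.
  have vVcvg : (fun k => (v k)^-1) @ \oo --> q.
    rewrite -[X in _ --> X]invrK; apply: cvgV => //.
    by rewrite gt_eqF.
  have pi2 : 0 < (2 * pi : R) ^+ d by rewrite exprn_gt0// mulr_gt0// pi_gt0.
  have L_E k : L_ k = ((2 * pi) ^+ d)^-1 * gauss_mass d (v k) *
      Int (fun x => g x * gauss (v k)^-1 x).
    have k0 : 0 < k.+1%:R :> R by rewrite ltr0n.
    have vV0 : 0 < (v k)^-1 by rewrite invr_gt0.
    have ig : integrableC (fun x => g x * gauss (v k)^-1 x).
      have := integrableC_mul_gauss 0 vV0 cg gB.
      by apply: eq_integrable => // t _; rewrite sub0r gaussNx.
    rewrite /L_ (_ : (fun y => _) = fun y => (gauss_mass d k.+1%:R^-1)^-1 * gauss_mass d (v k) *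
      (g y * gauss (v k)^-1 y)); last first.
      by apply/funext => y; rewrite /lim_bump; ring.
    by rewrite IntZ// -(gauss_massV k0) invfM; ring.
  rewrite (_ : L_ = fun k => ((2 * pi) ^+ d)^-1 * gauss_mass d (v k) *
      Int (fun x => g x * gauss (v k)^-1 x)); last exact/funext.
  have -> : (gauss_mass d q)^-1 = ((2 * pi) ^+ d)^-1 * gauss_mass d q^-1.
    rewrite -(gauss_massV q_gt0) invfM -mulrA mulVf ?mulr1//.
    by rewrite gt_eqF// gauss_mass_gt0.
  apply: cvgM.
    apply: cvgMr.
    have c1 : (fun k => 2 * pi / v k) @ \oo --> 2 * pi / q^-1.
      by apply: cvgMr; apply: cvgV => //; rewrite gt_eqF.
    have c2 := cvg_comp _ _ c1 (@sqrt_continuous R _).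
    exact: (cvg_comp _ _ c2 (@exprn_continuous R d _)).
  apply: (@Int_dominated_cvg _ _ _ _ (fun x => C0 * gauss 1 (x - 0))) => //.
  + by move=> k; apply: continuous_mulR => //; exact: continuous_expR_nsq.
  + have := integrableC_mul_gauss 0 q_gt0 cg gB.
    by apply: eq_integrable => // t _; rewrite sub0r gaussNx.
  + move=> k x; rewrite normrM (le_trans _ (gdom x))// ler_piMr//.
    by rewrite ger0_norm ?(ltW (gauss_gt0 _ _))// gauss_le1// ltW// invr_gt0.
  + move=> x; apply: cvgMr.
    apply: (cvg_comp _ (fun a => gauss a x) vVcvg).
    apply: (@continuous_compR _ _ expR (fun a => - (a / 2 * nsq x))).
      exact: continuous_expR.
    apply: continuous_oppR; apply: continuous_mulR; last exact: continuous_cstR.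
    by apply: continuous_mulR; [move=> u; exact: cvg_id|exact: continuous_cstR].
Unshelve. all: by end_near.
Qed.

(* Hubbard-Stratonovich: expR (lam |x|^2 / 2) is a Gaussian average of
   exponentials expR (dotp t x). *)
Lemma expect_expR_nsq_bounded lam : 0 < lam -> lam < z ->
  exists M, \forall N \near \oo, E N (fun x => expR (lam / 2 * nsq x)) <= M.
Proof.
move=> lam0 lamz; have lV0 : 0 < lam^-1 by rewrite invr_gt0.
have zlV : 0 < lam^-1 - z^-1 by rewrite subr_gt0 ltf_pV2.
have massV0 := @gauss_mass_gt0 R d _ lV0.
pose H x t := expR (dotp t x) * gauss lam^-1 t.
have HE x t : H x t = expR (lam / 2 * nsq x) * gauss lam^-1 (t - lam *: x).
  rewrite /H /gauss -!expRD; congr expR.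
  have -> : nsq (t - lam *: x) = nsq t - 2 * lam * dotp t x + lam ^+ 2 * nsq x.
    rewrite /nsq /dotp !mulr_sumr -sumrB -big_split /=; apply: eq_bigr => i _.
    by rewrite !mxE; ring.
  by field; rewrite gt_eqF.
have iH x : integrableC (H x).
  rewrite (_ : H x = fun t => expR (lam / 2 * nsq x) * gauss lam^-1 (t - lam *: x)); last exact/funext.
  apply: integrableCZ; apply: (@integrableC_dom _ _ _ 1 lam^-1 (lam *: x) lV0).
    exact: continuous_gauss.
  by move=> t; rewrite mul1r ger0_norm// ltW// gauss_gt0.
have IH x : Int (H x) = expR (lam / 2 * nsq x) * gauss_mass d lam^-1.
  rewrite (_ : H x = fun t => expR (lam / 2 * nsq x) * gauss lam^-1 (t - lam *: x)); last exact/funext.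
  rewrite IntZ ?Int_gauss//.
  apply: (@integrableC_dom _ _ _ 1 lam^-1 (lam *: x) lV0); first exact: continuous_gauss.
  by move=> t; rewrite mul1r ger0_norm// ltW// gauss_gt0.
(* The exponential moment bound lowers the precision of the auxiliary Gaussian from [lam^-1] to
   [lam^-1 - z^-1], still positive because [lam < z]. *)
exists ((gauss_mass d lam^-1)^-1 * gauss_mass d (lam^-1 - z^-1)).
near=> N.
have mgfN t : E N (fun x => expR (dotp t x)) <= expR (nsq t / (2 * z)).
  by move: t; near: N; exact: mgf_le.
have -> : E N (fun x => expR (lam / 2 * nsq x)) =
    (gauss_mass d lam^-1)^-1 * Int (fun t => \sum_(w : Omega N) P w * H (X w) t).
  rewrite Int_sum => [|w]; last exact: integrableCZ.
  rewrite mulr_sumr; apply: eq_bigr => w _; rewrite IntZ// IH.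
  by rewrite [RHS]mulrC -!mulrA mulfV ?mulr1// gt_eqF.
rewrite ler_pM2l ?invr_gt0//.
rewrite -(@Int_gauss _ _ _ 0 zlV); apply: Int_le.
- by apply: integrableC_sum => w; exact: integrableCZ.
- apply: (@integrableC_dom _ _ _ 1 (lam^-1 - z^-1) 0 zlV); first exact: continuous_gauss.
  by move=> t; rewrite mul1r ger0_norm// ltW// gauss_gt0.
- move=> t.
  have -> : \sum_(w : Omega N) P w * H (X w) t = E N (fun x => expR (dotp t x)) * gauss lam^-1 t.
    by rewrite /E mulr_suml; apply: eq_bigr => w _; rewrite mulrA.
  rewrite (@le_trans _ _ (expR (nsq t / (2 * z)) * gauss lam^-1 t))//.
    by rewrite ler_wpM2r ?(ltW (gauss_gt0 _ _)).
  rewrite subr0 /gauss -expRD ler_expR le_eqVlt; apply/orP; left; apply/eqP.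
  by field; rewrite !gt_eqF.
Unshelve. all: by end_near.
Qed.

(** The gap between [lam] and [z] is what is spent: for [lam1] strictly between them,
    [nsq x * expR (lam / 2 * nsq x)] is at most a constant times [expR (lam1 / 2 * nsq x)], whose
    expectations stay bounded. Replacing [b_ N] by [b] and cutting off large [x] both cost one
    factor [nsq x], so this single estimate controls both errors. *)
Lemma tilted_cvg (b : 'cV[R]_d -> R) (b_ : nat -> 'cV[R]_d -> R) (e_ : nat -> R)
    (lam : R) (f : 'cV[R]_d -> R) (B : R) :
  0 < lam -> lam < z -> z <= q -> continuous b ->
  (forall x, b x <= lam * nsq x) ->
  (\forall N \near \oo, forall x, b_ N x <= lam * nsq x) ->
  (forall N x, `|b_ N x - b x| <= e_ N * nsq x) -> e_ @ \oo --> 0 ->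
  continuous f -> (forall x, `|f x| <= B) ->
  (fun N => E N (fun x => f x * expR (b_ N x / 2))) @ \oo -->
  (gauss_mass d q)^-1 * Int (fun x => f x * expR (b x / 2) * gauss q x).
Proof.
move=> lam0 lamz zq cb b_le b__le b_near e0 cf fB.
have B0 : 0 <= B by rewrite (le_trans _ (fB 0)).
have [lam1 lam1z lam_lam1] : exists2 lam1, lam1 < z & 0 < lam1 - lam.
  by exists ((lam + z) / 2); lra.
have lam10 : 0 < lam1 by lra.
have [M EM] := expect_expR_nsq_bounded lam10 lam1z.
have [c0 c00 nsq_exp] : exists2 c0, 0 < c0 & forall x,
    nsq x * expR (lam / 2 * nsq x) <= c0 * expR (lam1 / 2 * nsq x).
  exists (2 / (lam1 - lam)) => [|x]; first by rewrite divr_gt0.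
  have -> : lam1 / 2 * nsq x = (lam1 - lam) / 2 * nsq x + lam / 2 * nsq x by ring.
  rewrite expRD mulrA ler_wpM2r ?expR_ge0//.
  rewrite mulrC -ler_pdivrMr ?divr_gt0// (le_trans _ (expR_ge1Dx _))//.
  by rewrite invf_div mulrC lerDr.
have cexp : continuous (fun x => expR (b x / 2)).
  apply: continuous_compR; first exact: continuous_expR.
  by apply: continuous_mulR => //; exact: continuous_cstR.
have expb x : expR (b x / 2) <= expR (lam / 2 * nsq x).
  by rewrite ler_expR mulrAC ler_wpM2r.
pose g0 x := f x * expR (b x / 2).
have cg0 : continuous g0 by exact: continuous_mulR.
have g0_le x : `|g0 x| <= B * expR (lam / 2 * nsq x).
  by rewrite normrM (ger0_norm (expR_ge0 _)) ler_pM ?expR_ge0.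
have M0 : 0 <= M.
  near \oo => N; apply: (@le_trans _ _ (E N (fun x => expR (lam1 / 2 * nsq x)))).
    by apply: sumr_ge0 => w _; rewrite mulr_ge0// expR_ge0.
  by near: N; exact: EM.
have BcM0 : 0 <= B * c0 * M by rewrite !mulr_ge0// ltW.
suff cvg0 : (fun N => E N g0) @ \oo --> (gauss_mass d q)^-1 * Int (fun x => g0 x * gauss q x).
  rewrite (_ : (fun N => _) = (fun N => (E N (fun x => f x * expR (b_ N x / 2)) - E N g0) + E N g0)); last first.
    by apply/funext => N; rewrite subrK.
  rewrite -[X in _ --> X]add0r; apply: cvgD => //.
  apply: (@squeeze_cvgr _ _ _ _ (fun N => - (B * c0 * M * `|e_ N|)) (fun N => B * c0 * M * `|e_ N|)).
  - near=> N; rewrite -ler_norml -expectB.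
    have b_N x : b_ N x <= lam * nsq x by move: x; near: N; exact: b__le.
    rewrite (@le_trans _ _ (E N (fun x => B * c0 * `|e_ N| * expR (lam1 / 2 * nsq x))))//.
      apply: expect_norm => x; rewrite /g0 -mulrBr normrM.
      have h1 : `|expR (b_ N x / 2) - expR (b x / 2)| <=
          `|b_ N x / 2 - b x / 2| * expR (lam / 2 * nsq x).
        by apply: expR_dist_le; rewrite mulrAC ler_wpM2r.
      have h2 : `|b_ N x / 2 - b x / 2| <= `|e_ N| * nsq x.
        rewrite -mulrBl normrM [`|2^-1|]ger0_norm//.
        rewrite (@le_trans _ _ `|b_ N x - b x|)//; first by rewrite ler_piMr//; lra.
        by rewrite (le_trans (b_near N x))// ler_wpM2r ?nsq_ge0// ler_norm.
      rewrite -!mulrA ler_pM// (le_trans h1)//.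
      rewrite (@le_trans _ _ (`|e_ N| * (nsq x * expR (lam / 2 * nsq x))))//.
        by rewrite mulrA ler_wpM2r// expR_ge0.
      rewrite (le_trans (ler_wpM2l (normr_ge0 _) (nsq_exp x)))//.
      by rewrite le_eqVlt; apply/orP; left; apply/eqP; rewrite !mulrA; ring.
    rewrite expectZ -!mulrA ler_wpM2l// ler_wpM2l ?(ltW c00)// mulrC ler_wpM2r//.
    by near: N; exact: EM.
  - rewrite -[X in _ --> X]oppr0 -(mulr0 (B * c0 * M)) -(@normr0 _ R); apply: cvgN; apply: cvgMr.
    exact: cvg_norm.
  - by rewrite -(mulr0 (B * c0 * M)) -(@normr0 _ R); apply: cvgMr; exact: cvg_norm.
(* This cutoff is chosen because [1 - chi k x <= nsq x / (k + 1)] everywhere, which bounds the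
   truncation error by the same moment as above. *)
pose chi (k : nat) x : R := Num.max 0 (1 - nsq x / k.+1%:R).
have cchi k : continuous (chi k).
  move=> x; apply: (@continuous_max _ _ (fun=> 0) (fun x => 1 - nsq x / k.+1%:R)).
    exact: cst_continuous.
  move: x; apply: continuous_addR; first exact: continuous_cstR.
  apply: continuous_oppR; apply: continuous_mulR; last exact: continuous_cstR.
  exact: continuous_nsq.
have chi_ge0 k x : 0 <= chi k x by rewrite le_max lexx.
have chi_le1 k x : chi k x <= 1.
  by rewrite ge_max ler01 /= lerBlDr lerDl divr_ge0 ?nsq_ge0.
have chi_near k x : 1 - chi k x <= nsq x / k.+1%:R.
  by rewrite lerBlDr -lerBlDl le_max lexx orbT.
have chi_out k x : k.+1%:R < nsq x -> chi k x = 0.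
  move=> kx; apply/max_idPl; rewrite subr_le0 ler_pdivlMr ?ltr0n// mul1r.
  exact: ltW.
apply: (@cvg_exchange _ _ (fun k N => E N (fun x => g0 x * chi k x))
  (fun k => (gauss_mass d q)^-1 * Int (fun x => g0 x * chi k x * gauss q x))).
- move=> e e_gt0; near=> k; near=> N; rewrite -expectB.
  have k0 : 0 < k.+1%:R :> R by rewrite ltr0n.
  rewrite (@le_trans _ _ (E N (fun x => B * c0 / k.+1%:R * expR (lam1 / 2 * nsq x))))//.
    apply: expect_norm => x; rewrite -{1}[g0 x]mulr1 -mulrBr normrM.
    rewrite (ger0_norm (_ : 0 <= 1 - chi k x)) ?subr_ge0//.
    rewrite (@le_trans _ _ (B * expR (lam / 2 * nsq x) * (nsq x / k.+1%:R)))//.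
      by rewrite ler_pM// subr_ge0.
    have -> : B * expR (lam / 2 * nsq x) * (nsq x / k.+1%:R) =
      B / k.+1%:R * (nsq x * expR (lam / 2 * nsq x)) by ring.
    rewrite [B * c0 / _]mulrAC -[leRHS]mulrA ler_wpM2l// divr_ge0//.
  rewrite expectZ (@le_trans _ _ (B * c0 / k.+1%:R * M))//.
    rewrite ler_wpM2l ?divr_ge0 ?mulr_ge0 ?(ltW c00)//.
    by near: N; exact: EM.
  have Dk : B * c0 * M / e <= k.+1%:R.
    rewrite (@le_trans _ _ k%:R) ?ler_nat//.
    by near: k; exact: nbhs_infty_ger.
  move: Dk; rewrite ler_pdivrMr// => Dk.
  by rewrite mulrAC ler_pdivrMr// [leRHS]mulrC.
- move=> k; have gk_le x : `|g0 x * chi k x| <= B * expR (lam / 2 * k.+1%:R).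
    rewrite normrM (ger0_norm (chi_ge0 _ _)); have [xk|xk] := leP (nsq x) k.+1%:R.
      rewrite (@le_trans _ _ `|g0 x|) ?ler_piMr// (le_trans (g0_le x))//.
      by rewrite ler_wpM2l// ler_expR ler_wpM2l// divr_ge0// ltW.
    by rewrite chi_out// mulr0 mulr_ge0// expR_ge0.
  apply: (@expect_cvg _ _ k.+1%:R _ gk_le) => [|x xk].
    exact: continuous_mulR.
  by rewrite chi_out// mulr0.
- have qlam : 0 < q - lam by lra.
  have gq x : `|g0 x| * gauss q x <= B * gauss (q - lam) (x - 0).
    rewrite subr0 (@le_trans _ _ (B * expR (lam / 2 * nsq x) * gauss q x))//.
      by rewrite ler_wpM2r// ltW// gauss_gt0.
    rewrite -mulrA /gauss -expRD le_eqVlt; apply/orP; left; apply/eqP.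
    by congr (_ * expR _); field.
  have igq : integrableC (fun x => B * gauss (q - lam) (x - 0)).
    apply: integrableCZ; apply: (@integrableC_dom _ _ _ 1 (q - lam) 0 qlam).
      exact: continuous_gauss.
    by move=> t; rewrite mul1r ger0_norm// ltW// gauss_gt0.
  apply: cvgMr; apply: (@Int_dominated_cvg _ _ _ _ (fun x => B * gauss (q - lam) (x - 0))) => //.
  + move=> k; apply: continuous_mulR; last exact: continuous_expR_nsq.
    exact: continuous_mulR.
  + apply: (@integrableC_dom _ _ _ B (q - lam) 0 qlam).
      by apply: continuous_mulR => //; exact: continuous_expR_nsq.
    by move=> x; rewrite normrM (ger0_norm (ltW (gauss_gt0 _ _))).
  + move=> k x; rewrite normrM (ger0_norm (ltW (gauss_gt0 _ _))).
    rewrite [`|g0 x * chi k x|]normrM (ger0_norm (chi_ge0 _ _)).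
    rewrite (le_trans _ (gq x))// ler_wpM2r ?(ltW (gauss_gt0 _ _))//.
    by rewrite ler_piMr.
  + move=> x; apply: cvgMl; rewrite -[X in _ --> X]mulr1; apply: cvgMr.
    apply: (@squeeze_cvgr _ _ _ _ (fun k => 1 - nsq x * harmonic k) (fun=> 1)).
    * by apply: nearW => k; rewrite chi_le1 andbT lerBlDl -lerBlDr; exact: chi_near.
    * rewrite -[X in _ --> X]subr0 -(mulr0 (nsq x)); apply: cvgB; first exact: cvg_cst.
      by apply: cvgMr; exact: cvg_harmonic.
    * exact: cvg_cst.
Unshelve. all: by end_near.
Qed.

End TiltedCLT.

(** * Sums over independent uniform spins *)

Section TrigBounds.
Context {R : realType}.
Implicit Types x : R.

(** First of four bounds obtained by repeated integration from [cos <= 1]: each one is the sign of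
    the derivative needed for the next. *)
Lemma sin_le_id x : 0 <= x -> sin x <= x.
Proof.
move=> x0; rewrite -subr_ge0.
suff : (id - @sin R) 0 <= (id - @sin R) x by rewrite /= !fctE sin0 subrr.
apply: (@ge0_derive_le _ _ (fun y => 1 - cos y) _ _ x0) => y _.
by rewrite subr_ge0 cos_le1.
Qed.

Lemma cos_ge_sqr x : 0 <= x -> 1 - x ^+ 2 / 2 <= cos x.
Proof.
move=> x0; rewrite -subr_ge0.
suff : (@cos R + 2^-1 \*o (id ^+ 2)) 0 <= (@cos R + 2^-1 \*o (id ^+ 2)) x.
  by rewrite /= !fctE /= cos0 expr0n/= mulr0; lra.
apply: (@ge0_derive_le _ _ (fun y => y - sin y) _ _ x0) => [y _|y /andP[y0 _]].
  by apply: is_derive_eq; rewrite /GRing.scale /=; field.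
by rewrite subr_ge0 sin_le_id.
Qed.

Lemma sin_ge_cube x : 0 <= x -> x - x ^+ 3 / 6 <= sin x.
Proof.
move=> x0; rewrite -subr_ge0.
suff : (@sin R - id + 6^-1 \*o (id ^+ 3)) 0 <= (@sin R - id + 6^-1 \*o (id ^+ 3)) x.
  by rewrite /= !fctE /= sin0 expr0n/= mulr0; lra.
apply: (@ge0_derive_le _ _ (fun y => cos y - 1 + y ^+ 2 / 2) _ _ x0) => [y _|y /andP[y0 _]].
  by apply: is_derive_eq; rewrite /GRing.scale /=; field.
by have := cos_ge_sqr y0; lra.
Qed.

Lemma cos_le_quartic x : 0 <= x -> cos x <= 1 - x ^+ 2 / 2 + x ^+ 4 / 24.
Proof.
move=> x0; rewrite -subr_ge0.
suff : (- @cos R - 2^-1 \*o (id ^+ 2) + 24^-1 \*o (id ^+ 4)) 0 <=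
       (- @cos R - 2^-1 \*o (id ^+ 2) + 24^-1 \*o (id ^+ 4)) x.
  by rewrite /= !fctE /= cos0 !expr0n/= !mulr0; lra.
apply: (@ge0_derive_le _ _ (fun y => sin y - y + y ^+ 3 / 6) _ _ x0) => [y _|y /andP[y0 _]].
  by apply: is_derive_eq; rewrite /GRing.scale /=; field.
by have := sin_ge_cube y0; lra.
Qed.

Lemma sin_taylor x : `|sin x - x| <= `|x| ^+ 3.
Proof.
wlog x0 : x / 0 <= x.
  move=> wlg; have [x0|/ltW x0] := leP 0 x; first exact: wlg.
  have := wlg (- x); rewrite oppr_ge0 => /(_ x0).
  by rewrite sinN -opprD !normrN.
have := sin_le_id x0; have := sin_ge_cube x0.
have x30 : 0 <= x ^+ 3 by rewrite exprn_ge0.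
rewrite (ger0_norm x0) => h1 h2; rewrite ler_norml; apply/andP; split; lra.
Qed.

Lemma cos_taylor x : `|cos x - (1 - x ^+ 2 / 2)| <= `|x| ^+ 4 / 24.
Proof.
wlog x0 : x / 0 <= x.
  move=> wlg; have [x0|/ltW x0] := leP 0 x; first exact: wlg.
  by have := wlg (- x); rewrite oppr_ge0 => /(_ x0); rewrite cosN sqrrN normrN.
have := cos_ge_sqr x0; have := cos_le_quartic x0.
have x40 : 0 <= x ^+ 4 by rewrite exprn_ge0.
rewrite (ger0_norm x0) => h1 h2; rewrite ler_norml; apply/andP; split; lra.
Qed.

Lemma expRN_taylor x : 0 <= x -> `|1 - x - expR (- x)| <= x ^+ 2.
Proof.
move=> x0; have h1 := expR_ge1Dx (- x).
have h2 : expR (- x) <= 1 - x + x ^+ 2.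
  have x10 : 0 < 1 + x by lra.
  rewrite expRN (@le_trans _ _ (1 + x)^-1)//.
    by rewrite lef_pV2 ?posrE ?expR_gt0// expR_ge1Dx.
  rewrite -[leLHS]mul1r ler_pdivrMr//.
  have : 0 <= x ^+ 3 by rewrite exprn_ge0.
  nra.
rewrite ler_norml; apply/andP; split; lra.
Qed.

End TrigBounds.

(** The factors are replaced one at a time. A numeric domain is general enough for the complex
    characteristic functions to which this is applied. *)
Lemma prod_dist_le (R : numDomainType) (I : Type) (r : seq I) (a b : I -> R) :
  (forall i, `|a i| <= 1) -> (forall i, `|b i| <= 1) ->
  `|\prod_(i <- r) a i - \prod_(i <- r) b i| <= \sum_(i <- r) `|a i - b i|.
Proof.
move=> a1 b1; elim: r => [|i r IH]; first by rewrite !big_nil subrr normr0.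
rewrite !big_cons.
have -> : a i * \prod_(j <- r) a j - b i * \prod_(j <- r) b j =
  a i * (\prod_(j <- r) a j - \prod_(j <- r) b j) + (a i - b i) * \prod_(j <- r) b j by ring.
rewrite (le_trans (ler_normD _ _))// addrC lerD// normrM.
  rewrite ler_piMr// normr_prod.
  by elim: r {IH} => [|j r IH]; rewrite ?big_nil// big_cons mulr_ile1// prodr_ge0.
by rewrite (le_trans _ IH)// ler_piMl.
Qed.

(** * Characteristic and moment generating functions of a sum of independent spins *)

Section Cis.
Context {R : realType}.
Import complex.
Local Open Scope complex_scope.
Local Notation C := (complex.complex R).
Implicit Types x y : R.

(** The exponential [e^(i x)]. Complex numbers serve to factorize over sites; results are read back
    as real parts. *)
Definition cis x : C := Complex (cos x) (sin x).

Lemma cisD x y : cis (x + y) = cis x * cis y.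
Proof.
rewrite /cis cosD sinD; apply/eqP; rewrite eq_complex/= eqxx /=.
by apply/eqP; ring.
Qed.

Lemma cis0 : cis 0 = 1. Proof. by rewrite /cis cos0 sin0. Qed.

Lemma cis_sum (I : Type) (r : seq I) (F : I -> R) :
  cis (\sum_(i <- r) F i) = \prod_(i <- r) cis (F i).
Proof.
elim: r => [|i r IH]; first by rewrite !big_nil cis0.
by rewrite !big_cons cisD IH.
Qed.

Lemma normc_cis x : `|cis x| = 1.
Proof. by rewrite normc_def /= cos2Dsin2 sqrtr1. Qed.

Lemma normc_le (z : C) : `|z| <= real_complex_def (Phant R) (`|Re z| + `|Im z|).
Proof.
rewrite normc_def lecR -[leRHS]ger0_norm ?addr_ge0// -sqrtr_sqr.
rewrite ler_wsqrtr// sqrrD !real_normK ?num_real// addrAC lerDl.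
by rewrite mulrn_wge0// mulr_ge0.
Qed.

Lemma Re_sum (I : Type) (r : seq I) (F : I -> C) :
  Re (\sum_(i <- r) F i) = \sum_(i <- r) Re (F i).
Proof. by elim: r => [|i r IH]; rewrite ?big_nil// !big_cons -IH; case: (F i) (\sum_(j <- r) F j) => a b []. Qed.

Lemma Im_sum (I : Type) (r : seq I) (F : I -> C) :
  Im (\sum_(i <- r) F i) = \sum_(i <- r) Im (F i).
Proof. by elim: r => [|i r IH]; rewrite ?big_nil// !big_cons -IH; case: (F i) (\sum_(j <- r) F j) => a b []. Qed.

Lemma Re_realM (a : R) (z : C) : Re (a%:C * z) = a * Re z.
Proof. by case: z => x y /=; rewrite mul0r subr0. Qed.

Lemma Im_realM (a : R) (z : C) : Im (a%:C * z) = a * Im z.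
Proof. by case: z => x y /=; rewrite mul0r addr0. Qed.

Variables (N q : nat) (eta : 'I_N -> 'I_q.+1 -> R) (dlt : R).
Hypotheses (eta_sum0 : forall i, \sum_c eta i c = 0)
  (eta_le : forall i c, `|eta i c| <= dlt) (dlt_ge0 : 0 <= dlt) (dlt1 : dlt <= 1).

Let V := \sum_i \sum_c eta i c ^+ 2.
Let Q : R := q.+1%:R.
(** If site [i] with color [c] contributes [eta i c], then [v i] is the variance of its contribution
    under the uniform law and [phi i] below is its characteristic function. *)
Let v i := Q^-1 * \sum_c eta i c ^+ 2.
Let phi i : C := (Q^-1)%:C * \sum_c cis (eta i c).

Let Q_gt0 : 0 < Q. Proof. by rewrite ltr0n. Qed.

Let v_ge0 i : 0 <= v i.
Proof. by rewrite mulr_ge0 ?invr_ge0 ?(ltW Q_gt0)// sumr_ge0// => c _; exact: sqr_ge0. Qed.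

Let v_le i : v i <= dlt ^+ 2.
Proof.
rewrite /v mulrC ler_pdivrMr//.
rewrite (@le_trans _ _ (\sum_(c < q.+1) dlt ^+ 2))//.
  apply: ler_sum => c _; rewrite -real_normK ?num_real//.
  by rewrite lerXn2r ?nnegrE .
by rewrite sumr_const card_ord mulr_natr.
Qed.

Let avg_le i K (F : 'I_q.+1 -> R) : (forall c, `|F c| <= K * eta i c ^+ 2) ->
  `|Q^-1 * \sum_c F c| <= K * v i.
Proof.
move=> FK; rewrite normrM ger0_norm ?invr_ge0 ?(ltW Q_gt0)// /v mulrCA.
rewrite ler_wpM2l ?invr_ge0 ?(ltW Q_gt0)// (le_trans (ler_norm_sum _ _ _))//.
by rewrite mulr_sumr; apply: ler_sum.
Qed.

(** The linear term vanishes because [eta i] sums to 0, and the quadratic terms agree. The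
    remainders, cubic in the sine, quartic in the cosine and quadratic in [v i], each yield a factor
    [dlt] times [v i], with coefficients 1, 1/24 and 1/4. *)
Lemma char_factor_dist i :
  `|phi i - (expR (- (v i / 2)))%:C| <= (2 * dlt * v i)%:C.
Proof.
have dlt0 := dlt_ge0; have v0 := v_ge0 i; have vd := v_le i.
have Qsum1 : Q^-1 * \sum_(c < q.+1) 1 = 1 :> R.
  by rewrite sumr_const card_ord mulVf// gt_eqF.
have d2 : dlt ^+ 2 <= dlt by rewrite expr2 ler_piMr.
rewrite (le_trans (normc_le _))// lecR.
have -> : Re (phi i - (expR (- (v i / 2)))%:C) =
    Q^-1 * \sum_c (cos (eta i c) - (1 - eta i c ^+ 2 / 2)) +
    (1 - v i / 2 - expR (- (v i / 2))).
  rewrite raddfB /= /phi Re_realM Re_sum /= !sumrB -mulr_suml.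
  rewrite !mulrBr Qsum1 /v; ring.
have -> : Im (phi i - (expR (- (v i / 2)))%:C) = Q^-1 * \sum_c (sin (eta i c) - eta i c).
  by rewrite raddfB /= subr0 /phi Im_realM Im_sum /= sumrB eta_sum0 subr0.
have h1 : `|Q^-1 * \sum_c (cos (eta i c) - (1 - eta i c ^+ 2 / 2))| <= dlt / 24 * v i.
  apply: avg_le => c; rewrite (le_trans (cos_taylor _))// [leRHS]mulrAC ler_wpM2r//.
  rewrite (_ : _ ^+ 4 = `|eta i c| ^+ 2 * `|eta i c| ^+ 2); last by ring.
  rewrite -[X in _ <= _ * X]real_normK ?num_real// ler_wpM2r ?sqr_ge0//.
  by rewrite (le_trans _ d2)// lerXn2r ?nnegrE.
have h2 : `|Q^-1 * \sum_c (sin (eta i c) - eta i c)| <= dlt * v i.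
  apply: avg_le => c; rewrite (le_trans (sin_taylor _))//.
  rewrite exprS -[X in _ <= _ * X]real_normK ?num_real//.
  by rewrite ler_wpM2r ?sqr_ge0.
have h3 : `|1 - v i / 2 - expR (- (v i / 2))| <= dlt / 4 * v i.
  have v20 : 0 <= v i / 2 by rewrite divr_ge0.
  have vdd : v i * v i <= dlt * v i by rewrite ler_wpM2r// (le_trans vd).
  by rewrite (le_trans (expRN_taylor v20))//; lra.
rewrite (le_trans (lerD (ler_normD _ _) (lexx _)))//.
rewrite (le_trans (lerD (lerD h1 h3) h2))//.
have : 0 <= dlt * v i by rewrite mulr_ge0.
lra.
Qed.

Lemma normc_phi i : `|phi i| <= 1.
Proof.
rewrite /phi normrM normc_def /= expr0n addr0 sqrtr_sqr ger0_norm ?invr_ge0 ?(ltW Q_gt0)//.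
rewrite (@le_trans _ _ ((Q^-1)%:C * \sum_(c < q.+1) 1))//.
  apply: ler_wpM2l; first by rewrite lecR invr_ge0 ltW.
  rewrite (le_trans (ler_norm_sum _ _ _))//.
  by apply: ler_sum => c _; rewrite normc_cis.
rewrite sumr_const card_ord -[X in _ * X](rmorph_nat (real_complex R)) -rmorphM /=.
by rewrite mulVf ?gt_eqF.
Qed.

Lemma prod_phiE : \prod_i phi i =
  ((Q ^+ N)^-1)%:C * \sum_(w : {ffun 'I_N -> 'I_q.+1}) cis (\sum_i eta i (w i)).
Proof.
rewrite /phi big_split /= prodr_const card_ord -rmorphXn /= exprVn.
congr (_ * _); rewrite (bigA_distr_bigA (fun i c => cis (eta i c))).
by apply: eq_bigr => w _; rewrite cis_sum.
Qed.

(** The distance of the products is at most the sum of the distances of the factors. Multiplying the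
    difference by [cis c], of modulus 1, before taking the real part produces the phase without
    further error. *)
Lemma mean_cos_dist c :
  `|(Q ^+ N)^-1 * (\sum_(w : {ffun 'I_N -> 'I_q.+1}) cos (\sum_i eta i (w i) + c))
     - expR (- (V / (2 * Q))) * cos c| <= 2 * dlt * V.
Proof.
pose E i : C := (expR (- (v i / 2)))%:C.
have E1 i : `|E i| <= 1.
  rewrite /E normc_def /= expr0n addr0 sqrtr_sqr ger0_norm ?expR_ge0//.
  by rewrite lecR -expR0 ler_expR oppr_le0 divr_ge0.
have VE : V / Q = \sum_i v i by rewrite /V mulrC mulr_sumr.
have prodE : \prod_i E i = (expR (- (V / (2 * Q))))%:C.
  rewrite /E -rmorph_prod /= -expR_sum; congr (expR _)%:C.
  rewrite sumrN -mulr_suml -VE; congr (- _); field.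
  by rewrite gt_eqF.
have := prod_dist_le (index_enum 'I_N) normc_phi E1.
have sumE : \sum_i `|phi i - E i| <= (2 * dlt * V)%:C.
  rewrite (@le_trans _ _ (\sum_i (2 * dlt * v i)%:C))//.
    by apply: ler_sum => i _; exact: char_factor_dist.
  rewrite -rmorph_sum /= -mulr_sumr -VE lecR ler_wpM2l ?mulr_ge0//.
  rewrite ler_pdivrMr// ler_peMr ?ler1n//.
  by apply: sumr_ge0 => i _; apply: sumr_ge0 => k _; exact: sqr_ge0.
move=> /le_trans /(_ sumE).
set D := _ - _ => DV.
have := normc_ge_Re (cis c * D).
rewrite normrM normc_cis mul1r => /le_trans /(_ DV); rewrite lecR.
congr (`|_| <= _).
rewrite /D mulrBr raddfB /= prodE prod_phiE; congr (_ - _); last first.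
  by rewrite mulrC Re_realM.
rewrite mulrCA mulr_sumr Re_realM Re_sum; congr (_ * _).
by apply: eq_bigr => w _; rewrite -cisD addrC.
Qed.

(** Independence factorizes the mean over the sites; the one-spin bound applies to each factor and
    the exponents add up to that of [V]. *)
Lemma mean_expR_sum_le : (0 < q)%N ->
  (Q ^+ N)^-1 * (\sum_(w : {ffun 'I_N -> 'I_q.+1}) expR (\sum_i eta i (w i)))
  <= expR (V / (2 * zeta q.+1)).
Proof.
case: q eta eta_sum0 @V @Q => [//|q'] eta' eta'0 V' Q' _.
have -> : \sum_(w : {ffun 'I_N -> 'I_q'.+2}) expR (\sum_i eta' i (w i)) =
    \prod_i \sum_c expR (eta' i c).
  rewrite bigA_distr_bigA; apply: eq_bigr => w _; exact: expR_sum.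
rewrite -exprVn -[X in _ ^+ X]card_ord -prodr_const -big_split /=.
rewrite /V' mulr_suml expR_sum; apply: ler_prod => i _.
rewrite mean_expR_le// andbT mulr_ge0 ?invr_ge0 ?ler0n// sumr_ge0// => c _.
Qed.

End Cis.

(** * The block Potts model *)

Section KroneckerIdentity.
Context {R : realType} {s r : nat}.
Implicit Types (x y : 'cV[R]_(s * r)) (B : 'M[R]_s).

Lemma sum_mxtens (F : 'I_(s * r) -> R) :
  \sum_i F i = \sum_(k < s) \sum_(l < r) F (mxtens_index (k, l)).
Proof.
rewrite pair_big /= (reindex (@mxtens_index s r)) /=.
  by apply: eq_bigr => -[k l] _.
by exists (@mxtens_unindex s r) => i _; rewrite ?mxtens_indexK ?mxtens_unindexK.
Qed.

(* x is read as the r vectors of R^s given by a fixed second tensor index. *)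
Definition slice x (l : 'I_r) : 'cV[R]_s := \col_k x (mxtens_index (k, l)) 0.

Lemma nsq_slice x : nsq x = \sum_l nsq (slice x l).
Proof.
rewrite /nsq sum_mxtens exchange_big /=; apply: eq_bigr => l _.
by apply: eq_bigr => k _; rewrite mxE.
Qed.

Lemma quad_form_tens1 B x :
  quad_form (B *t 1%:M) x = \sum_l quad_form B (slice x l).
Proof.
rewrite quad_formE sum_mxtens exchange_big /=; apply: eq_bigr => l _.
rewrite quad_formE; apply: eq_bigr => k _.
rewrite sum_mxtens; apply: eq_bigr => k' _.
rewrite (bigD1 l)//= big1 ?addr0 => [|l' l'l]; rewrite tensmxE !mxE.
  by rewrite eqxx mulr1.
by rewrite eq_sym (negbTE l'l) mulr0 mulr0 mul0r.
Qed.

(** By [|y_i y_j| <= (y_i^2 + y_j^2) / 2], an entrywise bound [e] costs a factor [s] as a bound on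
    forms; the tensor factor costs nothing, slice by slice. *)
Lemma quad_form_tens1_dist_le B B' x e :
  (forall k k', `|B k k' - B' k k'| <= e) ->
  `|quad_form (B *t 1%:M) x - quad_form (B' *t 1%:M) x| <= s%:R * e * nsq x.
Proof.
move=> BB'; rewrite !quad_form_tens1 -sumrB nsq_slice mulr_sumr.
rewrite (le_trans (ler_norm_sum _ _ _))//; apply: ler_sum => l _.
set y := slice x l.
rewrite !quad_formE -sumrB (le_trans (ler_norm_sum _ _ _))//.
rewrite (@le_trans _ _ (\sum_(i < s) \sum_(j < s) e / 2 * (y i 0 ^+ 2 + y j 0 ^+ 2)))//.
  apply: ler_sum => i _; rewrite -sumrB (le_trans (ler_norm_sum _ _ _))//.
  apply: ler_sum => j _.
  have -> : y i 0 * B i j * y j 0 - y i 0 * B' i j * y j 0 =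
    (B i j - B' i j) * (y i 0 * y j 0) by ring.
  rewrite normrM -mulrA ler_pM// normrM.
  rewrite -(real_normK (num_real (y i 0))) -(real_normK (num_real (y j 0))).
  have : 0 <= (`|y i 0| - `|y j 0|) ^+ 2 by rewrite sqr_ge0.
  by nra.
have -> : \sum_(i < s) \sum_(j < s) e / 2 * (y i 0 ^+ 2 + y j 0 ^+ 2) =
    \sum_(i < s) (s%:R * (e / 2) * y i 0 ^+ 2 + e / 2 * nsq y).
  apply: eq_bigr => i _; rewrite -mulr_sumr big_split /= sumr_const card_ord.
  by rewrite -/(nsq y) -mulr_natl; ring.
rewrite big_split /= sumr_const card_ord -mulr_sumr -/(nsq y) -mulr_natl.
by rewrite le_eqVlt; apply/orP; left; apply/eqP; field.
Qed.

End KroneckerIdentity.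

(** * Spectral norm and positive definite matrices *)

Section SpectralNorm.
Context {R : realType} {d : nat}.
Implicit Types (M : 'M[R]_d) (x : 'cV[R]_d).

Lemma norm2E x : norm2 x = Num.sqrt (nsq x). Proof. by []. Qed.

Lemma norm2Z (a : R) x : norm2 (a *: x) = `|a| * norm2 x.
Proof.
rewrite !norm2E -sqrtr_sqr -sqrtrM ?sqr_ge0//; congr Num.sqrt.
by rewrite /nsq mulr_sumr; apply: eq_bigr => i _; rewrite mxE exprMn.
Qed.

(** The supremum in [spectral_norm] has its meaning only for a bounded set. Absolute row sums give a
    crude bound, since the entries of a vector of norm at most 1 are at most 1 in absolute value. *)
Lemma has_ubound_spectral M :
  has_ubound [set norm2 (M *m x) | x in [set x : 'cV[R]_d | norm2 x <= 1]].
Proof.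
exists (Num.sqrt (\sum_i (\sum_j `|M i j|) ^+ 2)) => _ [x /= x1 <-].
rewrite norm2E ler_wsqrtr//; apply: ler_sum => i _.
rewrite -real_normK ?num_real// lerXn2r ?nnegrE ?sumr_ge0// mxE.
rewrite (le_trans (ler_norm_sum _ _ _))//; apply: ler_sum => j _.
rewrite normrM ler_piMr// -sqrtr_sqr (le_trans _ x1)//.
by rewrite norm2E ler_wsqrtr// nsq_entry_le.
Qed.

Lemma norm2_mul_le M x : norm2 (M *m x) <= spectral_norm M * norm2 x.
Proof.
have [->|x0] := eqVneq x 0.
  rewrite mulmx0 (_ : norm2 0 = 0) ?mulr0// norm2E /nsq big1 ?sqrtr0// => i _.
  by rewrite mxE expr0n.
have n0 : 0 < norm2 x by rewrite norm2E sqrtr_gt0 nsq_gt0.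
rewrite -ler_pdivrMr//.
have -> : norm2 (M *m x) / norm2 x = norm2 (M *m ((norm2 x)^-1 *: x)).
  by rewrite -scalemxAr norm2Z ger0_norm ?invr_ge0 ?(ltW n0)// mulrC.
apply: ub_le_sup; first exact: has_ubound_spectral.
exists ((norm2 x)^-1 *: x) => //=.
by rewrite norm2Z ger0_norm ?invr_ge0 ?(ltW n0)// mulVf// gt_eqF.
Qed.

(** Young's inequality with weight [lam] stands in for Cauchy-Schwarz:
    [u w <= lam / 2 * u^2 + w^2 / (2 lam)] in each coordinate, then the norm bound on [M x]. *)
Lemma quad_form_le_spectral M lam x : 0 < lam -> spectral_norm M <= lam ->
  quad_form M x <= lam * nsq x.
Proof.
move=> lam0 Mlam.
have nMx : nsq (M *m x) <= lam ^+ 2 * nsq x.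
  rewrite -(sqr_sqrtr (nsq_ge0 (M *m x))) -(sqr_sqrtr (nsq_ge0 x)) -exprMn.
  rewrite lerXn2r ?nnegrE ?sqrtr_ge0// ?mulr_ge0 ?sqrtr_ge0 ?(ltW lam0)//.
  rewrite (le_trans (norm2_mul_le M x))// ler_wpM2r ?sqrtr_ge0//.
have -> : quad_form M x = \sum_i x i 0 * (M *m x) i 0.
  rewrite /quad_form -mulmxA mxE; apply: eq_bigr => i _.
  by rewrite mxE.
rewrite (@le_trans _ _ (lam / 2 * nsq x + (2 * lam)^-1 * nsq (M *m x)))//.
  rewrite /nsq !mulr_sumr -big_split /=; apply: ler_sum => i _.
  set u := x i 0; set w := (M *m x) i 0; rewrite -subr_ge0.
  have -> : lam / 2 * u ^+ 2 + (2 * lam)^-1 * w ^+ 2 - u * w =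
    (lam * u - w) ^+ 2 / (2 * lam) by field; rewrite gt_eqF.
  by rewrite divr_ge0 ?sqr_ge0// mulr_ge0// ltW.
rewrite (@le_trans _ _ (lam / 2 * nsq x + (2 * lam)^-1 * (lam ^+ 2 * nsq x)))//.
  by rewrite lerD2l ler_wpM2l// invr_ge0 mulr_ge0// ltW.
by rewrite le_eqVlt; apply/orP; left; apply/eqP; field; rewrite gt_eqF.
Qed.

End SpectralNorm.

Section PosDef.
Context {R : realType} {d : nat}.
Implicit Types (M : 'M[R]_d).

Lemma posdef_unitmx M : M^T = M -> posdefmx M -> M \in unitmx.
Proof.
move=> Msym Mpos; have [D0 _] := integral_gauss_quad 0 Msym Mpos.
by rewrite unitmxE unitfE gt_eqF.
Qed.

Lemma posdef_invmx M : M^T = M -> posdefmx M ->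
  (invmx M)^T = invmx M /\ posdefmx (invmx M).
Proof.
move=> Msym Mpos; have Mu := posdef_unitmx Msym Mpos.
split; first by rewrite trmx_inv Msym.
move=> x x0; have -> : x = M *m (invmx M *m x) by rewrite mulKVmx.
set y := invmx M *m x.
have -> : quad_form (invmx M) (M *m y) = quad_form M y.
  by rewrite /quad_form trmx_mul Msym -!mulmxA mulKmx.
apply: Mpos; apply: contraNneq x0 => y0.
by rewrite -(mulKVmx Mu x) -/y y0 mulmx0.
Qed.

End PosDef.

(** * Blocks of sites and the rotation of the colors *)

Section Blocks.
Variables (R : realType) (s N : nat) (S : 'I_s -> {set 'I_N}).
Hypothesis Spart : block_partition S.

(** A map from sites to block labels turns sums over blocks and their members into single sums over
    sites. *)
Lemma block_label : exists kappa : 'I_N -> 'I_s, forall j k, (j \in S k) = (kappa j == k).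
Proof.
case: Spart => Sinj /and3P[/eqP Scov Striv _].
have exk j : exists k, j \in S k.
  have : j \in finset.cover (S @: 'I_s)%SET by rewrite Scov finset.in_setT.
  by case/bigcupP => _ /imsetP[k _ ->] jk; exists k.
pose kappa j := xchoose (exk j).
have kP j : j \in S (kappa j) := xchooseP (exk j).
exists kappa => j k; apply/idP/eqP => [jk|<-//].
apply/eqP/contraT => kk.
have Sk : S (kappa j) != S k by apply: contra kk => /eqP /Sinj ->.
have := (finset.trivIsetP Striv) _ _ (imset_f S (erefl (kappa j \in predT))) (imset_f S (erefl (k \in predT))) Sk.
by rewrite disjoint_subset => /fintype.subsetP /(_ j (kP j)); rewrite inE jk.
Qed.

Lemma block_card_gt0 k : (0 < #|S k|)%N.
Proof.
case: Spart => _ /and3P[_ _ S0]; rewrite card_gt0; apply: contraNneq S0 => <-.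
by apply: imset_f.
Qed.

Lemma sum_blocks (F : 'I_s -> 'I_N -> R) (kappa : 'I_N -> 'I_s) :
  (forall j k, (j \in S k) = (kappa j == k)) ->
  \sum_k \sum_(j in S k) F k j = \sum_j F (kappa j) j.
Proof.
move=> kP; under eq_bigr do rewrite big_mkcond.
rewrite exchange_big /=; apply: eq_bigr => j _.
rewrite (bigD1 (kappa j))//= kP eqxx big1 ?addr0// => k kj.
by rewrite kP eq_sym (negbTE kj).
Qed.
End Blocks.

Section Rotation.
Context {R : realType} {q : nat}.
Variable Rot : 'M[R]_q.+2.
Hypothesis RotP : rotation_to_last Rot.

(** Its rows are an orthonormal basis of the hyperplane orthogonal to the constant vector in color
    space. *)
Definition projrot : 'M[R]_(q.+1, q.+2) := (pid_mx q.+1 : 'M[R]_(q.+1, q.+2)) *m Rot.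

Lemma projrotE l c : projrot l c = Rot (widen_ord (leqnSn _) l) c.
Proof.
rewrite mxE (bigD1 (widen_ord (leqnSn _) l))//= big1 ?addr0 => [|j jl]; rewrite !mxE.
  by rewrite eqxx ltn_ord mul1r.
suff /negbTE -> : val l != val j by rewrite mul0r.
by apply: contra jl => /eqP lj; apply/eqP/val_inj.
Qed.

Lemma Rot_last c : Rot ord_max c = (Num.sqrt q.+2%:R)^-1.
Proof.
case: RotP => RRt _ Ru.
have : Rot^T *m (Rot *m const_mx (Num.sqrt q.+2%:R)^-1) =
    Rot^T *m \col_(i < q.+2) (i.+1 == q.+2)%:R :> 'cV[R]_q.+2 by rewrite Ru.
rewrite mulmxA (mulmx1C RRt) mul1mx => /matrixP /(_ c 0); rewrite !mxE => ->.
rewrite (bigD1 ord_max)//= big1 ?addr0 => [|j jm]; rewrite !mxE.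
  by rewrite eqxx mulr1.
suff /negbTE -> : j.+1 != q.+2 by rewrite mulr0.
by apply: contra jm => /eqP [jq]; apply/eqP/val_inj.
Qed.

Lemma projrot_orth l l' : \sum_c projrot l c * projrot l' c = (l == l')%:R.
Proof.
case: RotP => /matrixP /(_ (widen_ord (leqnSn _) l) (widen_ord (leqnSn _) l')) + _ _.
rewrite !mxE => h; transitivity ((widen_ord (leqnSn q.+1) l == widen_ord (leqnSn _) l')%:R : R).
  by rewrite -h; apply: eq_bigr => c _; rewrite !projrotE !mxE.
by congr (_%:R); rewrite -!val_eqE.
Qed.

(** Orthogonality of the columns of [Rot], with the last row removed; that row is constant and
    contributes the inverse number of colors. *)
Lemma projrot_gram c c' :
  \sum_l projrot l c * projrot l c' = (c == c')%:R - q.+2%:R^-1.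
Proof.
case: RotP => /mulmx1C /matrixP /(_ c c') + _ _.
rewrite !mxE big_ord_recr /= !mxE => <-.
rewrite !Rot_last -invfM -expr2 sqr_sqrtr ?ler0n// addrK.
by apply: eq_bigr => l _; rewrite !projrotE !mxE.
Qed.

Lemma projrot_sum0 l : \sum_c projrot l c = 0.
Proof.
case: RotP => /matrixP /(_ (widen_ord (leqnSn _) l) ord_max) + _ _.
rewrite !mxE => h.
have : \sum_c projrot l c * (Num.sqrt q.+2%:R)^-1 = 0.
  rewrite [RHS](_ : 0 = (widen_ord (leqnSn q.+1) l == ord_max)%:R); last first.
    by rewrite -val_eqE /= ltn_eqF.
  by rewrite -h; apply: eq_bigr => c _; rewrite projrotE !mxE Rot_last.
rewrite -mulr_suml => /eqP; rewrite mulf_eq0 invr_eq0 sqrtr_eq0.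
by rewrite leNgt ltr0n orbF => /eqP.
Qed.
End Rotation.

(** * The Hamiltonian as a quadratic form at finite N *)

Section PottsFiniteN.
Context {R : realType} {s q N : nat}.
Variables (S : 'I_s -> {set 'I_N}) (Rot : 'M[R]_q.+2).
Hypotheses (Spart : block_partition S) (RotP : rotation_to_last Rot).
Local Notation P := (projrot Rot).
Local Notation n k := (#|S k|%:R : R).
Implicit Types w : {ffun 'I_N -> 'I_q.+2}.

Let m w k c : R := (n k)^-1 * \sum_(j in S k) (w j == c)%:R.

Lemma magnetizationE w k c : magnetization S w (mxtens_index (k, c)) 0 = m w k c.
Proof. by rewrite mxE mxtens_indexK. Qed.

Lemma magnetization_sum1 w k : \sum_c m w k c = 1.
Proof.
rewrite /m -mulr_sumr exchange_big /=.
rewrite (eq_bigr (fun=> 1)) => [|j _].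
  by rewrite sumr_const mulVf// pnatr_eq0 -lt0n block_card_gt0.
by rewrite (bigD1 (w j))//= eqxx big1 ?addr0// => c /negbTE; rewrite eq_sym => ->.
Qed.

(** The centering by the uniform vector disappears because the rows of [projrot] sum to 0. *)
Lemma rotated_magnetizationE w k l :
  rotated_magnetization S Rot w (mxtens_index (k, l)) 0 =
  Num.sqrt (n k) * \sum_c P l c * m w k c.
Proof.
rewrite /rotated_magnetization.
have -> : map_mx Num.sqrt (calS q.+2 S) =
    diag_mx (\row_k Num.sqrt (n k)) *t (1%:M : 'M[R]_q.+2).
  apply/matrixP => i j.
  case: (mxtens_indexP i) => k1 c1; case: (mxtens_indexP j) => k2 c2.
  rewrite mxE !tensmxE !mxE.
  case: (eqVneq k1 k2) => _; case: (eqVneq c1 c2) => _;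
    by rewrite ?mulr1n ?mulr0n ?mulr1 ?mulr0 ?mul0r ?sqrtr0.
rewrite tensmx_mul mul1mx mulmx1 mxE sum_mxtens (bigD1 k)//= [X in _ + X]big1 ?addr0; last first.
  move=> k' k'k; rewrite big1// => c _; rewrite tensmxE !mxE eq_sym (negbTE k'k).
  by rewrite mulr0n !mul0r.
rewrite mulr_sumr.
transitivity (\sum_c (Num.sqrt (n k) * (P l c * m w k c) - Num.sqrt (n k) * q.+2%:R^-1 * P l c)).
  apply: eq_bigr => c _; rewrite tensmxE -/P.
  rewrite (_ : (magnetization S w - _) _ _ = m w k c - q.+2%:R^-1); last first.
    by rewrite !mxE mxtens_indexK.
  rewrite (_ : diag_mx _ k k = Num.sqrt (n k)); last by rewrite !mxE eqxx mulr1n.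
  by ring.
by rewrite sumrB -[X in _ - X]mulr_sumr projrot_sum0// mulr0 subr0.
Qed.

Lemma rotated_magnetization_sites w k l :
  rotated_magnetization S Rot w (mxtens_index (k, l)) 0 =
  (Num.sqrt (n k))^-1 * \sum_(j in S k) P l (w j).
Proof.
have n0 : 0 < n k by rewrite ltr0n block_card_gt0.
rewrite rotated_magnetizationE.
have -> : \sum_c P l c * m w k c = (n k)^-1 * \sum_(j in S k) P l (w j).
  rewrite /m; under eq_bigr do rewrite mulrCA mulr_sumr.
  rewrite -mulr_sumr exchange_big /=; congr (_ * _); apply: eq_bigr => j _.
  rewrite (bigD1 (w j))//= eqxx mulr1 big1 ?addr0// => c cw.
  by rewrite eq_sym (negbTE cw) mulr0.
rewrite mulrA; congr (_ * _); rewrite -{2}(sqr_sqrtr (ltW n0)).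
by field; rewrite gt_eqF// sqrtr_gt0.
Qed.

(** The matrix [S^(1/2) A S^(1/2) / N]: the other square roots of the block sizes in the Hamiltonian
    are absorbed by the rotated magnetization. *)
Definition interaction_mx (A : 'M[R]_s) : 'M[R]_s :=
  \matrix_(k, k') (Num.sqrt (n k) * Num.sqrt (n k') / N%:R * A k k').

Lemma quad_form_tens1_gram (r : nat) (B : 'M[R]_s) (x : 'cV[R]_(s * r)) :
  quad_form (B *t 1%:M) x = \sum_k \sum_k' B k k' *
    \sum_l x (mxtens_index (k, l)) 0 * x (mxtens_index (k', l)) 0.
Proof.
rewrite quad_form_tens1; under eq_bigr do rewrite quad_formE.
rewrite exchange_big /=; apply: eq_bigr => k _.
rewrite exchange_big /=; apply: eq_bigr => k' _.
by rewrite mulr_sumr; apply: eq_bigr => l _; rewrite !mxE; ring.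
Qed.

(** Colors sum to 1 in each block, so by [projrot_gram] an inner product of rotated block vectors is
    the original one minus the inverse number of colors, up to the size factors. The subtracted
    terms make up [K], which does not depend on the configuration and cancels in the Gibbs
    weights. *)
Lemma hamiltonianE (A : 'M[R]_s) : exists K, forall w,
  - hamiltonian S A w =
  K + quad_form (interaction_mx A *t 1%:M) (rotated_magnetization S Rot w) / 2.
Proof.
exists (\sum_k \sum_k' (2 * N%:R)^-1 * (n k * A k k' * n k') / q.+2%:R) => w.
rewrite /hamiltonian opprK.
have -> : (magnetization S w)^T *m calS q.+2 S *m (A *t 1%:M) *m calS q.+2 S *m magnetization S w =
    (magnetization S w)^T *m ((block_size_mx S *m A *m block_size_mx S) *t 1%:M) *m magnetization S w.
  by rewrite /calS -!(mulmxA (_^T)) !tensmx_mul !mulmx1.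
rewrite -/(quad_form _ _) !quad_form_tens1_gram mulr_sumr mulr_suml -big_split /=.
apply: eq_bigr => k _; rewrite mulr_sumr mulr_suml -big_split /=.
apply: eq_bigr => k' _.
have -> : (block_size_mx S *m A *m block_size_mx S) k k' = n k * A k k' * n k'.
  by rewrite /block_size_mx mul_mx_diag mxE mul_diag_mx !mxE.
under eq_bigr do rewrite !magnetizationE.
have -> : \sum_l rotated_magnetization S Rot w (mxtens_index (k, l)) 0 *
    rotated_magnetization S Rot w (mxtens_index (k', l)) 0 =
    Num.sqrt (n k) * Num.sqrt (n k') * (\sum_c m w k c * m w k' c - q.+2%:R^-1).
  under eq_bigr do rewrite !rotated_magnetizationE mulrACA.
  rewrite -mulr_sumr; congr (_ * _).
  transitivity (\sum_c \sum_c' m w k c * m w k' c' * ((c == c')%:R - q.+2%:R^-1)).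
    under eq_bigr do rewrite mulr_suml.
    rewrite exchange_big /=; apply: eq_bigr => c _.
    under eq_bigr do rewrite mulr_sumr.
    rewrite exchange_big /=; apply: eq_bigr => c' _.
    rewrite -(projrot_gram RotP) mulr_sumr; apply: eq_bigr => l _; ring.
  transitivity (\sum_c (m w k c * m w k' c - m w k c * q.+2%:R^-1)).
    apply: eq_bigr => c _; under eq_bigr do rewrite mulrBr.
    rewrite sumrB (bigD1 c)//= eqxx mulr1 big1 ?addr0 => [|c' c'c]; last first.
      by rewrite eq_sym (negbTE c'c) mulr0.
    by rewrite -mulr_suml -mulr_sumr magnetization_sum1 mulr1.
  by rewrite sumrB -mulr_suml magnetization_sum1 mul1r.
rewrite mxE; set T := \sum_c _.
rewrite -[in LHS](sqr_sqrtr (ler0n R #|S k|)) -[in LHS](sqr_sqrtr (ler0n R #|S k'|)).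
rewrite -[in X in X + _](sqr_sqrtr (ler0n R #|S k|)) -[in X in X + _](sqr_sqrtr (ler0n R #|S k'|)).
by rewrite invfM; ring.
Qed.

End PottsFiniteN.

(** * Linear functionals of the rotated magnetization as sums over sites *)

Section SiteWeights.
Context {R : realType} {s q N : nat}.
Variables (S : 'I_s -> {set 'I_N}) (Rot : 'M[R]_q.+2).
Hypotheses (Spart : block_partition S) (RotP : rotation_to_last Rot).
Local Notation P := (projrot Rot).
Local Notation n k := (#|S k|%:R : R).
Local Notation X := (rotated_magnetization S Rot).
Implicit Types th : 'cV[R]_(s * q.+1).

(** A bound on the contribution of any single site. Summing over blocks instead of taking the
    maximum makes its limit in [N] immediate. *)
Definition max_weight th : R :=
  (\sum_k (Num.sqrt (n k))^-1) * \sum_i `|th i 0|.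

(** A site of block [k] carries [n_k^(-1/2)] times a combination of the rows of [projrot]. The [n_k]
    sites cancel the squared prefactor, and orthonormal rows make the total of the squares exactly
    [nsq th]; rows summing to 0 make each site centered. *)
Lemma site_weights th : exists eta : 'I_N -> 'I_q.+2 -> R,
  [/\ forall w, dotp th (X w) = \sum_j eta j (w j),
      forall j, \sum_c eta j c = 0,
      \sum_j \sum_c eta j c ^+ 2 = nsq th &
      forall j c, `|eta j c| <= max_weight th].
Proof.
have [kappa kP] := block_label Spart.
pose y k c := \sum_l th (mxtens_index (k, l)) 0 * P l c.
have nk0 k : n k != 0 by rewrite pnatr_eq0 -lt0n block_card_gt0.
exists (fun j c => (Num.sqrt (n (kappa j)))^-1 * y (kappa j) c); split.
- move=> w; rewrite -(sum_blocks (fun k j => (Num.sqrt (n k))^-1 * y k (w j)) kP).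
  rewrite /dotp sum_mxtens; apply: eq_bigr => k _.
  under eq_bigr do rewrite (rotated_magnetization_sites Spart RotP) mulrCA.
  rewrite -!mulr_sumr; congr (_ * _).
  under eq_bigr do rewrite mulr_sumr.
  by rewrite exchange_big.
- move=> j; rewrite -mulr_sumr /y exchange_big /= big1 ?mulr0// => l _.
  by rewrite -mulr_sumr projrot_sum0// mulr0.
- rewrite -(sum_blocks (fun k j => \sum_c ((Num.sqrt (n k))^-1 * y k c) ^+ 2) kP).
  rewrite /nsq sum_mxtens; apply: eq_bigr => k _.
  rewrite sumr_const.
  under eq_bigr do rewrite exprMn exprVn sqr_sqrtr ?ler0n//.
  rewrite -mulr_sumr -[_ *+ _]mulr_natl mulrA divff// mul1r.
  transitivity (\sum_c \sum_l \sum_l' th (mxtens_index (k, l)) 0 *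
      th (mxtens_index (k, l')) 0 * (P l c * P l' c)).
    apply: eq_bigr => c _; rewrite expr2 /y mulr_suml; apply: eq_bigr => l _.
    by rewrite mulr_sumr; apply: eq_bigr => l' _; ring.
  rewrite exchange_big /=; apply: eq_bigr => l _.
  rewrite exchange_big /= (bigD1 l)//= -mulr_sumr projrot_orth// eqxx mulr1 big1 ?addr0//.
  move=> l' l'l; rewrite -mulr_sumr projrot_orth// eq_sym (negbTE l'l) mulr0//.
- move=> j c; rewrite normrM ger0_norm ?invr_ge0 ?sqrtr_ge0// /max_weight ler_pM//.
  + rewrite (bigD1 (kappa j))//= lerDl; apply: sumr_ge0 => k _.
    by rewrite invr_ge0 sqrtr_ge0.
  + rewrite sum_mxtens (bigD1 (kappa j))//=.
    rewrite (@le_trans _ _ (\sum_l `|th (mxtens_index (kappa j, l)) 0|))//; last first.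
      by rewrite lerDl sumr_ge0// => k _; rewrite sumr_ge0.
    rewrite (le_trans (ler_norm_sum _ _ _))//; apply: ler_sum => l _.
    rewrite normrM ler_piMr// -(@ler_sqr _ `|_|) ?nnegrE//.
    rewrite real_normK ?num_real// expr1n.
    have := projrot_orth RotP l l; rewrite eqxx => h; rewrite -[leRHS]h (bigD1 c)//= -expr2 lerDl sumr_ge0// => c' _.
    by rewrite -expr2 sqr_ge0.
Qed.

Lemma uniform_cos_dist th c : max_weight th <= 1 ->
  `|\sum_(w : {ffun 'I_N -> 'I_q.+2}) (q.+2%:R ^+ N)^-1 * cos (dotp th (X w) + c)
     - expR (- (nsq th / (2 * q.+2%:R))) * cos c| <= 2 * max_weight th * nsq th.
Proof.
move=> th1; have [eta [Xeta eta0 <- eta_le]] := site_weights th.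
have th0 : 0 <= max_weight th.
  by apply: mulr_ge0; apply: sumr_ge0 => // k _; rewrite invr_ge0 sqrtr_ge0.
rewrite -mulr_sumr; under eq_bigr do rewrite Xeta.
exact: mean_cos_dist.
Qed.

Lemma uniform_mgf_le th :
  \sum_(w : {ffun 'I_N -> 'I_q.+2}) (q.+2%:R ^+ N)^-1 * expR (dotp th (X w))
  <= expR (nsq th / (2 * zeta q.+2)).
Proof.
have [eta [Xeta eta0 <- eta_le]] := site_weights th.
rewrite -mulr_sumr; under eq_bigr do rewrite Xeta.
exact: mean_expR_sum_le.
Qed.

End SiteWeights.

Lemma cvg_sum0 (R : realType) (s : nat) (F : nat -> 'I_s -> R) :
  (forall k, F ^~ k @ \oo --> 0) -> (fun N => \sum_k F N k) @ \oo --> 0.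
Proof.
move=> F0; rewrite [X in _ --> X](_ : _ = \sum_(k < s) 0); last by rewrite big1.
apply: cvg_big => [|k _]; [exact: add_continuous|exact: F0].
Qed.

(** * Limits of the block sizes and of the interaction matrix *)

Section PottsLimits.
Context {R : realType} {s : nat}.
Variables (S : forall N, 'I_s -> {set 'I_N}) (gamma : 'I_s -> R).
Hypotheses (gamma_gt0 : forall k, 0 < gamma k)
  (gammaP : forall k, (fun N => #|S N k|%:R / N%:R : R) @ \oo --> gamma k).

Lemma sqrt_block_cvg k :
  (fun N => Num.sqrt (#|S N k|%:R / N%:R : R)) @ \oo --> Num.sqrt (gamma k).
Proof.
apply: (@cvg_comp _ _ _ _ (@Num.sqrt R)); first exact: gammaP.
exact: sqrt_continuous.
Qed.

Lemma inv_sqrt_block_cvg k :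
  (fun N => (Num.sqrt (#|S N k|%:R : R))^-1) @ \oo --> (0 : R).
Proof.
rewrite (_ : (fun N => _) = (fun N => (Num.sqrt (#|S N k|%:R / N%:R : R))^-1 *
    (Num.sqrt (N%:R : R))^-1)); last first.
  apply/funext => -[|N].
    (* At [N = 0] there are no sites, and both sides are 0 because the inverse of 0 is 0. *)
    by rewrite (_ : #|S 0%N k| = 0%N) ?sqrtr0 ?invr0 ?mulr0//; apply/eqP; rewrite -leqn0 (leq_trans (max_card _))// card_ord.
  rewrite sqrtrM// sqrtrV// invfM invrK -mulrA divff ?mulr1//.
rewrite -[0 in X in _ --> X](mulr0 (Num.sqrt (gamma k))^-1); apply: cvgM.
  apply: cvgV; first by rewrite gt_eqF// sqrtr_gt0.
  exact: sqrt_block_cvg.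
rewrite (_ : (fun N => _) = (fun N => Num.sqrt (N%:R^-1 : R))); last first.
  by apply/funext => N; rewrite sqrtrV.
rewrite -[0 in X in _ --> X]sqrtr0.
apply: (@cvg_comp _ _ _ _ (@Num.sqrt R)); last exact: sqrt_continuous.
apply/gtr0_cvgV0; last exact: cvgr_idn.
by near=> N; rewrite ltr0n; near: N; exact: nbhs_infty_gt.
Unshelve. all: by end_near.
Qed.

Lemma max_weight_cvg r (th : 'cV[R]_(s * r.+1)) :
  (fun N => max_weight (S N) th) @ \oo --> 0.
Proof.
rewrite /max_weight -[0 in X in _ --> X](mul0r (\sum_i `|th i 0|)); apply: cvgM; last exact: cvg_cst.
by apply: cvg_sum0 => k; exact: inv_sqrt_block_cvg.
Qed.

Variable A : 'M[R]_s.
Local Notation D := (sqrt_diag_mx (diag_mx (\row_k gamma k))).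
Local Notation B := (D *m A *m D).

Lemma limit_mxE k k' : B k k' = Num.sqrt (gamma k) * Num.sqrt (gamma k') * A k k'.
Proof.
have -> : D = diag_mx (\row_k Num.sqrt (gamma k)).
  apply/matrixP => i j; rewrite !mxE.
  by case: eqVneq; rewrite ?mulr1n ?mulr0n ?sqrtr0.
by rewrite mul_mx_diag mxE mul_diag_mx !mxE; ring.
Qed.

Lemma interaction_mx_dist_cvg : exists2 e : nat -> R,
  e @ \oo --> 0 & forall N k k', `|interaction_mx (S N) A k k' - B k k'| <= e N.
Proof.
exists (fun N => \sum_k \sum_k' `|interaction_mx (S N) A k k' - B k k'|) => [|N k k'].
  apply: cvg_sum0 => k; apply: cvg_sum0 => k'.
  rewrite -(@normr0 _ R) -(subrr (B k k')); apply: cvg_norm.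
  apply: cvgB; last exact: cvg_cst.
  rewrite limit_mxE.
  rewrite (_ : (fun N => _) = (fun N => Num.sqrt (#|S N k|%:R / N%:R) *
      Num.sqrt (#|S N k'|%:R / N%:R) * A k k')).
    apply: cvgM; last exact: cvg_cst.
    by apply: cvgM; exact: sqrt_block_cvg.
  apply/funext => N; rewrite mxE !sqrtrM// sqrtrV//.
  rewrite -[in LHS](sqr_sqrtr (ler0n R N)) expr2 invfM; ring.
rewrite (bigD1 k)//= (bigD1 k')//= -addrA lerDl addr_ge0// ?sumr_ge0// => ? _.
by rewrite sumr_ge0.
Qed.

End PottsLimits.

(** * Measures with a density *)

Section Density.
Import HBNNSimple.
Local Open Scope ereal_scope.
Context d (T : measurableType d) (R : realType).
Variables (mu nu : {measure set T -> \bar R}) (g : T -> R).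
Hypotheses (g_ge0 : forall x, (0 <= g x)%R) (mg : measurable_fun setT g)
  (nuE : forall A, measurable A -> nu A = \int[mu]_(x in A) (g x)%:E).

(** [nu] is given by its values on measurable sets, so the density formula is built up from simple
    functions through monotone limits to signed functions. *)
Lemma integral_nnsfun_density (f : {nnsfun T >-> R}) :
  \int[nu]_x (f x)%:E = \int[mu]_x ((f x)%:E * (g x)%:E).
Proof.
under [LHS]eq_integral do rewrite fimfunE -fsumEFin//.
rewrite [LHS]ge0_integral_fsum//; last 2 first.
  - by move=> r; exact/measurable_EFinP/measurableT_comp.
  - by move=> n x _; rewrite EFinM nnfun_muleindic_ge0.
under [RHS]eq_integral.
  move=> x xD; rewrite fimfunE -fsumEFin// ge0_mule_fsuml; last first.
    by move=> r; rewrite EFinM nnfun_muleindic_ge0.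
  over.
rewrite [RHS]ge0_integral_fsum//; last 2 first.
  - move=> r; apply: emeasurable_funM; last exact/measurable_EFinP.
    by apply/measurable_EFinP; apply/measurableT_comp.
  - move=> n x _; rewrite -EFinM lee_fin mulr_ge0//.
    by have := nnfun_muleindic_ge0 f n x; rewrite -EFinM lee_fin.
apply: eq_fsbigr => r _; rewrite integralZl_indic_nnsfun//= integral_indic//= setIT nuE//.
have [r0|r0] := leP 0%R r; last first.
  rewrite preimage_nnfun0// integral_set0 mule0.
  by rewrite (eq_integral (cst 0)) ?integral0// => x _; rewrite indic0 mulr0 mul0e.
rewrite [X in _ * X]integral_mkcond -ge0_integralZl//; last 2 first.
  - by apply/(measurable_restrict _ _ _).1 => //; rewrite setTI; exact/measurable_EFinP/measurable_funTS.
  - by move=> x _; rewrite patchE; case: ifP => _; rewrite ?lee_fin.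
apply: eq_integral => x _; rewrite patchE indicE; case: ifP => _.
  by rewrite mulr1.
by rewrite mulr0 mule0 mul0e.
Qed.

Lemma ge0_integral_density (f : T -> \bar R) : measurable_fun setT f ->
  (forall x, 0 <= f x) -> \int[nu]_x f x = \int[mu]_x (f x * (g x)%:E).
Proof.
move=> mf f0.
pose f_ := nnsfun_approx measurableT mf.
have cvgf x : (f_ n x)%:E @[n --> \oo] --> f x by exact: cvg_nnsfun_approx.
have ndf x n m : (n <= m)%N -> (f_ n x <= f_ m x)%R.
  by move=> nm; exact/lefP/nd_nnsfun_approx.
transitivity (lim (\int[nu]_x (f_ n x)%:E @[n --> \oo])).
  rewrite -monotone_convergence//=.
  - by apply: eq_integral => x _; exact/esym/cvg_lim.
  - by move=> n; exact/measurable_EFinP/measurable_funTS.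
  - by move=> n x _; rewrite lee_fin.
  - by move=> x _ n m nm; rewrite lee_fin ndf.
under eq_fun do rewrite integral_nnsfun_density.
rewrite -monotone_convergence//=.
- apply: eq_integral => x _; apply/cvg_lim => //.
  rewrite muleC; under eq_fun do rewrite muleC.
  by apply: cvgeZl.
- move=> n; apply: emeasurable_funM; last exact/measurable_EFinP.
  exact/measurable_EFinP/measurable_funTS.
- by move=> n x _; rewrite mule_ge0// lee_fin.
- by move=> x _ n m nm; apply: lee_wpmul2r; rewrite lee_fin// ndf.
Qed.

Lemma integral_density (f : T -> R) : measurable_fun setT f ->
  \int[nu]_x (f x)%:E = \int[mu]_x (f x * g x)%:E.
Proof.
move=> /measurable_EFinP mf; rewrite integralE [RHS]integralE; congr (_ - _).
- rewrite ge0_integral_density//; last exact: measurable_funepos.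
  apply: eq_integral => x _; rewrite !funeposE -!EFin_max -EFinM.
  by rewrite maxr_pMl// mul0r.
- rewrite ge0_integral_density//; last exact: measurable_funeneg.
  apply: eq_integral => x _; rewrite !funenegE -!EFinN -!EFin_max -EFinM.
  by rewrite maxr_pMl// mul0r mulNr.
Qed.

End Density.

(** * The normal law through its density *)

Section GaussianLaw.
Context {R : realType} {d : nat}.

Lemma integral_mvnormal (Sigma : 'M[R]_d) (f : 'cV[R]_d -> R) : continuous f ->
  (\int[mvnormal 0 Sigma]_t f (col_of_tuple t))%R =
  Int (fun x => f x * mvnormal_pdf 0 Sigma x).
Proof.
move=> cf; rewrite /Int /Rintegral; congr fine.
apply: (@integral_density _ _ _ (lebesgue_tuple d) (mvnormal 0 Sigma)
  (fun t => mvnormal_pdf 0 Sigma (col_of_tuple t)) _ _ _ (fun t => f (col_of_tuple t))).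
- by move=> t; exact: mvnormal_pdf_ge0.
- exact: measurable_mvnormal_pdf.
- by [].
- exact: measurable_continuous_col.
Qed.

Lemma Int_gauss_quad (K : 'M[R]_d) : K^T = K -> posdefmx K ->
  0 < Int (fun x => expR (- (quad_form K x / 2))) /\
  Int (fun x => expR (- (quad_form K x / 2))) = Num.sqrt ((2 * pi) ^+ d / \det K).
Proof.
move=> Ksym Kpos; have [det0 intK] := integral_gauss_quad 0 Ksym Kpos.
have -> : Int (fun x => expR (- (quad_form K x / 2))) = Num.sqrt ((2 * pi) ^+ d / \det K).
  have := congr1 fine intK; rewrite [fine _%:E]/= => <-.
  rewrite /Int /Rintegral; apply: (congr1 fine).
  by apply: eq_integral => t _; rewrite subr0.
by rewrite sqrtr_gt0 divr_gt0// exprn_gt0// mulr_gt0// pi_gt0.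
Qed.

(** The prefactor of the density is recognized as the inverse of the total Gaussian integral. The
    mean thereby takes the same quotient form as in [gibbs_mean]. *)
Lemma mvnormal_mean (K Sigma : 'M[R]_d) (f : 'cV[R]_d -> R) (C a : R) :
  K^T = K -> invmx Sigma = K -> \det Sigma = (\det K)^-1 ->
  0 < a -> (forall x, a * nsq x <= quad_form K x) ->
  continuous f -> (forall x, `|f x| <= C) ->
  \int[mvnormal 0 Sigma]_t f (col_of_tuple t) =
  Int (fun x => f x * expR (- (quad_form K x / 2))) /
  Int (fun x => expR (- (quad_form K x / 2))).
Proof.
move=> Ksym SK detS a0 aK cf fC.
have Kpos : posdefmx K by move=> x x0; rewrite (lt_le_trans _ (aK x))// mulr_gt0// nsq_gt0.
have [_ ->] := Int_gauss_quad Ksym Kpos.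
pose g (x : 'cV[R]_d) : R := expR (- (quad_form K x / 2)).
have cg : continuous g.
  rewrite (_ : g = fun x => expR (- (quad_form K (x - 0) / 2))).
    exact: continuous_gauss_quad.
  by apply/funext => x; rewrite subr0.
have ifg : integrableC (fun x => f x * g x).
  apply: (@integrableC_dom _ _ _ C a 0 a0); first exact: continuous_mulR.
  move=> x; rewrite subr0 normrM ler_pM// /g ger0_norm ?expR_ge0// /gauss ler_expR lerN2.
  by have := aK x; lra.
rewrite (integral_mvnormal _ cf).
rewrite [RHS]mulrC.
rewrite -(IntZ _ ifg).
apply: (congr1 Int).
apply/funext => x.
by rewrite /mvnormal_pdf SK subr0 detS mulrCA.
Qed.

End GaussianLaw.

Lemma tens1_1 (R : comPzRingType) (m n : nat) :
  (1%:M : 'M[R]_m) *t (1%:M : 'M[R]_n) = 1%:M.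
Proof.
apply/matrixP => i j; case: (mxtens_indexP i) => k1 c1.
case: (mxtens_indexP j) => k2 c2; rewrite tensmxE !mxE.
rewrite (inj_eq (can_inj (@mxtens_indexK m n))) xpair_eqE -natrM.
by rewrite mulnb.
Qed.

(** * Covariance matrices of Kronecker form *)

Section TensorPosDef.
Context {R : realType} {s r : nat}.
Implicit Types (M : 'M[R]_s).

Lemma trmx_tens1 M : M^T = M -> (M *t (1%:M : 'M[R]_r))^T = M *t 1%:M.
Proof. by move=> Msym; rewrite trmx_tens Msym trmx1. Qed.

Lemma posdef_tens1 M : posdefmx M -> posdefmx (M *t (1%:M : 'M[R]_r)).
Proof.
move=> Mpos x x0; rewrite quad_form_tens1.
have [l xl] : exists l, slice x l != 0.
  apply/existsP; apply: contraNT x0; rewrite negb_exists => /forallP x0.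
  apply/eqP/matrixP => i j; rewrite ord1 -(mxtens_unindexK i).
  case: (mxtens_unindex i) => k l.
  have := x0 l; rewrite negbK => /eqP /matrixP /(_ k 0).
  by rewrite !mxE.
rewrite (bigD1 l)//= ltr_wpDr ?Mpos// sumr_ge0// => l' _.
have [->|/Mpos/ltW//] := eqVneq (slice x l') 0.
by rewrite /quad_form mulmx0 mxE.
Qed.

Lemma tens1_inv M : M^T = M -> posdefmx M ->
  let Sigma := invmx M *t (1%:M : 'M[R]_r) in
  [/\ Sigma^T = Sigma, posdefmx Sigma, Sigma \in unitmx,
      invmx Sigma = M *t 1%:M & \det Sigma = (\det (M *t (1%:M : 'M[R]_r)))^-1].
Proof.
move=> Msym Mpos Sigma; have Mu := posdef_unitmx Msym Mpos.
have [Isym Ipos] := posdef_invmx Msym Mpos.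
have Ssym := trmx_tens1 Isym; have Spos := posdef_tens1 Ipos.
have Su := posdef_unitmx Ssym Spos.
have SM : Sigma *m (M *t 1%:M) = 1%:M.
  by rewrite tensmx_mul mulVmx// mulmx1 tens1_1.
split => //.
  by rewrite -[RHS](mulKmx Su) SM mulmx1.
have := congr1 determinant SM; rewrite det_mulmx det1 => h.
have dM : \det (M *t (1%:M : 'M[R]_r)) != 0.
  by apply: contra_eq_neq h => ->; rewrite mulr0 eq_sym oner_neq0.
by apply: (mulIf dM); rewrite h mulVf.
Qed.

End TensorPosDef.

Section LimitInteraction.
Context {R : realType} {s q : nat}.
Variables (gamma : 'I_s -> R) (A : 'M[R]_s).
Local Notation D := (sqrt_diag_mx (diag_mx (\row_k gamma k))).
Local Notation B := (D *m A *m D).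

Lemma limit_interactionE :
  limit_interaction q gamma A = B *t (1%:M : 'M[R]_q).
Proof.
rewrite /limit_interaction.
have -> : map_mx Num.sqrt (diag_mx (\row_k gamma k) *t (1%:M : 'M[R]_q)) =
    D *t (1%:M : 'M[R]_q).
  apply/matrixP => i j; case: (mxtens_indexP i) => k1 c1.
  case: (mxtens_indexP j) => k2 c2; rewrite mxE !tensmxE !mxE.
  by case: (eqVneq c1 c2) => _; rewrite ?mulr1n ?mulr0n ?mulr1 ?mulr0 ?sqrtr0.
by rewrite !tensmx_mul !mulmx1.
Qed.

Lemma quad_form_limit_le lam v : (0 < q)%N -> 0 < lam ->
  spectral_norm (limit_interaction q gamma A) <= lam ->
  quad_form B v <= lam * nsq v.
Proof.
move=> q0 lam0; rewrite limit_interactionE => Llam.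
pose c0 : 'I_q := Ordinal q0.
(* [v] is placed in a single color: the form of [B (x) I] at [x] is that of [B] at [v], and the
   squared norms agree, so the spectral bound passes to [B]. *)
pose x : 'cV[R]_(s * q) := \col_i
  let: (k, c) := mxtens_unindex i in if c == c0 then v k 0 else 0.
have xs c : slice x c = if c == c0 then v else 0.
  apply/matrixP => k j; rewrite ord1 !mxE mxtens_indexK.
  by case: ifP; rewrite ?mxE.
have := quad_form_le_spectral x lam0 Llam.
rewrite quad_form_tens1 nsq_slice (bigD1 c0)//= [in leRHS](bigD1 c0)//=.
rewrite !xs eqxx big1 ?addr0 => [|c /negbTE cc0]; last first.
  by rewrite xs cc0 /quad_form mulmx0 mxE.
rewrite big1 ?addr0// => c /negbTE cc0.
by rewrite xs cc0 /nsq big1// => k _; rewrite mxE expr0n.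
Qed.

Lemma trmx_limit : A^T = A -> B^T = B.
Proof.
move=> Asym; have Dsym : D^T = D.
  by rewrite map_trmx tr_diag_mx.
by rewrite !trmx_mul Dsym Asym mulmxA.
Qed.

End LimitInteraction.

(** The constant of [hamiltonianE] and the uniform weight cancel in the quotient. The factor [1 *]
    keeps the denominator an instance of the numerator, so one limit theorem treats both. *)
Lemma gibbs_mean (R : realType) (s q N : nat) (S : 'I_s -> {set 'I_N})
    (Rot : 'M[R]_q.+2) (A : 'M[R]_s) (f : 'cV[R]_(s * q.+1) -> R) :
  block_partition S -> rotation_to_last Rot ->
  let X := rotated_magnetization S Rot in
  let E h := \sum_(w : {ffun 'I_N -> 'I_q.+2}) (q.+2%:R ^+ N)^-1 * h (X w) in
  let b := quad_form (interaction_mx S A *t 1%:M) in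
  \sum_(w : {ffun 'I_N -> 'I_q.+2}) gibbs S A w * f (X w) =
  E (fun x => f x * expR (b x / 2)) / E (fun x => 1 * expR (b x / 2)).
Proof.
move=> Spart RotP X E b; have [K HK] := hamiltonianE Spart RotP A.
rewrite /E -!mulr_sumr -mulf_div divff ?mul1r; last first.
  by rewrite invr_eq0 expf_neq0// pnatr_eq0.
rewrite /gibbs.
set Z := \sum_(w : {ffun 'I_N -> 'I_q.+2}) expR (b (X w) / 2).
have ZE : \sum_(w : {ffun 'I_N -> 'I_q.+2}) expR (- hamiltonian S A w) = expR K * Z.
  by rewrite mulr_sumr; apply: eq_bigr => w _; rewrite HK expRD.
rewrite ZE mulr_suml; apply: eq_bigr => w _.
by rewrite HK expRD invfM mulrACA divff ?mul1r ?gt_eqF ?expR_gt0//; ring.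
Qed.

(** * Convergence under the Gibbs measure *)

Section PottsCLT.
Context {R : realType} {s q : nat}.
Variables (S : forall N, 'I_s -> {set 'I_N}) (gamma : 'I_s -> R)
  (Rot : 'M[R]_q.+2) (A : 'M[R]_s).
Hypotheses (S_partition : forall N, (s <= N)%N -> block_partition (S N))
  (gammaP : forall k, (fun N => #|S N k|%:R / N%:R : R) @ \oo --> gamma k)
  (gamma_gt0 : forall k, 0 < gamma k) (RotP : rotation_to_last Rot)
  (Asym : A^T = A)
  (A_lt : spectral_norm (limit_interaction q.+2 gamma A) < zeta q.+2).
Local Notation D := (sqrt_diag_mx (diag_mx (\row_k gamma k))).
Local Notation B := (D *m A *m D).
Local Notation Q := (q.+2%:R : R).
Local Notation M := (Q%:M - B).
Local Notation mag N := (rotated_magnetization (S N) Rot).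
Local Notation Sigma := (invmx M *t (1%:M : 'M[R]_q.+1)).
Local Notation Z := (zeta q.+2 : R).
Local Notation b := (quad_form (B *t (1%:M : 'M[R]_q.+1))).
Local Notation b_ N := (quad_form (interaction_mx (S N) A *t (1%:M : 'M[R]_q.+1))).

(** Two levels below [zeta] are needed: [lam0] bounds the limiting form, and [lam] leaves room for
    the forms at finite [N], which lie below it only eventually. The maximum with 0 secures positive
    levels directly. *)
Lemma subcritical : exists lam0 lam : R,
  [/\ 0 < lam0, lam0 < lam, lam < Z & forall v, quad_form B v <= lam0 * nsq v].
Proof.
pose L := spectral_norm (limit_interaction q.+2 gamma A).
have LZ : L < Z by [].
have Z0 : 0 < Z by exact: zeta_gt0.
pose lam0 := (Num.max L 0 + Z) / 2.
have m0 : 0 <= Num.max L 0 by rewrite le_max lexx orbT.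
have mL : L <= Num.max L 0 by rewrite le_max lexx.
have mZ : Num.max L 0 < Z by rewrite gt_max LZ Z0.
exists lam0, ((lam0 + Z) / 2); split; rewrite /lam0; try lra.
move=> v; apply: (@quad_form_limit_le _ _ q.+2); [by []|lra|rewrite -/L; lra].
Qed.

Lemma trmx_covinv : M^T = M.
Proof. by rewrite linearB /= tr_scalar_mx trmx_limit. Qed.

Lemma quad_form_covinv v : quad_form M v = Q * nsq v - quad_form B v.
Proof.
rewrite -quad_form_scalar /quad_form mulmxBr mulmxBl [LHS]mxE; congr (_ + _).
by rewrite mxE.
Qed.

Lemma posdef_covinv : posdefmx M.
Proof.
move=> v v0; have [lam0 [lam [l0 l1 l2 Bv]]] := subcritical.
have ZQ : Z <= Q by exact: zeta_le.
have n0 := nsq_gt0 v0.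
rewrite quad_form_covinv subr_gt0 (le_lt_trans (Bv v))// ltr_pM2r//; lra.
Qed.

Lemma uniform_sum1 N : \sum_(w : {ffun 'I_N -> 'I_q.+2}) (Q ^+ N)^-1 = 1.
Proof.
rewrite sumr_const card_ffun !card_ord -[_ *+ _]mulr_natr natrX mulVf//.
Qed.

Lemma quad_form_tens1_le (C : 'M[R]_s) lam (x : 'cV[R]_(s * q.+1)) :
  (forall v, quad_form C v <= lam * nsq v) ->
  quad_form (C *t 1%:M) x <= lam * nsq x.
Proof.
move=> Cle; rewrite quad_form_tens1 nsq_slice mulr_sumr.
by apply: ler_sum => l _; exact: Cle.
Qed.

Lemma tilted_mean_cvg (f : 'cV[R]_(s * q.+1) -> R) (C : R) :
  continuous f -> (forall x, `|f x| <= C) ->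
  (fun N => \sum_(w : {ffun 'I_N -> 'I_q.+2}) (Q ^+ N)^-1 *
     (f (mag N w) * expR (b_ N (mag N w) / 2))) @ \oo -->
  (gauss_mass (s * q.+1) Q)^-1 *
    Int (fun x => f x * expR (- (quad_form (M *t 1%:M) x / 2))).
Proof.
move=> cf fC; have [lam0 [lam [l0 l1 l2 Bv]]] := subcritical.
have [e e0 eB] := interaction_mx_dist_cvg gammaP A.
have near_s : \forall N \near \oo, (s <= N)%N by exact: nbhs_infty_ge.
have b_near N x : `|b_ N x - b x| <= s%:R * e N * nsq x.
  exact: quad_form_tens1_dist_le.
have b_le x : b x <= lam0 * nsq x by exact: quad_form_tens1_le.
have se0 : (fun N => s%:R * e N) @ \oo --> 0.
  by rewrite -[0 in X in _ --> X](mulr0 s%:R); apply: cvgM => //; exact: cvg_cst.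
have MbE x : expR (b x / 2) * gauss Q x = expR (- (quad_form (M *t 1%:M) x / 2)).
  rewrite /gauss -expRD; congr expR.
  rewrite !quad_form_tens1; under [in RHS]eq_bigr do rewrite quad_form_covinv.
  by rewrite sumrB -mulr_sumr -nsq_slice; field.
rewrite (_ : (fun x => _ * expR (- _)) = (fun x => f x * expR (b x / 2) * gauss Q x)); last first.
  by apply/funext => x; rewrite -mulrA MbE.
apply: (@tilted_cvg R (s * q.+1) (fun N => {ffun 'I_N -> 'I_q.+2})
  (fun N _ => (Q ^+ N)^-1) (fun N => mag N) Q Z _ _ _ _ _ _ b (fun N => b_ N)
  (fun N => s%:R * e N) lam f C) => //.
- exact: uniform_sum1.
- exact: zeta_gt0.
- move=> t c; have mw0 := max_weight_cvg gamma_gt0 gammaP t.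
  have dlt0 : (fun N => 2 * max_weight (S N) t * nsq t) @ \oo --> 0.
    rewrite -[0 in X in _ --> X](mul0r (nsq t)); apply: cvgM; last exact: cvg_cst.
    by rewrite -[0 in X in _ --> X](mulr0 2); apply: cvgM => //; exact: cvg_cst.
  apply/cvgrPdist_le => eps eps0; near=> N.
  rewrite distrC (le_trans (@uniform_cos_dist R s q N (S N) Rot _ RotP t c _))//.
  + by apply: S_partition; near: N; exact: near_s.
  + by near: N; apply: (cvgr_le _ mw0).
  + by near: N; apply: (cvgr_le _ dlt0).
- near=> N => t; apply: uniform_mgf_le => //; apply: S_partition; near: N.
  exact: near_s.
- lra.
- exact: zeta_le.
- exact: continuous_quad_form.
- move=> x; rewrite (le_trans (b_le x))// ler_wpM2r ?nsq_ge0//; lra.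
(* The margin between the two levels absorbs the error [s e_N] once [N] is large. *)
- have lam_lam0 : 0 < lam - lam0 by lra.
  near=> N => x.
  have h : s%:R * e N < lam - lam0.
    by near: N; apply: (cvgr_lt _ se0).
  have := b_near N x; rewrite ler_norml => /andP[_].
  rewrite lerBlDr => /le_trans; apply; rewrite (@le_trans _ _ (s%:R * e N * nsq x + lam0 * nsq x))//.
    by rewrite lerD2l.
  rewrite -mulrDl ler_wpM2r ?nsq_ge0//; lra.
Unshelve. all: by end_near.
Qed.

(** The tilted limit is applied to [f] and to the constant 1, and the limits are divided; the
    Gaussian mass common to both drops out, and the denominator is a positive Gaussian integral. *)
Lemma gibbs_cvg : cvg_in_distribution (fun N => gibbs (S N) A)
  (fun N => mag N) (mvnormal 0 Sigma).
Proof.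
have [Ssym Spos Su SinvE SdetE] := tens1_inv (r := q.+1) trmx_covinv posdef_covinv.
have Mtsym := trmx_tens1 (r := q.+1) trmx_covinv.
have Mtpos := posdef_tens1 (r := q.+1) posdef_covinv.
have [lam0 [lam [l0 l1 l2 Bv]]] := subcritical.
have ZQ : Z <= Q by exact: zeta_le.
have [V0 _] := Int_gauss_quad Mtsym Mtpos.
move=> f cf [C fC].
have Mle x : (Q - lam0) * nsq x <= quad_form (M *t (1%:M : 'M[R]_q.+1)) x.
  rewrite quad_form_tens1 nsq_slice mulr_sumr; apply: ler_sum => l _.
  by rewrite quad_form_covinv mulrBl lerD2l lerN2.
have Qlam : 0 < Q - lam0 by lra.
rewrite (mvnormal_mean Mtsym SinvE SdetE Qlam Mle cf fC).
set If := Int _; set I1 := Int _ in V0 *.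
set G := gauss_mass (s * q.+1) Q.
have G0 : 0 < G by rewrite gauss_mass_gt0// ltr0n.
have -> : If / I1 = (G^-1 * If) / (G^-1 * I1).
  by rewrite -mulf_div divff ?mul1r// invr_eq0 gt_eqF.
have c1 : forall x : 'cV[R]_(s * q.+1), `|1 : R| <= 1 by move=> _; rewrite normr1.
have lim1 := tilted_mean_cvg (@continuous_cstR _ _ (1 : R)) c1.
rewrite (_ : (fun x => 1 * expR _) = fun x => expR (- (quad_form (M *t 1%:M) x / 2))) -/I1 -/G in lim1; last first.
  by apply/funext => x; rewrite mul1r.
have nz : G^-1 * I1 != 0 by rewrite gt_eqF// mulr_gt0// invr_gt0.
apply: cvg_trans (cvgM (tilted_mean_cvg cf fC) (cvgV nz lim1)).
(* The quotient formula relies on a genuine partition, available from [N = s] on, so the two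
   sequences agree only eventually. *)
apply: near_eq_cvg; near=> N; apply/esym; apply: gibbs_mean => //.
by apply: S_partition; near: N; exact: nbhs_infty_ge.
Unshelve. all: by end_near.
Qed.

End PottsCLT.

Lemma block_limit_mxE (R : realType) (s : nat) (gamma : 'I_s -> R) (A : 'M[R]_s) :
  (forall k, gamma k = s%:R^-1) ->
  let D := sqrt_diag_mx (diag_mx (\row_k gamma k)) in
  D *m A *m D = s%:R^-1 *: A.
Proof.
move=> gE; apply/matrixP => i j.
by rewrite limit_mxE !gE -expr2 sqr_sqrtr ?invr_ge0// mxE.
Qed.

Theorem theorem5 (R : realType) (s q : nat) (s_ge1 : (1 <= s)%N)
    (q_ge2 : (2 <= q)%N)
    (S : forall N, 'I_s -> {set 'I_N})
    (S_partition : forall N, (s <= N)%N -> block_partition (S N))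
    (gamma : 'I_s -> R)
    (gammaP : forall k, (fun N => #|S N k|%:R / N%:R : R) @ \oo --> gamma k)
    (Rot : 'M[R]_q) (RotP : rotation_to_last Rot) :
  (forall alpha beta : R, 0 < alpha -> alpha < beta ->
    let A := block_interaction s alpha beta in
    (forall k, gamma k = s%:R^-1) ->
    spectral_norm (limit_interaction q gamma A) < zeta q ->
    let M := q%:R%:M - s%:R^-1 *: A in
    let Sigma := invmx M *t (1%:M : 'M[R]_q.-1) in
    [/\ cvg_in_distribution (fun N => gibbs (S N) A)
          (fun N => rotated_magnetization (S N) Rot) (mvnormal 0 Sigma),
        M \in unitmx, Sigma \in unitmx & Sigma^T = Sigma /\ posdefmx Sigma])
  /\
  (forall A : 'M[R]_s, A^T = A -> posdefmx A -> (forall j k, 0 < A j k) ->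
    (forall k, 0 < gamma k) ->
    spectral_norm (limit_interaction q gamma A) < 4 * (q%:R - 1) / q%:R ->
    let D := sqrt_diag_mx (diag_mx (\row_k gamma k)) in
    let M := q%:R%:M - D *m A *m D in
    let Sigma := invmx M *t (1%:M : 'M[R]_q.-1) in
    [/\ cvg_in_distribution (fun N => gibbs (S N) A)
          (fun N => rotated_magnetization (S N) Rot) (mvnormal 0 Sigma),
        M \in unitmx, Sigma \in unitmx & Sigma^T = Sigma /\ posdefmx Sigma]).
Proof.
(* Writing the number of colors as [q + 2] makes [q.-1] compute to the dimension [q + 1] used in the
   finite-volume lemmas. *)
case: q q_ge2 Rot RotP => [//|[//|{}q]] _ {}Rot {}RotP; split.
- move=> alpha beta _ _ A gE A_lt M Sigma.
  have g0 k : 0 < gamma k by rewrite gE invr_gt0 ltr0n.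
  have Asym : A^T = A.
    by rewrite /A /block_interaction linearD linearZ /= trmx_const tr_scalar_mx.
  have ME : M = q.+2%:R%:M - sqrt_diag_mx (diag_mx (\row_k gamma k)) *m A *m
      sqrt_diag_mx (diag_mx (\row_k gamma k)) by rewrite block_limit_mxE.
  have Msym := trmx_covinv (q := q) gamma Asym.
  have Mpos := posdef_covinv A_lt.
  have [Ssym Spos Su _ _] := tens1_inv (r := q.+1) Msym Mpos.
  rewrite /Sigma ME; split => //; first exact: gibbs_cvg.
  exact: posdef_unitmx.
- move=> A Asym _ _ g0 A_lt D M Sigma.
  have {}A_lt : spectral_norm (limit_interaction q.+2 gamma A) < zeta q.+2.
    by rewrite (lt_le_trans A_lt)// zeta_ge.
  have Msym := trmx_covinv (q := q) gamma Asym.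
  have Mpos := posdef_covinv A_lt.
  have [Ssym Spos Su _ _] := tens1_inv (r := q.+1) Msym Mpos.
  split => //; first exact: gibbs_cvg.
  exact: posdef_unitmx.
Qed.
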